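(* (Maximum principle.) Let $(x_0,K_0)\in[0,\bar x]\times[0,\infty)$ and let $(x,K,u,\mu)$ be a solution (optimal process) of the problem $P(x_0,K_0)$. Define $$\widetilde H(t,\check x,\check K,w,\tilde\lambda_1,\tilde\lambda_2,\eta):=\tilde\lambda_1(F(\check x)-w\check K\check x)-\tilde\lambda_2\gamma\check K-\eta e^{-\delta t}(c-p\check x)w\check K .$$ Then there exist $\tilde\lambda_{1,0},\tilde\lambda_{2,0},\eta\in\mathbb R$ and functions $\tilde\lambda_1,\tilde\lambda_2:[0,\infty)\to\mathbb R$ such that $$\tilde\lambda_{1,0}^2+\tilde\lambda_{2,0}^2+\eta^2\ne0,\qquad \eta\ge0,$$ $$\tilde\lambda_1'=-\tilde\lambda_1(F'(x)-u(t)K)-\eta e^{-\delta t}pu(t)K,\qquad \tilde\lambda_1(0)=\tilde\lambda_{1,0},$$ $$\tilde\lambda_2'=\tilde\lambda_1xu(t)+\gamma\tilde\lambda_2+\eta e^{-\delta t}(c-px)u(t),\qquad \tilde\lambda_2(0)=\tilde\lambda_{2,0},$$ $$\tilde\lambda_2(t)-\eta e^{-\delta t}r\le0\ \text{ for all }t\in[0,\infty),\qquad \tilde\lambda_2(t)-\eta e^{-\delta t}r=0\ \ \mu\text{-a.e. in }[0,\infty),$$ $$\widetilde H(t,x(t),K(t),u(t),\tilde\lambda_1(t),\tilde\lambda_2(t),\eta)=\max_{w\in[0,1]}\widetilde H(t,x(t),K(t),w,\tilde\lambda_1(t),\tilde\lambda_2(t),\eta)\ \text{ for a.e. }t\in[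0,\infty).$$
   Context: $F\in C^2[0,\infty)$ and $\bar x>0$ satisfy $F(0)=F(\bar x)=0$, $F(x)>0$ for $0<x<\bar x$, $F''(x)<0$ for $0\le x\le\bar x$; $\delta>0$ and $\gamma,p,c,r\ge0$ are constants. **Problem $P(x_0,K_0)$.** Minimize $$J(x_0,K_0;\mu,u)=\int_{[0,\infty)}e^{-\delta t}r\,\mu(dt)+\int_0^\infty e^{-\delta t}(c-px(t))u(t)K(t)\,dt$$ over $u\in L_\infty[0,\infty)$ with $0\le u\le1$ a.e. and non-negative Borel measures $\mu$ on $[0,\infty)$, subject to $x'=F(x)-u(t)Kx$, $x(0)=x_0$, and $dK=-\gamma K\,dt+\mu(dt)$, $K(0)=K_0$. The last equation means $K(t)=K_0-\int_0^t\gamma K(s)\,ds+\mu([0,t])$ for $t>0$, so $K$ is right continuous on $(0,\infty)$ and may jump at $t=0$ from $K_0$ to $K_0+\mu(\{0\})$. The differential equations for $x,\tilde\lambda_1,\tilde\lambda_2$ are understood in the Carathéodory sense (absolutely continuous solutions, equation a.e.). *)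

(* Defs.v *)
From HB Require Import structures.
From mathcomp Require Import all_boot all_order all_algebra.
From mathcomp Require Import all_classical all_reals all_analysis.
Set Implicit Arguments.
Unset Strict Implicit.
Unset Printing Implicit Defensive.
Import Order.TTheory GRing.Theory Num.Theory.
Import numFieldNormedType.Exports.
Local Open Scope classical_set_scope.
Local Open Scope ring_scope.

(* Derivative on the closed half-line: one-sided at 0. Functions on [0, +oo[
   are total functions whose values at negative arguments play no role. *)
Definition is_deriv_halfline (R : realType) (f f' : R -> R) : Prop :=
  forall a : R, 0 <= a ->
    (f y - f a) / (y - a) @[y --> within `[0, +oo[ a^'] --> f' a.

(* F is C^2 on [0, +oo[, with first and second derivatives F' and F''. *)
Definition is_C2_halfline (R : realType) (F F' F'' : R -> R) : Prop :=
  [/\ is_deriv_halfline F F', is_deriv_halfline F' F''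
    & {within `[0, +oo[, continuous F''}].

Definition absolutely_continuous_on (R : realType) (a b : R) (f : R -> R) :
    Prop :=
  forall e : R, 0 < e -> exists2 d : R, 0 < d &
    forall (n : nat) (I : 'I_n -> R * R),
      (forall i, a <= (I i).1 /\ (I i).1 <= (I i).2 /\ (I i).2 <= b) ->
      trivIset [set: 'I_n] (fun i => `](I i).1, (I i).2[%classic) ->
      \sum_(i < n) ((I i).2 - (I i).1) < d ->
      \sum_(i < n) `|f (I i).2 - f (I i).1| < e.

(* Caratheodory solution on [0, +oo[ of y' = g(t), y(0) = y0, where g(t) is the
   right-hand side evaluated along the solution. Absolute continuity is
   required on every compact subinterval. *)
Definition caratheodory (R : realType) (y g : R -> R) (y0 : R) : Prop :=
  [/\ y 0 = y0,
      forall T : R, 0 <= T -> absolutely_continuous_on 0 T y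
    & {ae @lebesgue_measure R, forall t : R, 0 <= t -> is_derive t 1 y (g t)}].

(* (x, K, u, mu) satisfies the constraints of P(x0, K0).
   - A Borel measure on [0, +oo[ is a Borel measure on R that gives no mass to
     the negative half-line.
   - 0 <= x t is the requirement that F, defined on [0, +oo[, can be evaluated
     along x.
   - K is real-valued, so the last clause, an equality in \bar R, forces
     mu [0, t] to be finite. *)
Definition admissible (R : realType) (F : R -> R) (gamma x0 K0 : R)
    (x K u : R -> R) (mu : {measure set (measurableTypeR R) -> \bar R}) :
    Prop :=
  [/\ measurable_fun (`[0%R, +oo[%classic : set R) u /\
        {ae @lebesgue_measure R, forall t : R, 0 <= t -> 0 <= u t <= 1},
      mu (`]-oo, 0%R[%classic : set R) = 0%E,
      (forall t : R, 0 <= t -> 0 <= x t) /\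
        caratheodory x (fun t => F (x t) - u t * K t * x t) x0,
      K 0 = K0
    & forall t : R, 0 < t ->
        (@lebesgue_measure R).-integrable `[0, t] (EFin \o K) /\
        (K t)%:E =
          (K0%:E - \int[@lebesgue_measure R]_(s in `[0%R, t]) (gamma * K s)%:E
           + mu (`[0%R, t]%classic : set R))%E].

(* Extended-real valued. For admissible processes the second integral is never
   -oo, since the integral of u K x over [0, T] grows at most linearly in T; so
   the sum is never of the form +oo - oo. *)
Definition cost (R : realType) (delta p c r : R) (x K u : R -> R)
    (mu : {measure set (measurableTypeR R) -> \bar R}) : \bar R :=
  (\int[mu]_(t in `[0%R, +oo[) (expR (- delta * t) * r)%:E +
   \int[@lebesgue_measure R]_(t in `[0%R, +oo[)
      (expR (- delta * t) * (c - p * x t) * u t * K t)%:E)%E.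

Definition optimal (R : realType) (F : R -> R) (delta gamma p c r x0 K0 : R)
    (x K u : R -> R) (mu : {measure set (measurableTypeR R) -> \bar R}) :
    Prop :=
  admissible F gamma x0 K0 x K u mu /\
  forall (y L v : R -> R) (nu : {measure set (measurableTypeR R) -> \bar R}),
    admissible F gamma x0 K0 y L v nu ->
    (cost delta p c r x K u mu <= cost delta p c r y L v nu)%E.

Definition Htilde (R : realType) (F : R -> R) (delta gamma p c : R)
    (t x K w l1 l2 eta : R) : R :=
  l1 * (F x - w * K * x) - l2 * gamma * K
  - eta * expR (- delta * t) * (c - p * x) * w * K.

Definition is_max (R : realType) (A : set R) (m : R) : Prop :=
  A m /\ ubound A m.

(* Main.v *)
(* Write [w = u K]. Concavity gives [F'(x) <= F(x)/x], so the flow linearized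
   along [x > 0] is dominated by [x] itself; hence the adjoint equation has a
   solution [l1] with [l1 x = O(exp (- delta t))], and perturbing [w] to [w + e h]
   with [h] bounded changes the running cost by [e \int sigma h + O(e^2)] over the
   whole half-line, where [sigma = l1 x + exp (- delta t) (c - p x)].
   With [eta = 1] and
   [l2(t) = - \int_t^oo exp (- gamma (s - t)) sigma(s) u(s) ds], three families of
   perturbations of the optimal process give the conditions: moving [u] towards
   the minimizer of [sigma w] gives the maximum condition; adding [e] times a
   Dirac mass at [a] to [mu] gives [l2(a) <= exp (- delta a) r]; removing the
   fraction [e] of [mu] on [0, n] gives equality [mu]-almost everywhere.
   The null investment costs nothing, so the optimal cost is finite, which makes
   all these comparisons meaningful.
   When [x0 = 0] the stock vanishes identically and a positive solution [l1] of
   the adjoint equation, with [l2 = 0] and [eta = 0], is a multiplier. *)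
Require Import Defs.
From HB Require Import structures.
From mathcomp Require Import all_boot all_order all_algebra.
From mathcomp Require Import all_classical all_reals all_analysis.
From mathcomp Require Import measurable_realfun lra ring.
Set Implicit Arguments.
Unset Strict Implicit.
Unset Printing Implicit Defensive.
Import Order.TTheory GRing.Theory Num.Theory.
Import numFieldNormedType.Exports.
Local Open Scope classical_set_scope.
Local Open Scope ring_scope.

(** * Absolutely continuous functions *)

Section ac_monotone.
Context {R : realType}.
Implicit Types (f g : R -> R) (a b t d e : R).
Notation leb := (@lebesgue_measure R).

(** The stock sees the control only through the effort [w], and [K] is affine in [mu]; so needle
    variations are avoided, and each first-order condition is an instance of one inequality
    [rho + \int sigma h >= 0]. The obstacle is the unbounded horizon. Neither [K] nor [w] need be
    bounded, and a Gronwall estimate would let [|y - x|] grow at the rate of a Lipschitz constant of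
    [F], which discounting need not dominate. Comparing logarithms of stocks removes this constant
    by concavity: the deviation relative to [x] grows at a rate proportional to the size of the
    perturbation, which can be taken below any fraction of [delta]. The boundary term of the adjoint
    pairing then vanishes at infinity, and this is why [eta = 1] is possible for a positive stock.
    Since [w] is merely locally integrable and the equations hold almost everywhere, the estimates
    for trajectories are reduced to one principle: an absolutely continuous function whose
    derivative is nonnegative almost everywhere is nondecreasing. *)

Lemma is_derive_approx f t d e : is_derive t 1 f d -> 0 < e ->
  exists2 rho, 0 < rho & forall y, `|y - t| < rho ->
    `|f y - f t - d * (y - t)| <= e * `|y - t|.
Proof.
move=> [df fd] e0.
have : h^-1 *: (f (h *: 1 + t) - f t) @[h --> 0^'] --> d.
  by rewrite -fd; exact: df.
move=> /cvgrPdist_le /(_ e e0) [rho rho0 H].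
exists rho => // y yt.
have [->|ny] := eqVneq y t; first by rewrite !subrr mulr0 subr0 normr0 mulr0.
have yt0 : y - t != 0 by rewrite subr_eq0.
have := H (y - t); rewrite /= sub0r normrN => /(_ yt yt0).
rewrite [(y - t) *: 1]mulr1 subrK => H'.
rewrite (_ : _ - _ - _ = - ((d - (y - t)^-1 * (f y - f t)) * (y - t))); last first.
  by field.
by rewrite normrN normrM ler_wpM2r.
Qed.

(** Cousin's lemma in straddling form: a step from [s] to [s'] only has to contain its tag [t],
    which is where pointwise differentiability gives information. One step tagged at the supremum of
    the points satisfying [P] leaps past it, unless it is [b]. *)
Lemma cousin_induction a b (P : R -> Prop) : a <= b -> P a ->
  (forall t, a <= t <= b -> exists2 rho, 0 < rho &
     forall s s', a <= s -> s <= t -> t <= s' -> s' <= b ->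
       t - rho < s -> s' < t + rho -> P s -> P s') ->
  P b.
Proof.
move=> ab Pa step.
pose S := [set t | a <= t <= b /\ P t].
have Sa : S a by rewrite /S /= lexx ab.
have hsup : has_sup S by split; [exists a|exists b => t [/andP[]]].
have as_ : a <= sup S by apply: ub_le_sup => //; case: hsup.
have sb : sup S <= b by apply: ge_sup; [exists a|move=> t [/andP[]]].
have [|rho rho0 H] := step (sup S); first by rewrite as_ sb.
have [t [/andP[at_ tb] Pt] st] := sup_adherent rho0 hsup.
have ts : t <= sup S by apply: ub_le_sup; [case: hsup|split=> //; rewrite at_ tb].
pose s' := Order.min b (sup S + rho / 2).
have ss' : sup S <= s' by rewrite le_min sb/= lerDl; lra.
have s'b : s' <= b by rewrite ge_min lexx.
have Ps' : P s'.
  apply: (H t s') => //.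
  by rewrite gt_min; apply/orP; right; rewrite ltrD2l; lra.
have : s' <= sup S.
  apply: ub_le_sup; first by case: hsup.
  by split=> //; rewrite s'b (le_trans as_ ss').
rewrite ge_min => /orP[bs|]; last by lra.
suff -> : b = s' by [].
by apply/esym/eqP; rewrite eq_le s'b (le_trans bs ss').
Qed.

(** The exceptional null set is covered by an open [U] so small that, by absolute continuity, the
    increments of [f] over disjoint intervals in [U] sum to less than [e]. A step tagged elsewhere
    loses at most [e] per unit length, the derivative at its tag being nonnegative. *)
Lemma ac_nondecreasing f a b : a <= b -> absolutely_continuous_on a b f ->
  {ae leb, forall t, a <= t <= b -> exists2 d : R, is_derive t 1 f d & 0 <= d} ->
  f a <= f b.
Proof.
move=> ab acf [N [mN N0 HN]].
suff H (e : R) : 0 < e -> f a - f b <= e * (b - a) + e.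
  rewrite -subr_le0; apply/ler_addgt0Pr => e e0; rewrite add0r.
  have e1 : 0 < e / (b - a + 1) by apply: divr_gt0 => //; lra.
  apply: le_trans (H _ e1) _.
  by rewrite -{2}[_ / _]mulr1 -mulrDr divfK//; lra.
move=> e0.
have [d d0 Hd] := acf e e0.
have [U [oU NU UN]] : exists U, [/\ open U, N `<=` U & (leb U < d%:E)%E].
  have [|U [oU NU HU]] := @lebesgue_regularity_outer R N d mN _ d0.
    by apply: (@le_lt_trans _ _ 0%E) => //; rewrite le_eqVlt; apply/orP; left; exact/eqP.
  exists U; split => //; apply: le_lt_trans HU.
  have mU : measurable U by exact: open_measurable.
  rewrite -[leRHS]adde0 -[X in (_ + X)%E]N0.
  apply: le_trans (measureU2 _ _ _) => //; last exact: measurableD.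
  by apply: le_measure; rewrite ?inE//; [apply: measurableU => //; exact: measurableD|
    move=> z Uz; have [Nz|nNz] := pselect (N z); [right|left]].
(* State of the induction: the steps tagged in [N] are kept as an ordered list of intervals inside
   [U]; the losses of all other steps are absorbed in [e * (t - a)]. *)
pose P t := exists n (I : nat -> R * R), [/\
  forall i, (i < n)%N -> a <= (I i).1 /\ (I i).1 <= (I i).2 /\ (I i).2 <= t,
  forall i j, (i < j < n)%N -> (I i).2 <= (I j).1,
  forall i, (i < n)%N -> `](I i).1, (I i).2[ `<=` U &
  f a - f t <= e * (t - a) + \sum_(i < n) `|f (I i).2 - f (I i).1| ].
have : P b.
  apply: (@cousin_induction a) => //.
    exists 0%N, (fun=> (0, 0)); split=> //.
    by rewrite big_ord0 !subrr mulr0 addr0.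
  move=> t /andP[at_ tb].
  have [Nt|nNt] := pselect (N t).
    have [rho rho0 HU] : exists2 rho, 0 < rho & ball t rho `<=` U.
      by have /nbhs_ballP[r r0 Hr] := open_nbhs_nbhs (conj oU (NU _ Nt)); exists r.
    exists rho => // s s' as_ st ts' s'b sl s'l [n [I [H1 H2 H3 H4]]].
    exists n.+1, (fun i => if i == n then (s, s') else I i); split.
    - move=> i; case: eqVneq => [->/= _|ni]; first by split => //; split => //; lra.
      rewrite ltnS leq_eqVlt (negbTE ni)/= => /H1[h1 [h2 h3]].
      by do ! split => //; lra.
    - move=> i j /andP[ij jn]; have ni : i != n by rewrite ltn_eqF// (leq_trans ij).
      rewrite (negbTE ni); case: eqVneq => [_/=|nj].
        by have [_ []] := H1 i (leq_trans ij jn).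
      by apply: H2; rewrite ij ltn_neqAle nj -ltnS.
    - move=> i; case: eqVneq => [_ _|ni].
        move=> z /=; rewrite in_itv/= => /andP[sz zs']; apply: HU.
        by rewrite /ball/= ltr_distlC; apply/andP; split; lra.
      by rewrite ltnS leq_eqVlt (negbTE ni)/= => /H3.
    rewrite big_ord_recr/= eqxx.
    under eq_bigr do rewrite ltn_eqF//.
    have h : f s - f s' <= `|f s' - f s| by rewrite -opprB -normrN ler_norm.
    have h' : 0 <= e * (s' - s) by apply: mulr_ge0; lra.
    lra.
  have [dt dft dt0] : exists2 d : R, is_derive t 1 f d & 0 <= d.
    by move: (contra_notP (HN t) nNt); apply; rewrite at_ tb.
  have [rho rho0 Hr] := is_derive_approx dft e0.
  exists rho => // s s' as_ st ts' s'b sl s'l [n [I [H1 H2 H3 H4]]].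
  exists n, I; split=> //.
    by move=> i /H1[h1 [h2 h3]]; do ! split => //; lra.
  have h1 : f s - f t <= e * (t - s).
    have := Hr s; rewrite (ler0_norm (_ : s - t <= 0)); last lra.
    move=> /(_ ltac:(lra)); rewrite ler_norml => /andP[_].
    have : dt * (s - t) <= 0 by apply: mulr_ge0_le0; lra.
    lra.
  have h2 : f t - f s' <= e * (s' - t).
    have := Hr s'; rewrite (ger0_norm (_ : 0 <= s' - t)); last lra.
    move=> /(_ ltac:(lra)); rewrite ler_norml => /andP[+ _].
    have : 0 <= dt * (s' - t) by apply: mulr_ge0; lra.
    lra.
  lra.
move=> [n [I [H1 H2 H3 H4]]].
apply: le_trans H4 _; rewrite lerD2l; apply: ltW.
pose F i := if (i < n)%N then `](I i).1, (I i).2[%classic else set0.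
have tF : trivIset [set: nat] F.
  apply/trivIsetP => i j _ _; wlog ij : i j / (i < j)%N => [wl|].
    by case: ltngtP => // ij _; [apply: wl => //; rewrite ltn_eqF|rewrite setIC; apply: wl => //; rewrite ltn_eqF].
  move=> _; rewrite /F; case: ifPn => [iln|_]; last by rewrite set0I.
  case: ifPn => [jn|_]; last by rewrite setI0.
  apply/seteqP; split=> // z [] /=; rewrite !in_itv/= => /andP[_ h1] /andP[h2 _].
  by have := H2 i j; rewrite ij jn => /(_ isT); lra.
apply: (Hd n (fun i => I (val i))).
- by move=> i; have [h1 [h2 h3]] := H1 i (ltn_ord i).
- move=> i j _ _ h; apply: val_inj; apply: (tF (val i) (val j)) => //.
  by rewrite /F !ltn_ord.
rewrite -lte_fin; apply: le_lt_trans UN.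
have mF i : measurable (F i) by rewrite /F; case: ifP.
have -> : (\sum_(i < n) ((I i).2 - (I i).1))%:E = leb (\big[setU/set0]_(i < n) F i).
  rewrite measure_bigsetU// -sumEFin; apply: eq_bigr => i _.
  rewrite /F ltn_ord.
  transitivity (lebesgue_measure (`](I i).1, (I i).2[%classic : set R)) => //.
  rewrite lebesgue_measure_itv/= lte_fin -EFinB.
  case: ltP => // h; congr EFin.
  by have [_ [h' _]] := H1 i (ltn_ord i); lra.
apply: le_measure; rewrite ?inE.
- by apply: (@bigsetU_measurable _ _ _ (index_enum _) xpredT (fun i : 'I_n => F i)) => i _; exact: mF.
- exact: (open_measurable oU).
by elim/big_ind: _ => [//|A B AU BU z [/AU|/BU]//|i _]; rewrite /F ltn_ord; exact: H3.
Qed.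
End ac_monotone.

Section ac_calculus.
Context {R : realType}.
Implicit Types (f g y : R -> R) (a b s t d e : R).
Notation leb := (@lebesgue_measure R).
Notation AC := (@absolutely_continuous_on R).

(** Common source of the closure properties: sums and products need two dominating functions,
    Lipschitz functions and compositions only one. *)
Lemma ac_dominated f f1 f2 a b (C1 C2 : R) :
  (forall s t, a <= s -> s <= t -> t <= b ->
    `|f t - f s| <= C1 * `|f1 t - f1 s| + C2 * `|f2 t - f2 s|) ->
  AC a b f1 -> AC a b f2 -> AC a b f.
Proof.
move=> H ac1 ac2 e e0.
pose C := `|C1| + `|C2| + 1.
have C1C : C1 <= C by have := ler_norm C1; have := normr_ge0 C2; rewrite /C; lra.
have C2C : C2 <= C by have := ler_norm C2; have := normr_ge0 C1; rewrite /C; lra.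
have C0 : 0 < C by have := normr_ge0 C2; have := normr_ge0 C1; rewrite /C; lra.
have e1 : 0 < e / (2 * C) by apply: divr_gt0 => //; lra.
have [d1 d10 H1] := ac1 _ e1; have [d2 d20 H2] := ac2 _ e1.
exists (Order.min d1 d2) => [|n I Iab tI]; first by rewrite lt_min d10.
rewrite lt_min => /andP[/(H1 n I Iab tI) h1 /(H2 n I Iab tI) h2].
apply: (@le_lt_trans _ _ (C * (\sum_(i < n) `|f1 (I i).2 - f1 (I i).1| +
                              \sum_(i < n) `|f2 (I i).2 - f2 (I i).1|))).
  rewrite -big_split mulr_sumr; apply: ler_sum => i _ /=.
  have [ai [ii ib]] := Iab i.
  apply: le_trans (H _ _ ai ii ib) _.
  by rewrite mulrDr; apply: lerD; apply: ler_wpM2r.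
have -> : e = C * (e / (2 * C) + e / (2 * C)) by field; rewrite gt_eqF.
by rewrite ltr_pM2l// ltrD.
Qed.

Lemma ac_id a b : AC a b id.
Proof.
move=> e e0; exists e => // n I Iab _; apply: le_lt_trans.
apply: ler_sum => i _; rewrite ger0_norm// subr_ge0.
by have [_ []] := Iab i.
Qed.

Lemma ac_lipschitz f a b (C : R) :
  (forall s t, a <= s -> s <= t -> t <= b -> `|f t - f s| <= C * (t - s)) ->
  AC a b f.
Proof.
move=> H; apply: (@ac_dominated _ id id _ _ C 0); [|exact: ac_id..].
move=> s t as_ st tb; rewrite mul0r addr0 [`|t - s|]ger0_norm ?subr_ge0//.
exact: H.
Qed.

Lemma within_continuous_eps (A : set R) f :
  (forall t, A t -> forall e, 0 < e -> exists2 d, 0 < d &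
     forall s, A s -> `|t - s| < d -> `|f t - f s| <= e) ->
  {within A, continuous f}.
Proof.
move=> H; apply/subspace_continuousP => t At; apply/cvgrPdist_le => e e0.
have [d d0 Hd] := H t At e e0.
rewrite near_withinE; exists d => //= s ts As; exact: Hd.
Qed.

Lemma ac_continuous f a b : AC a b f -> {within `[a, b], continuous f}.
Proof.
move=> acf; apply: within_continuous_eps => t; rewrite /= in_itv/= => /andP[at_ tb] e e0.
have [d d0 H] := acf e e0.
suff K s s' : a <= s -> s <= s' -> s' <= b -> `|s - s'| < d -> `|f s - f s'| <= e.
  exists d => // s; rewrite /= in_itv/= => /andP[as_ sb] ts.
  have [st|/ltW st] := leP t s; first exact: K.
  by rewrite distrC; apply: K => //; rewrite distrC.
move=> as_ ss' s'b ds; rewrite distrC; apply: ltW.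
have := H 1%N (fun=> (s, s')); rewrite !big_ord1/=; apply => //.
- by move=> i j _ _ _; rewrite (ord1 i) (ord1 j).
- by move: ds; rewrite distrC ger0_norm// subr_ge0.
Qed.

Lemma within_continuous_bounded f a b : {within `[a, b], continuous f} ->
  exists2 C : R, 0 <= C & forall t, a <= t -> t <= b -> `|f t| <= C.
Proof.
move=> cf; have [ab|ba] := leP a b; last first.
  by exists 0 => // t at_ tb; move: (le_trans at_ tb); rewrite leNgt ba.
have [c _ Hc] := EVT_max ab cf.
have [c' _ Hc'] := EVT_min ab cf.
exists (`|f c| + `|f c'|); first by rewrite addr_ge0.
move=> t at_ tb; have tab : t \in `[a, b] by rewrite in_itv/= at_.
rewrite ler_norml; have := Hc _ tab; have := Hc' _ tab.
have := ler_norm (f c); have := normr_ge0 (f c'); have := ler_norm (- f c').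
rewrite normrN; have := normr_ge0 (f c).
by move=> *; apply/andP; split; lra.
Qed.

Definition ac_bounded f a b (acf : AC a b f) :=
  within_continuous_bounded (ac_continuous acf).

Lemma aeS1 (P Q : R -> Prop) : (forall t, P t -> Q t) ->
  {ae leb, forall t, P t} -> {ae leb, forall t, Q t}.
Proof. by move=> PQ; apply: filterS; [exact: (ae_filter_ringOfSetsType leb)|]. Qed.

Lemma aeS2 (P1 P2 Q : R -> Prop) : (forall t, P1 t -> P2 t -> Q t) ->
  {ae leb, forall t, P1 t} -> {ae leb, forall t, P2 t} -> {ae leb, forall t, Q t}.
Proof. by move=> PQ; apply: filterS2; [exact: (ae_filter_ringOfSetsType leb)|]. Qed.

Lemma aeT (P : R -> Prop) : (forall t, P t) -> {ae leb, forall t, P t}.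
Proof. by move=> H; apply: filterE; [exact: (ae_filter_ringOfSetsType leb)|]. Qed.

Lemma ae_neq0 : {ae leb, forall t, t != 0}.
Proof.
exists [set 0]; split; [by []|exact: lebesgue_measure_set1|].
by move=> t /= /negP; rewrite negbK => /eqP.
Qed.

(** A Caratheodory antiderivative without prescribed initial value, so that sums, products and
    compositions stay in the class. *)
Definition ac_primitive y g :=
  (forall T, 0 <= T -> AC 0 T y) /\
  {ae leb, forall t, 0 <= t -> is_derive t 1 y (g t)}.

Lemma caratheodoryE y g (y0 : R) :
  caratheodory y g y0 <-> y 0 = y0 /\ ac_primitive y g.
Proof. by split=> [[? ? ?]|[? [? ?]]]. Qed.

Lemma acp_eq y g g' : {ae leb, forall t, 0 <= t -> g t = g' t} ->
  ac_primitive y g -> ac_primitive y g'.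
Proof.
by move=> gg' [ac dy]; split=> //; apply: aeS2 gg' dy => t h1 h2 t0; rewrite -h1//; exact: h2.
Qed.

Lemma acp_eqr y g g' : (forall t, 0 <= t -> g t = g' t) ->
  ac_primitive y g -> ac_primitive y g'.
Proof. by move=> h; apply: acp_eq; exact: aeT. Qed.

Lemma acp_cst (c : R) : ac_primitive (fun=> c) (fun=> 0).
Proof.
split=> [T T0|]; last by apply: aeT => t _; exact: is_derive_cst.
by apply: (@ac_lipschitz _ _ _ 0) => s t _ _ _; rewrite subrr normr0 mul0r.
Qed.

Lemma acp_id : ac_primitive id (fun=> 1).
Proof. by split=> [T T0|]; [exact: ac_id|apply: aeT => t _; exact: is_derive_id]. Qed.

Lemma acpD y z g h : ac_primitive y g -> ac_primitive z h ->
  ac_primitive (fun t => y t + z t) (fun t => g t + h t).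
Proof.
move=> [acy dy] [acz dz]; split=> [T T0|].
  apply: (@ac_dominated _ y z _ _ 1 1); [|exact: acy|exact: acz].
  by move=> s t _ _ _; rewrite !mul1r opprD addrACA ler_normD.
by apply: aeS2 dy dz => t h1 h2 t0; apply: is_deriveD; [exact: h1|exact: h2].
Qed.

Lemma acpM y z g h : ac_primitive y g -> ac_primitive z h ->
  ac_primitive (fun t => y t * z t) (fun t => y t * h t + z t * g t).
Proof.
move=> [acy dy] [acz dz]; split=> [T T0|].
  have [C1 C10 H1] := ac_bounded (acy T T0); have [C2 C20 H2] := ac_bounded (acz T T0).
  apply: (@ac_dominated _ y z _ _ C2 C1); [|exact: acy|exact: acz].
  move=> s t s0 st tT.
  have -> : y t * z t - y s * z s = (y t - y s) * z t + y s * (z t - z s) by ring.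
  rewrite (le_trans (ler_normD _ _))// !normrM; apply: lerD.
    by rewrite mulrC ler_wpM2r// H2// (le_trans s0).
  by rewrite ler_wpM2r// H1// (le_trans st).
by apply: aeS2 dy dz => t h1 h2 t0; apply: is_deriveM; [exact: h1|exact: h2].
Qed.

Lemma acpZ (c : R) y g : ac_primitive y g -> ac_primitive (fun t => c * y t) (fun t => c * g t).
Proof.
by move=> /(acpM (acp_cst c)); apply: acp_eqr => t _; rewrite mulr0 addr0.
Qed.

Lemma acpN y g : ac_primitive y g -> ac_primitive (fun t => - y t) (fun t => - g t).
Proof.
move=> /(acpZ (-1)) [ac dy]; split => [T /ac|].
  by rewrite (_ : (fun t => -1 * y t) = (fun t => - y t))//; apply/funext => t; rewrite mulN1r.
apply: aeS1 dy => t + /[dup] t0 => /[apply].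
rewrite (_ : (fun t => -1 * y t) = (fun t => - y t)) ?mulN1r//.
by apply/funext => ?; rewrite mulN1r.
Qed.

Lemma acpB y z g h : ac_primitive y g -> ac_primitive z h ->
  ac_primitive (fun t => y t - z t) (fun t => g t - h t).
Proof. by move=> /acpD + /acpN; apply. Qed.

Lemma acp_comp y g (phi phi' : R -> R) :
  (forall T, 0 <= T -> exists C, forall s t, 0 <= s -> s <= t -> t <= T ->
    `|phi (y t) - phi (y s)| <= C * `|y t - y s|) ->
  (forall t, 0 < t -> is_derive (y t) 1 phi (phi' (y t))) ->
  ac_primitive y g ->
  ac_primitive (fun t => phi (y t)) (fun t => phi' (y t) * g t).
Proof.
move=> lip dphi [acy dy]; split=> [T T0|].
  have [C HC] := lip T T0.
  apply: (@ac_dominated _ y y _ _ C 0); [|exact: acy|exact: acy].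
  by move=> s t *; rewrite mul0r addr0; exact: HC.
apply: aeS2 dy ae_neq0 => t h1 h2 t0; apply: is_derive1_comp; last exact: h1.
by apply: dphi; rewrite lt_neqAle eq_sym h2.
Qed.

Lemma acp_expR y g : ac_primitive y g ->
  ac_primitive (fun t => expR (y t)) (fun t => expR (y t) * g t).
Proof.
move=> py; apply: acp_comp => // T T0.
have [C C0 HC] := ac_bounded (py.1 T T0); exists (expR C) => s t s0 st tT.
have K a b : a <= b -> `|b| <= C -> `|expR b - expR a| <= expR C * `|b - a|.
  move=> ab bC; rewrite ger0_norm ?subr_ge0 ?ler_expR//.
  have -> : expR b - expR a = expR b * (1 - expR (a - b)) by rewrite mulrBr mulr1 -expRD addrCA subrr addr0.
  apply: ler_pM; [exact: expR_ge0| |by rewrite ler_expR (le_trans (ler_norm _))|].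
    by rewrite subr_ge0 expR_le1 subr_le0.
  rewrite distrC ler0_norm ?subr_le0//; have := expR_ge1Dx (a - b); lra.
have [yst|/ltW yst] := leP (y s) (y t); first by apply: K => //; apply: HC => //; lra.
by rewrite distrC [X in _ * X]distrC; apply: K => //; apply: HC => //; lra.
Qed.

Lemma acp_nondecreasing y g a b : ac_primitive y g -> 0 <= a -> a <= b ->
  {ae leb, forall t, a <= t -> t <= b -> 0 <= g t} -> y a <= y b.
Proof.
move=> [acy dy] a0 ab g0; apply: ac_nondecreasing => //.
  move=> e e0; have [d d0 H] := acy b (le_trans a0 ab) e e0; exists d => // n I Iab.
  by apply: H => i; have [? ?] := Iab i; split=> //; apply: le_trans a0 _.
apply: aeS2 dy g0 => t h1 h2 /andP[at_ tb]; exists (g t); last exact: h2.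
by apply: h1; rewrite (le_trans a0).
Qed.

Lemma acp_le y z g h a b : ac_primitive y g -> ac_primitive z h -> 0 <= a -> a <= b ->
  {ae leb, forall t, a <= t -> t <= b -> g t <= h t} -> y b - y a <= z b - z a.
Proof.
move=> py pz a0 ab gh.
suff : z a - y a <= z b - y b by lra.
apply: (acp_nondecreasing (acpB pz py)) => //.
by apply: aeS1 gh => t H ? ?; rewrite subr_ge0 H.
Qed.
End ac_calculus.

(** * Locally integrable functions *)

Section integrable_real.
Context (di : measure_display) (X : measurableType di) (R : realType).
Context (mu : {measure set X -> \bar R}) (D : set X) (mD : measurable D).
Implicit Types f g : X -> R.

Lemma integrable_EFinD f g : mu.-integrable D (EFin \o f) ->
  mu.-integrable D (EFin \o g) -> mu.-integrable D (EFin \o (fun t => f t + g t)).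
Proof. by move=> fi gi; have := integrableD mD fi gi; apply: eq_integrable. Qed.

Lemma integrable_EFinB f g : mu.-integrable D (EFin \o f) ->
  mu.-integrable D (EFin \o g) -> mu.-integrable D (EFin \o (fun t => f t - g t)).
Proof. by move=> fi gi; have := integrableB mD fi gi; apply: eq_integrable. Qed.

Lemma integrable_EFinZ (c : R) f : mu.-integrable D (EFin \o f) ->
  mu.-integrable D (EFin \o (fun t => c * f t)).
Proof. by move=> fi; have := integrableZl mD c fi; apply: eq_integrable. Qed.

Lemma integrable_EFin_measurable f : mu.-integrable D (EFin \o f) ->
  measurable_fun D f.
Proof. by move=> /integrableP[/measurable_EFinP]. Qed.

Lemma integrable_EFin_le f g : measurable_fun D f -> mu.-integrable D (EFin \o g) ->
  (forall t, D t -> `|f t| <= g t) -> mu.-integrable D (EFin \o f).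
Proof.
move=> mf gi fg; apply: (le_integrable mD _ _ gi) => [|t Dt]; first exact/measurable_EFinP.
by rewrite /= lee_fin (le_trans (fg _ Dt))// ler_norm.
Qed.

Lemma EFin_Rintegral f : mu.-integrable D (EFin \o f) ->
  (\int[mu]_(x in D) f x)%:E = (\int[mu]_(x in D) (f x)%:E)%E.
Proof. by move=> fi; rewrite /Rintegral fineK//; exact: (integrable_fin_num mD fi). Qed.
End integrable_real.

Section primitive_integral.
Context {R : realType}.
Implicit Types (f g y : R -> R) (a b s t d e T : R).
Notation leb := (@lebesgue_measure R).
Notation AC := (@absolutely_continuous_on R).
Notation hl := (`[0%R, +oo[%classic : set R).

(** Absolute continuity of the Lebesgue integral, applied to the union of the intervals, whose
    measure is the sum of their lengths. *)
Lemma ac_integral f T : leb.-integrable `[0, T] (EFin \o f) ->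
  AC 0 T (fun t => \int[leb]_(s in `[0, t]) f s).
Proof.
move=> intf e e0.
have intf1 : leb.-integrable setT (EFin \o (f \_ `[0, T])).
  by rewrite -restrict_EFin; apply/(integrable_mkcond _ _).1.
have [d [d0 H]] := integral_normr_continuous intf1 e0.
exists d => // n I Iab tI sd.
pose F (i : 'I_n) := `](I i).1, (I i).2[%classic : set R.
pose D := \big[setU/set0]_(i <- index_enum 'I_n) F i.
have mF i : measurable (F i) by exact: measurable_itv.
have mD : measurable D.
  by apply: (@bigsetU_measurable _ _ _ (index_enum _) xpredT F) => i _; exact: mF.
have uI : uniq (index_enum 'I_n) by exact: index_enum_uniq.
have tF : trivIset [set` index_enum 'I_n] F.
  by apply: sub_trivIset tI => i _.
have LD : (leb D < d%:E)%E.
  rewrite -[X in (X < _)%E]mul1e -integral_cst// ge0_integral_bigsetU//.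
  rewrite (eq_bigr (fun i => ((I i).2 - (I i).1)%:E)) ?sumEFin//= => i _.
  transitivity (1 * leb (F i))%E; [exact: (integral_cst leb (mF i) 1%E)|rewrite mul1e].
  transitivity (lebesgue_measure (F i)) => //.
  rewrite lebesgue_measure_itv/= lte_fin -EFinB.
  case: ltP => // h; congr EFin.
  by have [_ [h' _]] := Iab i; lra.
have := H D mD LD; apply: le_lt_trans.
have intD (A : set R) : measurable A ->
    leb.-integrable A (EFin \o (fun x => `|(f \_ `[0, T]) x|)).
  move=> mA; apply: (integrableS measurableT) => //.
  exact: (integrable_abse intf1).
rewrite -lee_fin EFin_Rintegral//; last exact: intD.
rewrite ge0_integral_bigsetU//; last by case/integrableP: (intD _ mD).
rewrite -sumEFin; apply: lee_sum => i _.
have [a0 [ab bT]] := Iab i.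
rewrite -EFin_Rintegral//; last exact: (intD _ (mF i)).
rewrite lee_fin.
have I0d : leb.-integrable `[0, (I i).2] (EFin \o f).
  apply: (integrableS _ _ _ intf) => //.
  by apply: subset_itvl; rewrite bnd_simp.
rewrite Rintegral_itvB// ?bnd_simp//.
rewrite -Rintegral_itv_bndo_bndc; last first.
  apply: (integrableS _ _ _ I0d) => //.
  by apply: subset_itv; rewrite bnd_simp.
have -> : \int[leb]_(x in `](I i).1, (I i).2[) f x = \int[leb]_(x in F i) (f \_ `[0, T]) x.
  apply: eq_Rintegral => x; rewrite inE /= in_itv/= => /andP[h1 h2].
  by rewrite patchE mem_set//= in_itv/=; apply/andP; split; lra.
  apply: (@le_normr_Rintegral _ _ R leb (F i) (f \_ `[0, T])); first exact: mF.
  exact: (@integrableS _ _ R leb setT (F i) _ measurableT (mF i) (@subsetT _ _) intf1).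
exact: mF.
Qed.

(** For [T < 0] the interval is empty, so quantifying over all [T] costs nothing and spares sign
    conditions. *)
Definition loc_int f := forall T, leb.-integrable `[0, T] (EFin \o f).

Lemma loc_intP f : (forall T, 0 <= T -> leb.-integrable `[0, T] (EFin \o f)) -> loc_int f.
Proof.
move=> H T; have [/H//|T0] := leP 0 T.
by rewrite set_itv_ge ?bnd_simp -?ltNge//; exact: integrable_set0.
Qed.

Lemma itv_bigcup0 : hl = \bigcup_n `[0%R, n%:R]%classic.
Proof.
apply/seteqP; split=> t.
  rewrite /= in_itv/= andbT => t0; exists (Num.Def.truncn t).+1 => //=.
  by rewrite in_itv/= t0/=; apply/ltW/truncnS_gt.
by move=> [n _] /=; rewrite !in_itv/= => /andP[-> _].
Qed.

Lemma measurable_halfline f :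
  (forall T, measurable_fun `[0, T] f) -> measurable_fun hl f.
Proof.
by move=> H; rewrite itv_bigcup0; apply/measurable_fun_bigcup.
Qed.

Lemma loc_int_measurable f : loc_int f -> measurable_fun hl f.
Proof.
by move=> lf; apply: measurable_halfline => T; exact: (integrable_EFin_measurable (lf T)).
Qed.

Lemma acp_integral f : loc_int f ->
  ac_primitive (fun t => \int[leb]_(s in `[0, t]) f s) f.
Proof.
move=> lf; split=> [T _|]; first exact/ac_integral/lf.
(* Lebesgue differentiation is applied on the whole line, hence the extension by zero, which leaves
   the values at nonnegative arguments unchanged. *)
pose f0 := f \_ hl.
have f0E t : 0 <= t -> f0 t = f t.
  by move=> t0; rewrite /f0 patchE mem_set//= in_itv/= t0.
have mf0 : measurable_fun setT f0.
  have mhl : measurable hl by exact: measurable_itv.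
  exact: ((measurable_restrictT f mhl).1 (loc_int_measurable lf)).
have lf0 : loc_int f0.
  move=> T; have := lf T; apply: eq_integrable => // x; rewrite inE/= in_itv/= => /andP[x0 _] /=.
  by rewrite f0E.
have locf0 : locally_integrable [set: R] f0.
  split; [exact: mf0|exact: openT|move=> A _ cK].
  have [M [_ HM]] := compact_bounded cK.
  pose N : R := `|M| + 1.
  have N0 : 0 <= N by rewrite addr_ge0.
  have KM x : A x -> `|x| <= N.
    by apply: HM; have := ler_norm M; rewrite /N; lra.
  pose B : set R := `[- N, N]%classic.
  apply: (@le_lt_trans _ _ (\int[leb]_(x in B) (`|f0 x|%:E))%E).
    apply: ge0_subset_integral => //; [exact: compact_measurable|exact: measurable_itv| |].
      by apply/measurable_EFinP/measurableT_comp => //; apply: measurable_funTS.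
    by move=> x /KM; rewrite ler_norml /B/= in_itv.
  rewrite integral_mkcond.
  rewrite (_ : _ \_ _ = (fun x => `|f0 x|%:E) \_ (`[0, N]%classic : set R)); last first.
    apply/funext => x; rewrite !patchE.
    have [x0|x0] := leP 0 x.
      suff -> : (x \in B) = (x \in (`[0, N]%classic : set R)) by [].
      by apply/idP/idP => /set_mem h; apply/mem_set; move: h; rewrite /B/= !in_itv/=;
        move=> /andP[? ?]; apply/andP; split=> //; lra.
    have -> : f0 x = 0 by rewrite /f0 patchE memNset//= in_itv/= andbT; apply/negP; rewrite -ltNge.
    by rewrite normr0 !if_same.
  rewrite -integral_mkcond.
  by have /integrableP[_] := lf0 N.
have := @FTC1 _ f0 (BLeft 0) lf0 locf0.
apply: (@aeS2 R _ _ _ _ (@ae_neq0 R)) => t tn0 H t0.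
have {}t0 : 0 < t by rewrite lt_neqAle eq_sym tn0.
have [|dt ft] := H _; first by rewrite /= lte_fin.
rewrite -(f0E _ (ltW t0)).
have -> : (fun t => \int[leb]_(s in `[0, t]) f s) = (fun t => \int[leb]_(s in `[0, t]) f0 s).
  apply/funext => z; apply: eq_Rintegral => x; rewrite inE/= in_itv/= => /andP[? _].
  by rewrite f0E.
by apply: DeriveDef; [exact: dt|rewrite -derive1E; exact: ft].
Qed.

Lemma integral0_itv f : \int[leb]_(s in `[0, 0]) f s = 0.
Proof. by rewrite set_itv1 Rintegral_set1. Qed.

(** [y] and the indefinite integral of [g] have the same derivative almost everywhere; [acp_le] in
    both directions gives equal increments. *)
Lemma acp_FTC y g T : ac_primitive y g -> loc_int g -> 0 <= T ->
  \int[leb]_(s in `[0, T]) g s = y T - y 0.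
Proof.
move=> py lg T0; have pg := acp_integral lg.
have ae : {ae leb, forall t, 0 <= t -> t <= T -> g t <= g t} by exact: aeT.
have := acp_le py pg (lexx 0) T0 ae; have := acp_le pg py (lexx 0) T0 ae.
by rewrite integral0_itv subr0 => h1 h2; apply/eqP; rewrite eq_le h1.
Qed.

Lemma loc_intD f g : loc_int f -> loc_int g -> loc_int (fun t => f t + g t).
Proof. by move=> lf lg T; apply: integrable_EFinD; [exact: measurable_itv|exact: lf|exact: lg]. Qed.

Lemma loc_intB f g : loc_int f -> loc_int g -> loc_int (fun t => f t - g t).
Proof. by move=> lf lg T; apply: integrable_EFinB; [exact: measurable_itv|exact: lf|exact: lg]. Qed.

Lemma loc_int_measurable_itv f T : loc_int f -> measurable_fun `[0, T] f.
Proof. by move=> lf; apply: integrable_EFin_measurable (lf T). Qed.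

Lemma loc_int_mul_bounded f g :
  (forall T, measurable_fun `[0, T] g) ->
  (forall T, 0 <= T -> exists C : R, forall t, 0 <= t -> t <= T -> `|g t| <= C) ->
  loc_int f -> loc_int (fun t => g t * f t).
Proof.
move=> mg bg lf; apply: loc_intP => T T0; have [C HC] := bg T T0.
have h : leb.-integrable `[0, T] (EFin \o (fun t => C * `|f t|)).
  apply: integrable_EFinZ; first exact: measurable_itv.
  exact: (integrable_abse (lf T)).
apply: (integrable_EFin_le _ _ h); first exact: measurable_itv.
  by apply: measurable_funM; [exact: mg|exact: (loc_int_measurable_itv lf)].
move=> t; rewrite /= in_itv/= => /andP[t0 tT].
by rewrite !normrM ler_wpM2r// HC.
Qed.

Lemma within_continuous_measurable f a b :
  {within `[a, b], continuous f} -> measurable_fun `[a, b] f.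
Proof. exact: subspace_continuous_measurable_fun. Qed.

Lemma loc_int_continuous f :
  (forall T, 0 <= T -> {within `[0, T], continuous f}) -> loc_int f.
Proof.
move=> cf; apply: loc_intP => T T0; apply: continuous_compact_integrable; last exact: cf.
exact: segment_compact.
Qed.

Lemma loc_int_mul_continuous f g :
  (forall T, 0 <= T -> {within `[0, T], continuous g}) ->
  loc_int f -> loc_int (fun t => g t * f t).
Proof.
move=> cg; apply: loc_int_mul_bounded => T.
  have [T0|T0] := leP 0 T; first exact: (within_continuous_measurable (cg T T0)).
  rewrite set_itv_ge ?bnd_simp -?ltNge//.
  exact: measurable_fun_set0.
by move=> T0; have [C _ HC] := within_continuous_bounded (cg T T0); exists C.
Qed.

Lemma acp_continuous y g T : ac_primitive y g -> 0 <= T -> {within `[0, T], continuous y}.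
Proof. by move=> py T0; exact/ac_continuous/py.1. Qed.

End primitive_integral.

(** * Existence of trajectories *)

Section picard.
Context {R : realType}.
Implicit Types (f g y : R -> R) (a b s t T : R).
Notation leb := (@lebesgue_measure R).

Definition cont0 (z : R -> R) := forall T, 0 <= T -> {within `[0, T], continuous z}.

Lemma cont0D f g : cont0 f -> cont0 g -> cont0 (fun t => f t + g t).
Proof. by move=> cf cg T T0 t; apply: cvgD; [exact: cf|exact: cg]. Qed.

Lemma cont0N f : cont0 f -> cont0 (fun t => - f t).
Proof. by move=> cf T T0 t; apply: cvgN; exact: cf. Qed.

Lemma cont0M f g : cont0 f -> cont0 g -> cont0 (fun t => f t * g t).
Proof. by move=> cf cg T T0 t; apply: cvgM; [exact: cf|exact: cg]. Qed.

Lemma cont0_cst (c : R) : cont0 (fun=> c).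
Proof. by move=> T T0 t; exact: cvg_cst. Qed.

Lemma cont0_comp (phi f : R -> R) : continuous phi -> cont0 f -> cont0 (fun t => phi (f t)).
Proof.
move=> cphi cf T T0.
by apply: (@within_continuous_comp _ _ _ _ f phi); [move=> t _; exact: cphi|exact: cf].
Qed.

Lemma cont0_acp y g : ac_primitive y g -> cont0 y.
Proof. by move=> py T T0; exact: (acp_continuous py T0). Qed.

Lemma cont0_loc_int f : cont0 f -> loc_int f.
Proof. exact: loc_int_continuous. Qed.

Lemma acp_normr_le y (z : R -> R) g h a b : ac_primitive y g -> ac_primitive z h ->
  0 <= a -> a <= b ->
  {ae leb, forall t, a <= t -> t <= b -> `|g t| <= h t} ->
  `|y b - y a| <= z b - z a.
Proof.
move=> py pz a0 ab gh; rewrite ler_norml; apply/andP; split.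
  rewrite lerNl opprB.
  have : (- y b) - (- y a) <= z b - z a.
    apply: (acp_le (acpN py) pz) => //; apply: aeS1 gh => t H ? ?.
    by rewrite (le_trans (ler_norm _))// normrN H.
  lra.
by apply: (acp_le py pz) => //; apply: aeS1 gh => t H ? ?; rewrite (le_trans (ler_norm _))// H.
Qed.

Lemma norm_le_geometric_eq0 (a K : R) : (forall n, `|a| <= K * 2^-1 ^+ n) -> a = 0.
Proof.
move=> H; apply/eqP; rewrite -normr_eq0; apply/eqP/le_anti; rewrite normr_ge0 andbT.
have K0 : 0 <= K by have := H 0%N; rewrite expr0 mulr1; apply: le_trans.
apply/ler_addgt0Pr => e e0; rewrite add0r.
pose n := (Num.Def.truncn (K / e)).+1.
apply: le_trans (H n) _.
have n2 : (n%:R : R) <= 2 ^+ n by rewrite -natrX ler_nat ltnW// ltn_expl.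
have nK : K / e < n%:R by exact: truncnS_gt.
have p2 : 0 < 2 ^+ n :> R by rewrite exprn_gt0.
rewrite exprVn ler_pdivrMr// mulrC -ler_pdivrMr//.
by rewrite (le_trans (ltW nK)).
Qed.

Variables (Phi : R -> R -> R) (L y0 : R).
Hypothesis L0 : 0 < L.
Hypothesis lipPhi : forall s z z', 0 <= s -> `|Phi s z - Phi s z'| <= L * `|z - z'|.
Hypothesis cPhi : forall z : R -> R, cont0 z -> cont0 (fun s => Phi s (z s)).

Fixpoint picard_iter (n : nat) : R -> R := match n with
  | 0 => fun=> y0
  | m.+1 => fun t => y0 + \int[leb]_(s in `[0, t]) Phi s (picard_iter m s)
  end.
Local Notation it := picard_iter.

Let acp_step (z : R -> R) : cont0 z ->
  ac_primitive (fun t => y0 + \int[leb]_(s in `[0, t]) Phi s (z s)) (fun s => Phi s (z s)).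
Proof.
move=> cz; have := acpD (acp_cst y0) (acp_integral (cont0_loc_int (cPhi cz))).
by apply: acp_eqr => t _; rewrite add0r.
Qed.

Let cont0_it n : cont0 (it n).
Proof.
elim: n => [|n IH] /=; first exact: cont0_cst.
exact: cont0_acp (acp_step IH).
Qed.

(** Bielecki weight: relative to [E] the Picard map contracts by the factor 1/2 on every [[0, T]],
    so that no smallness of [T] is needed and the solution is global at once. *)
Let E t := expR (2 * L * t).

Let acpE (c : R) : ac_primitive (fun t => c * E t) (fun t => c * (2 * L) * E t).
Proof.
have := acpZ c (acp_expR (acpZ (2 * L) (@acp_id R))).
by apply: acp_eqr => t _; rewrite /E mulr1; ring.
Qed.

Let E_ge1 t : 0 <= t -> 1 <= E t.
Proof. by move=> t0; rewrite -expR0 ler_expR mulr_ge0// mulr_ge0// ltW. Qed.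

Let it_step T : 0 <= T -> exists2 C : R, 0 <= C & forall n t, 0 <= t -> t <= T ->
  `|it n.+1 t - it n t| <= C * 2^-1 ^+ n * E t.
Proof.
move=> T0; have [C C0 HC] := within_continuous_bounded (@cont0_it 1%N T T0).
have [K K0 HK] : exists2 K : R, 0 <= K & forall t, 0 <= t -> t <= T -> `|it 1 t - it 0 t| <= K.
  exists (C + `|y0|); first by rewrite addr_ge0.
  move=> t t0 tT; rewrite (le_trans (ler_normB _ _))// lerD//; exact: HC.
exists K => //; elim=> [|n IH] t t0 tT.
  rewrite expr0 mulr1 (le_trans (HK t t0 tT))// ler_peMr//; exact: E_ge1.
have p1 := acpB (acp_step (@cont0_it n.+1)) (acp_step (@cont0_it n)).
have p2 := acpE (K * 2^-1 ^+ n.+1).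
have := acp_normr_le p1 p2 (lexx 0) t0.
rewrite !integral0_itv subrr subr0 => H.
apply: le_trans (H _) _; last first.
  by rewrite gerBl mulr_ge0// ?expR_ge0// mulr_ge0// exprn_ge0.
apply: aeT => s s0 st.
apply: le_trans (lipPhi _ _ s0) _.
apply: le_trans (ler_wpM2l (ltW L0) (IH s s0 (le_trans st tT))) _.
by rewrite exprS le_eqVlt; apply/orP; left; apply/eqP; field.
Qed.

Let limit_bound T : 0 <= T -> exists K : R, forall t, 0 <= t -> t <= T ->
  exists z, forall n, `|z - it n t| <= K * 2^-1 ^+ n.
Proof.
move=> T0; have [C C0 HC] := it_step T0.
exists (2 * (C * E T)) => t t0 tT; set K := C * E T.
have K0 : 0 <= K by rewrite mulr_ge0// expR_ge0.
have step n : `|it n.+1 t - it n t| <= K * 2^-1 ^+ n.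
  apply: le_trans (HC n t t0 tT) _; rewrite /K -!mulrA [_ * E t]mulrC.
  rewrite ler_wpM2l// ler_wpM2r// ?exprn_ge0//.
  by rewrite ler_expR ler_wpM2l// mulr_ge0// ltW.
(* The increments after stage [n] sum to at most [2 * K * 2^-1 ^+ n]; hence the intervals
   [[b n, a n]] are nested and the supremum of their lower ends is the limit. *)
pose a n := it n t + 2 * K * 2^-1 ^+ n.
pose b n := it n t - 2 * K * 2^-1 ^+ n.
have aS n : a n.+1 <= a n.
  have := step n; rewrite /a exprS ler_norml => /andP[_].
  set q := _ ^+ n; lra.
have bS n : b n <= b n.+1.
  have := step n; rewrite /b exprS ler_norml => /andP[+ _].
  set q := _ ^+ n; lra.
have ba n : b n <= a n.
  rewrite /a /b; have : 0 <= 2 * K * 2^-1 ^+ n by apply: mulr_ge0; [apply: mulr_ge0|apply: exprn_ge0].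
  lra.
have ha m n : (m <= n)%N -> a n <= a m.
  by move=> /subnK <-; elim: (n - m)%N => // k IH; rewrite addSn (le_trans (aS _)).
have hb m n : (m <= n)%N -> b m <= b n.
  by move=> /subnK <-; elim: (n - m)%N => // k IH; rewrite addSn (le_trans _ (bS _)).
have bam m n : b m <= a n.
  have [mn|/ltnW nm] := leqP m n; first exact: le_trans (hb _ _ mn) (ba n).
  exact: le_trans (ba m) (ha _ _ nm).
have hs : has_sup (range b).
  by split; [exists (b 0%N), 0%N|exists (a 0%N) => _ [n _ <-]; exact: bam].
exists (sup (range b)) => n.
have h1 : b n <= sup (range b) by apply: ub_le_sup; [case: hs|exists n].
have h2 : sup (range b) <= a n by apply: ge_sup; [case: hs|move=> _ [m _ <-]; exact: bam].
rewrite ler_norml; move: h1 h2; rewrite /a /b.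
by move=> h1 h2; apply/andP; split; lra.
Qed.

Lemma picard_existence : exists2 y, y 0 = y0 & ac_primitive y (fun s => Phi s (y s)).
Proof.
have [y Hy] : {y : R -> R & forall t, 0 <= t -> exists K, forall n, `|y t - it n t| <= K * 2^-1 ^+ n}.
  apply: (@choice _ _ (fun t (z : R) => 0 <= t -> exists K, forall n, `|z - it n t| <= K * 2^-1 ^+ n)) => t.
  have [t0|t0] := pselect (0 <= t); last by exists 0.
  have [K HK] := limit_bound t0; have [z Hz] := HK t t0 (lexx t).
  by exists z => _; exists K.
(* The choice of [y t] came with a constant depending on [t]; uniqueness of the limit transfers the
   constant that is valid on all of [[0, T]]. *)
have unif T : 0 <= T -> exists2 K : R, 0 <= K &
    forall n t, 0 <= t -> t <= T -> `|y t - it n t| <= K * 2^-1 ^+ n.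
  move=> T0; have [K HK] := limit_bound T0; exists K.
    have [z Hz] := HK 0 (lexx 0) T0.
    by have := Hz 0%N; rewrite expr0 mulr1; apply: le_trans.
  move=> n t t0 tT; have [z Hz] := HK t t0 tT; have [K' HK'] := Hy t t0.
  suff -> : y t = z by exact: Hz.
  apply/eqP; rewrite -subr_eq0; apply/eqP.
  apply: (@norm_le_geometric_eq0 _ (K + K')) => m.
  rewrite mulrDl (_ : y t - z = (it m t - z) + (y t - it m t)); last by ring.
  by rewrite (le_trans (ler_normD _ _))// lerD// distrC.
have cy : cont0 y.
  move=> T T0; apply: within_continuous_eps => t; rewrite /= in_itv/= => /andP[t0 tT] e e0.
  have [K K0 HK] := unif T T0.
  have [n Kn] : exists n, K * 2^-1 ^+ n <= e / 3.
    apply: contrapT => /forallNP H.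
    have : e / 3 = 0.
      apply: (@norm_le_geometric_eq0 _ K) => n; rewrite ger0_norm; last lra.
      by have /negP := H n; rewrite -ltNge => /ltW.
    lra.
  have /subspace_continuousP/(_ t) := @cont0_it n T T0.
  rewrite /= in_itv/= t0 tT => /(_ isT)/cvgrPdist_le/(_ (e / 3)).
  have e3 : 0 < e / 3 by lra.
  move=> /(_ e3); rewrite near_withinE => -[d d0 Hd].
  exists d => // s; rewrite /= in_itv/= => /andP[s0 sT] ts.
  have h1 := le_trans (HK n t t0 tT) Kn.
  have h2 := le_trans (HK n s s0 sT) Kn.
  have h3 : `|it n t - it n s| <= e / 3 by apply: Hd => //=; rewrite in_itv/= s0.
  have -> : y t - y s = (y t - it n t) + ((it n t - it n s) - (y s - it n s)) by ring.
  have := ler_normD (y t - it n t) ((it n t - it n s) - (y s - it n s)).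
  have := ler_normB (it n t - it n s) (y s - it n s).
  lra.
have py := acp_step cy.
(* The integral equation is available for [t >= 0] only. A derivative needs a neighbourhood, so it
   is transferred at [t > 0], at the cost of a null set. *)
suff yE t : 0 <= t -> y t = y0 + \int[leb]_(s in `[0, t]) Phi s (y s).
  exists y; first by rewrite yE// integral0_itv addr0.
  case: py => ac dy; split=> [T T0 e e0|].
    have [d d0 H] := ac T T0 e e0; exists d => // n I Iab tI sd.
    have := H n I Iab tI sd; rewrite (eq_bigr (fun i => `|y (I i).2 - y (I i).1|))// => i _.
    by have [h1 [h2 _]] := Iab i; rewrite !yE// (le_trans h1).
  apply: aeS2 dy (@ae_neq0 R) => t + tn0 t0 => /(_ t0) [dt dtE].
  have {tn0}t0' : 0 < t by rewrite lt_neqAle eq_sym tn0.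
  apply: (@near_eq_is_derive _ _ _ (fun t => y0 + \int[leb]_(s in `[0, t]) Phi s (y s))).
  - by near=> s; apply/esym/yE; apply: ltW; near: s; exact: lt_nbhsr.
  - exact: DeriveDef.
move=> t0; apply/eqP; rewrite -subr_eq0; apply/eqP.
have [K K0 HK] := unif t t0.
apply: (@norm_le_geometric_eq0 _ (K + L * K * t)) => n.
have p1 := acpB py (acp_step (@cont0_it n)).
have p2 := acpZ (L * (K * 2^-1 ^+ n)) (@acp_id R).
have := acp_normr_le p1 p2 (lexx 0) t0.
rewrite !integral0_itv subrr subr0 mulr0 subr0 => H.
have {}H : `|y0 + \int[leb]_(s in `[0, t]) Phi s (y s) - it n.+1 t| <= L * (K * 2^-1 ^+ n) * t.
  apply: H; apply: aeT => s s0 st; rewrite mulr1.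
  by apply: le_trans (lipPhi _ _ s0) _; rewrite ler_wpM2l ?(ltW L0)// HK.
have h1 := HK n.+1 t t0 (lexx t).
have h2 : K * 2^-1 ^+ n.+1 <= K * 2^-1 ^+ n.
  rewrite ler_wpM2l// exprS ler_piMl ?exprn_ge0//; lra.
rewrite (_ : y t - _ = (y t - it n.+1 t) - (y0 + \int[leb]_(s in `[0, t]) Phi s (y s) - it n.+1 t)); last by ring.
rewrite (le_trans (ler_normB _ _))// mulrDl lerD//; first exact: le_trans h1 h2.
by rewrite (le_trans H)// le_eqVlt; apply/orP; left; apply/eqP; ring.
Unshelve. all: by end_near. Qed.
End picard.

(** * Barriers for differential inequalities *)

Section comparison.
Context {R : realType}.
Implicit Types (f g y : R -> R) (a b c s t e L T : R).
Notation leb := (@lebesgue_measure R).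

Lemma within_continuousP_itv f a b : {within `[a, b], continuous f} ->
  forall t e, a <= t -> t <= b -> 0 < e ->
  exists2 d, 0 < d & forall s, a <= s -> s <= b -> `|t - s| < d -> `|f t - f s| <= e.
Proof.
move=> /subspace_continuousP cf t e at_ tb e0.
have := cf t; rewrite /= in_itv/= at_ tb => /(_ isT)/cvgrPdist_le/(_ _ e0).
rewrite near_withinE => -[d d0 Hd]; exists d => // s as_ sb ts.
by apply: Hd => //=; rewrite in_itv/= as_.
Qed.

(** The last time at level [c], not the first, is taken so that [f] stays above [c] from there up to
    [b], as the barrier argument requires. *)
Lemma last_exit f a b c : a <= b -> {within `[a, b], continuous f} ->
  f a <= c -> c < f b ->
  exists2 t, a <= t <= b & f t = c /\ forall s, t <= s -> s <= b -> c <= f s.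
Proof.
move=> ab cf fac cfb.
pose S := [set s | a <= s <= b /\ f s <= c].
have Sa : S a by rewrite /S/= lexx ab.
have hS : has_sup S by split; [exists a|exists b => s [/andP[]]].
set t := sup S.
have at_ : a <= t by apply: ub_le_sup => //; case: hS.
have tb : t <= b by apply: ge_sup; [exists a|move=> s [/andP[]]].
have aft s : t < s -> s <= b -> c < f s.
  move=> ts sb; rewrite ltNge; apply/negP => fsc.
  have : s <= t by apply: ub_le_sup; [case: hS|split=> //; rewrite sb (le_trans at_ (ltW ts))].
  by rewrite leNgt ts.
have ftc : f t = c.
  apply/eqP; rewrite eq_le; apply/andP; split.
    apply/ler_addgt0Pr => e e0.
    have [d d0 Hd] := within_continuousP_itv cf at_ tb e0.
    have [s [/andP[as_ sb] fsc] ds] := sup_adherent d0 hS.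
    have st : s <= t by apply: ub_le_sup; [case: hS|split=> //; rewrite as_].
    have := Hd s as_ sb; rewrite ger0_norm ?subr_ge0//.
    move=> /(_ ltac:(rewrite -/t in ds; lra)).
    rewrite ler_norml => /andP[_]; lra.
  apply/ler_addgt0Pr => e e0.
  have [d d0 Hd] := within_continuousP_itv cf at_ tb e0.
  have tltb : t < b.
    rewrite lt_neqAle tb andbT; apply/eqP => tE.
    have [d' d'0 Hd'] := within_continuousP_itv cf ab (lexx b) (ltac:(lra) : 0 < (f b - c) / 2).
    have [s [/andP[as_ sb] fsc] ds] := sup_adherent d'0 hS.
    have := Hd' s as_ sb; rewrite ger0_norm ?subr_ge0//.
    move=> /(_ ltac:(rewrite -/t tE in ds; lra)).
    rewrite ler_norml => /andP[_]; lra.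
  pose s := Order.min b (t + d / 2).
  have ts : t < s by rewrite lt_min tltb/= ltrDl; lra.
  have sb : s <= b by rewrite ge_min lexx.
  have sd : s <= t + d / 2 by rewrite ge_min lexx orbT.
  have := Hd s (le_trans at_ (ltW ts)) sb; rewrite distrC ger0_norm ?subr_ge0 ?(ltW ts)//.
  move=> /(_ ltac:(lra)); rewrite ler_norml => /andP[+ _].
  have := aft s ts sb; lra.
exists t; first by rewrite at_.
split=> // s; rewrite le_eqVlt => /orP[/eqP <- _|]; first by rewrite ftc.
by move=> ts sb; apply/ltW/aft.
Qed.

(** The inequality is required only above the barrier. After the last time at level [c], the
    function [exp (- L t) (f - c)] starts from 0 and is nonincreasing, so it cannot be positive at
    [T]. *)
Lemma acp_barrier f g c L T : ac_primitive f g -> 0 <= T -> f 0 <= c ->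
  {ae leb, forall t, 0 <= t -> t <= T -> c <= f t -> g t <= L * (f t - c)} ->
  f T <= c.
Proof.
move=> pf T0 f0c H; rewrite leNgt; apply/negP => cfT.
have [t /andP[t0 tT] [ftc Hs]] := last_exit T0 (acp_continuous pf T0) f0c cfT.
have p1 := acpN (acpM (acp_expR (acpZ (- L) (@acp_id R))) (acpB pf (acp_cst c))).
have := acp_nondecreasing p1 t0 tT.
rewrite /= ftc subrr mulr0 oppr0 oppr_ge0 => K.
have : expR (- L * T) * (f T - c) <= 0.
  apply: K; apply: aeS1 H => s Hs' ts sT.
  have cfs := Hs s ts sT; have := Hs' (le_trans t0 ts) sT cfs.
  rewrite addr0 mulr1 => h.
  have -> : - (expR (- L * s) * g s + (f s - c) * (expR (- L * s) * - L)) =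
    expR (- L * s) * (L * (f s - c) - g s) by ring.
  by rewrite mulr_ge0 ?expR_ge0// subr_ge0.
by rewrite pmulr_rle0 ?expR_gt0// subr_le0 leNgt cfT.
Qed.
End comparison.

(** * Functions differentiable on the closed half-line *)

Section halfline_derivative.
Context {R : realType}.
Implicit Types (f : R -> R) (a b s t e C X D : R).

Lemma halfline_approx f (f' : R -> R) a e : is_deriv_halfline f f' -> 0 <= a -> 0 < e ->
  exists2 d, 0 < d & forall y, 0 <= y -> `|y - a| < d ->
    `|f y - f a - f' a * (y - a)| <= e * `|y - a|.
Proof.
move=> hd a0 e0; have /cvgrPdist_le/(_ _ e0) := hd a a0.
rewrite near_withinE => -[d d0 Hd]; exists d => // y y0 ya.
have [->|ny] := eqVneq y a; first by rewrite !subrr mulr0 subr0 normr0 mulr0.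
have ya0 : y - a != 0 by rewrite subr_eq0.
have := Hd y; rewrite /= distrC => /(_ ya ny); rewrite in_itv/= y0 => /(_ isT) H.
rewrite (_ : _ - _ - _ = - ((f' a - (f y - f a) / (y - a)) * (y - a))); last by field.
by rewrite normrN normrM ler_wpM2r.
Qed.

Lemma approx_is_derive f a D :
  (forall e, 0 < e -> exists2 d, 0 < d & forall y, `|y - a| < d ->
    `|f y - f a - D * (y - a)| <= e * `|y - a|) -> is_derive a 1 f D.
Proof.
move=> H.
have K : h^-1 *: (f (h *: 1 + a) - f a) @[h --> 0^'] --> D.
  apply/cvgrPdist_le => e e0; have [d d0 Hd] := H e e0.
  exists d => // h; rewrite /= sub0r normrN => hd h0.
  rewrite [h *: 1]mulr1.
  have := Hd (h + a); rewrite addrK => /(_ hd) Hh.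
  have h0' : 0 < `|h| by rewrite normr_gt0.
  rewrite -(ler_pM2r h0') -normrM.
  rewrite (_ : _ * h = - (f (h + a) - f a - D * h)); first by rewrite normrN.
  by rewrite /GRing.scale/=; field.
by apply: DeriveDef; [apply/cvg_ex; exists D|exact/cvg_lim].
Qed.

Lemma halfline_is_derive f (f' : R -> R) a : is_deriv_halfline f f' -> 0 < a ->
  is_derive a 1 f (f' a).
Proof.
move=> hd a0; apply: approx_is_derive => e e0.
have [d d0 Hd] := halfline_approx hd (ltW a0) e0.
exists (Order.min d a) => [|y]; first by rewrite lt_min d0.
rewrite lt_min => /andP[h1 h2]; apply: Hd => //.
by move: h2; rewrite ltr_norml => /andP[h2 _]; lra.
Qed.

Lemma halfline_continuous f (f' : R -> R) : is_deriv_halfline f f' -> forall X, {within `[0, X], continuous f}.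
Proof.
move=> hd X; apply: within_continuous_eps => t; rewrite /= in_itv/= => /andP[t0 tX] e e0.
have [d d0 Hd] := halfline_approx hd t0 ltr01.
have C0 : 0 < `|f' t| + 1 by rewrite ltr_wpDl.
exists (Order.min d (e / (`|f' t| + 1))) => [|s]; first by rewrite lt_min d0 divr_gt0.
rewrite /= in_itv/= => /andP[s0 sX]; rewrite lt_min distrC => /andP[h1 h2].
have h3 := Hd s s0 h1.
rewrite distrC (_ : f s - f t = (f s - f t - f' t * (s - t)) + f' t * (s - t)); last by ring.
rewrite (le_trans (ler_normD _ _))// normrM.
apply: (@le_trans _ _ ((`|f' t| + 1) * `|s - t|)); first by rewrite mulrDl addrC lerD2l.
by rewrite mulrC -ler_pdivlMr// ltW.
Qed.

Lemma halfline_MVT f (f' : R -> R) a b : is_deriv_halfline f f' -> 0 <= a -> a < b ->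
  exists2 c, a < c < b & f b - f a = f' c * (b - a).
Proof.
move=> hd a0 ab.
have [c||c cab E] := @MVT R f f' a b ab; last by exists c => //; move: cab; rewrite in_itv.
- by rewrite in_itv/= => /andP[ac _]; apply: halfline_is_derive => //; apply: le_lt_trans ac.
- apply: (continuous_subspaceW _ (halfline_continuous hd (X := b))).
  by apply: subset_itvr; rewrite bnd_simp.
Qed.

Lemma halfline_lipschitz f (f' : R -> R) X C : is_deriv_halfline f f' ->
  (forall s, 0 < s -> s < X -> `|f' s| <= C) ->
  forall a b, 0 <= a -> a <= X -> 0 <= b -> b <= X -> `|f b - f a| <= C * `|b - a|.
Proof.
move=> hd bd.
suff H a b : 0 <= a -> a < b -> b <= X -> `|f b - f a| <= C * `|b - a|.
  move=> a b a0 aX b0 bX; case: (ltgtP a b) => [ab|ba|->]; first exact: H.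
    by rewrite distrC [`|b - a|]distrC H.
  by rewrite !subrr normr0 mulr0.
move=> a0 ab bX; have [c /andP[ac cb] ->] := halfline_MVT hd a0 ab.
by rewrite normrM ler_wpM2r// bd//; lra.
Qed.
End halfline_derivative.

(** * Concave growth and the trajectories of the stock *)

Section growth.
Context {R : realType}.
Variables (F F' F'' : R -> R) (xbar : R).
Hypothesis F_C2 : is_C2_halfline F F' F''.
Hypothesis xbar_gt0 : 0 < xbar.
Hypothesis F_0 : F 0 = 0.
Hypothesis F_xbar : F xbar = 0.
Hypothesis F_gt0 : forall x : R, 0 < x -> x < xbar -> 0 < F x.
Hypothesis F''_lt0 : forall x : R, 0 <= x -> x <= xbar -> F'' x < 0.
Implicit Types (a b c s t e X T : R) (w x y : R -> R).
Notation leb := (@lebesgue_measure R).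

Let dF : is_deriv_halfline F F'. Proof. by case: F_C2. Qed.
Let dF' : is_deriv_halfline F' F''. Proof. by case: F_C2. Qed.

Lemma growth_lipschitz X : exists2 L : R, 0 < L & forall a b,
  0 <= a -> a <= X -> 0 <= b -> b <= X -> `|F b - F a| <= L * `|b - a|.
Proof.
have [C C0 HC] := within_continuous_bounded (halfline_continuous dF' (X := X)).
exists (C + 1); first by rewrite ltr_wpDl.
apply: (halfline_lipschitz dF) => s s0 sX.
by rewrite (le_trans (HC s (ltW s0) (ltW sX)))// lerDl.
Qed.

(** Mean value theorem for [F], then the Lipschitz bound of [F'] between [a] and the mean value
    point; the lost factor 1/2 is immaterial. *)
Lemma growth_taylor : exists2 M : R, 0 <= M & forall a b,
  0 < a -> a <= xbar -> 0 < b -> b <= xbar ->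
  `|F b - F a - F' a * (b - a)| <= M * (b - a) ^+ 2.
Proof.
have cF'' : {within `[0, xbar], continuous F''}.
  case: F_C2 => _ _; apply: continuous_subspaceW.
  by apply: subset_itvl.
have [M M0 HM] := within_continuous_bounded cF''.
have bd s : 0 < s -> s < xbar -> `|F'' s| <= M by move=> s0 sX; apply: HM; exact: ltW.
have lip := halfline_lipschitz dF' bd.
exists M => // a b a0 aX b0 bX.
suff [c [c0 [cX [ca E]]]] : exists c, 0 <= c /\ c <= xbar /\ `|c - a| <= `|b - a| /\ F b - F a = F' c * (b - a).
  rewrite E -mulrBl normrM -[(b - a) ^+ 2]real_normK ?num_real// expr2 mulrA ler_wpM2r//.
  apply: le_trans (lip a c _ _ c0 cX) _ => //; first exact: ltW.
  by rewrite ler_wpM2l.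
case: (ltgtP a b) => [ab|ba|<-].
- have [c /andP[ac cb] E] := halfline_MVT dF (ltW a0) ab.
  by exists c; do ! split; rewrite ?E//; [lra|lra|rewrite !ger0_norm; lra].
- have [c /andP[ac cb] E] := halfline_MVT dF (ltW b0) ba.
  exists c; do ! split; [lra|lra|by rewrite !ler0_norm; lra|].
  by rewrite -opprB E; ring.
- by exists a; do ! split => //; [exact: ltW|rewrite !subrr mulr0].
Qed.

Lemma growth_deriv_noninc a b : 0 <= a -> a <= b -> b <= xbar -> F' b <= F' a.
Proof.
move=> a0; rewrite le_eqVlt => /orP[/eqP->//|ab] bX.
have [c /andP[ac cb] E] := halfline_MVT dF' a0 ab.
rewrite -subr_le0 E; apply: mulr_le0_ge0; last lra.
by apply/ltW/F''_lt0; lra.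
Qed.

Lemma growth_tangent s : 0 < s -> s <= xbar -> s * F' s <= F s.
Proof.
move=> s0 sX; have [c /andP[c0 cs]] := halfline_MVT dF (lexx 0) s0.
rewrite F_0 !subr0 => ->; rewrite mulrC ler_wpM2r ?(ltW s0)//.
by apply: growth_deriv_noninc => //; exact: ltW.
Qed.

(** The larger of two stocks has the smaller relative growth rate; this controls the ratio of two
    trajectories in [trajectory_ratio_le]. *)
Lemma growth_rate_noninc a b : 0 < a -> a <= b -> b <= xbar -> F b / b <= F a / a.
Proof.
move=> a0; rewrite le_eqVlt => /orP[/eqP->//|ab] bX.
have [c /andP[ac cb] E] := halfline_MVT dF (ltW a0) ab.
have h1 : F' c <= F' a by apply: growth_deriv_noninc; lra.
have h2 : a * F' a <= F a by apply: growth_tangent; lra.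
have b0 : 0 < b by lra.
rewrite ler_pdivrMr// mulrAC ler_pdivlMr//.
have : F b = F a + F' c * (b - a) by lra.
move=> ->; rewrite mulrDl mulrAC.
have h3 : F' c * a * (b - a) <= F a * (b - a).
  rewrite ler_wpM2r; [|lra|]; first by lra.
  by rewrite mulrC (le_trans _ h2)// ler_wpM2l// ltW.
lra.
Qed.

Lemma growth_ge0 s : 0 <= s -> s <= xbar -> 0 <= F s.
Proof.
rewrite !le_eqVlt => /orP[/eqP <-|s0]; first by rewrite F_0 eqxx.
by case/orP => [/eqP->|sX]; [rewrite F_xbar eqxx|rewrite F_gt0// orbT].
Qed.

Section trajectory.
Variables (x w : R -> R).
Hypothesis px : ac_primitive x (fun t => F (x t) - w t * x t).
Hypothesis w_ge0 : {ae leb, forall t, 0 <= t -> 0 <= w t}.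
Hypothesis x_ge0 : forall t, 0 <= t -> 0 <= x t.

(** Beyond [xbar] only local Lipschitz continuity of [F] is known. With [F xbar = 0] it gives
    [F x <= L * (x - xbar)] there, and harvesting only lowers the stock, so [xbar] is a barrier. *)
Lemma trajectory_le t : x 0 <= xbar -> 0 <= t -> x t <= xbar.
Proof.
move=> x0X t0; have [X X0 HX] := ac_bounded (px.1 t t0).
have [L L0 HL] := growth_lipschitz (Order.max X xbar).
apply: (acp_barrier (L := L) px) => //; apply: aeS1 w_ge0 => s ws s0 st xs.
have xX : x s <= X by rewrite (le_trans (ler_norm _))// HX.
have := HL xbar (x s) (ltW xbar_gt0).
rewrite !le_max lexx orbT xX F_xbar subr0 => /(_ isT (x_ge0 s0) isT).
rewrite [`|x s - _|]ger0_norm ?subr_ge0// => h.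
have : 0 <= w s * x s by rewrite mulr_ge0// ?ws// x_ge0.
by have := ler_norm (F (x s)); lra.
Qed.

Lemma trajectory_eq0 t : x 0 = 0 -> 0 <= t -> x t = 0.
Proof.
move=> x00 t0; apply/eqP; rewrite eq_le x_ge0// andbT.
have [X X0 HX] := ac_bounded (px.1 t t0).
have [L L0 HL] := growth_lipschitz X.
apply: (acp_barrier (L := L) px) => //; first by rewrite x00.
apply: aeS1 w_ge0 => s ws s0 st xs.
have xX : x s <= X by rewrite (le_trans (ler_norm _))// HX.
have := HL 0 (x s) (lexx 0) X0 xs xX; rewrite F_0 !subr0 [`|x s|]ger0_norm// => h.
have : 0 <= w s * x s by rewrite mulr_ge0// ws.
by have := ler_norm (F (x s)); lra.
Qed.

(** The integrating factor removes the harvest: [x exp (\int w)] has the derivative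
    [exp (\int w) F x >= 0]. *)
Lemma trajectory_gt0 t : loc_int w -> 0 < x 0 -> x 0 <= xbar -> 0 <= t -> 0 < x t.
Proof.
move=> lw x00 x0X t0; have pW := acp_integral lw.
have := acp_nondecreasing (acpM px (acp_expR pW)) (lexx 0) t0.
rewrite integral0_itv expR0 mulr1 => K.
rewrite -(pmulr_lgt0 _ (expR_gt0 (\int[leb]_(s in `[0, t]) w s))) (lt_le_trans x00)//.
apply: K; apply: aeT => s s0 st; set e := expR _.
rewrite (_ : _ + _ = e * F (x s)); last by ring.
by rewrite mulr_ge0 ?expR_ge0// growth_ge0 ?x_ge0// trajectory_le.
Qed.
End trajectory.

(** Picard iteration is run with right-hand sides that are continuous in time, whereas [w] is only
    locally integrable. The unknown [eta = x exp W], with [W] the primitive of [w], satisfies such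
    an equation, and clipping the argument of [F] to [[0, xbar]] makes it globally Lipschitz. The
    solution stays in []0, xbar]], where clipping changes nothing. *)
Lemma trajectory_exists w (x0 : R) : loc_int w ->
  {ae leb, forall t, 0 <= t -> 0 <= w t} -> 0 < x0 -> x0 <= xbar ->
  exists x : R -> R, [/\ x 0 = x0,
    ac_primitive x (fun t => F (x t) - w t * x t) &
    forall t, 0 <= t -> 0 < x t /\ x t <= xbar].
Proof.
move=> lw w0 x00 x0X.
pose clip s := Order.max 0 (Order.min s xbar).
have clip0 s : 0 <= clip s by rewrite le_max lexx.
have clipX s : clip s <= xbar by rewrite ge_max (ltW xbar_gt0) ge_min lexx orbT.
have clipE s : 0 <= s -> s <= xbar -> clip s = s.
  by move=> s0 sX; rewrite /clip (min_l sX) (max_r s0).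
have clipP s : [\/ s <= 0 /\ clip s = 0, 0 <= s /\ s <= xbar /\ clip s = s |
    xbar <= s /\ clip s = xbar].
  have [s0|s0] := leP s 0.
    by apply: Or31; split=> //; rewrite /clip max_l// ge_min s0.
  have [sX|sX] := leP s xbar; first by apply: Or32; rewrite clipE// ltW.
  by apply: Or33; rewrite /clip (min_r (ltW sX)) (max_r (ltW xbar_gt0)) ltW.
have clip_lip s t : `|clip s - clip t| <= `|s - t|.
  wlog st : s t / s <= t => [wl|].
    by have [/wl//|/ltW/wl] := leP s t; rewrite distrC [`|t - s|]distrC.
  rewrite distrC [`|s - t|]distrC [`|t - s|]ger0_norm ?subr_ge0// ger0_norm;
  by case: (clipP s) => [[? ->]|[? [? ->]]|[? ->]]; case: (clipP t) => [[? ->]|[? [? ->]]|[? ->]]; lra.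
have [L L0 HL] := growth_lipschitz xbar.
pose Ft s := F (clip s).
have Ft_lip s t : `|Ft s - Ft t| <= L * `|s - t|.
  apply: le_trans (HL _ _ _ _ _ _) _ => //.
  by rewrite ler_wpM2l ?(ltW L0).
have Ft0 s : 0 <= Ft s by exact: growth_ge0.
have cFt : continuous Ft.
  move=> t; apply/cvgrPdist_le => e e0; exists (e / L) => [|s /= ts]; first by rewrite /= divr_gt0.
  by rewrite (le_trans (Ft_lip _ _))// mulrC -ler_pdivlMr// ltW.
pose W t := \int[leb]_(s in `[0, t]) w s.
have pW : ac_primitive W w := acp_integral lw.
have W0 : W 0 = 0 by exact: integral0_itv.
(* The factors [expR (W s)] and [expR (- W s)] cancel in the Lipschitz estimate, so the constant [L]
   of [F] serves for every [s]. *)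
pose Phi s z := expR (W s) * Ft (z * expR (- W s)).
have [eta eta0 peta] : exists2 y, y 0 = x0 & ac_primitive y (fun s => Phi s (y s)).
  apply: (@picard_existence _ Phi L) => // [s z z' s0|z cz].
    rewrite /Phi -mulrBr normrM ger0_norm ?expR_ge0//.
    apply: le_trans (ler_wpM2l (expR_ge0 _) (Ft_lip _ _)) _.
    rewrite -mulrBl normrM [`|expR _|]ger0_norm ?expR_ge0//.
    rewrite (_ : expR (W s) * _ = L * `|z - z'| * (expR (W s) * expR (- W s))); last by ring.
    by rewrite -expRD subrr expR0 mulr1.
  have cW : cont0 W by exact: cont0_acp pW.
  apply: cont0M; first by apply: cont0_comp => //; exact: continuous_expR.
  apply: cont0_comp => //; apply: cont0M => //.
  by apply: cont0_comp; [exact: continuous_expR|exact: cont0N].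
pose x t := eta t * expR (- W t).
have px0 : ac_primitive x (fun t => Ft (x t) - w t * x t).
  have := acpM peta (acp_expR (acpN pW)); apply: acp_eqr => t t0.
  rewrite /Phi -/(x t) [X in _ + X]mulrA -expRD addNr expR0 mul1r /x; ring.
have xgt0 t : 0 <= t -> 0 < x t.
  move=> t0; rewrite mulr_gt0 ?expR_gt0// (lt_le_trans x00)// -eta0.
  apply: (acp_nondecreasing peta) => //; apply: aeT => s s0 st.
  by rewrite mulr_ge0 ?expR_ge0.
have x_0 : x 0 = x0 by rewrite /x W0 oppr0 expR0 mulr1.
have xle t : 0 <= t -> x t <= xbar.
  move=> t0; apply: (acp_barrier (L := 0) px0) => //; first by rewrite x_0.
  apply: aeS1 w0 => s ws s0 st xs; rewrite mul0r.
  rewrite /Ft /clip (min_r xs) (max_r (ltW xbar_gt0)) F_xbar sub0r oppr_le0.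
  by rewrite mulr_ge0 ?ws// ltW// xgt0.
exists x; split=> // [|t t0]; last by rewrite xgt0// xle.
by apply: acp_eqr px0 => t t0; rewrite /Ft clipE ?xle// ltW// xgt0.
Qed.
End growth.

(** * The adjoint equation and the first variation *)

Section adjoint.
Context {R : realType}.
Variables (F F' F'' : R -> R) (xbar delta p : R).
Hypothesis F_C2 : is_C2_halfline F F' F''.
Hypothesis xbar_gt0 : 0 < xbar.
Hypothesis F_0 : F 0 = 0.
Hypothesis F_xbar : F xbar = 0.
Hypothesis F_gt0 : forall x : R, 0 < x -> x < xbar -> 0 < F x.
Hypothesis F''_lt0 : forall x : R, 0 <= x -> x <= xbar -> F'' x < 0.
Hypothesis delta_gt0 : 0 < delta.
Hypothesis p_ge0 : 0 <= p.
Implicit Types (a b c s t e X T : R) (v w x y : R -> R).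
Notation leb := (@lebesgue_measure R).

Lemma cont0_lipschitz (f z : R -> R) (C : R) : 0 <= C ->
  (forall s t, 0 <= s -> 0 <= t -> `|f t - f s| <= C * `|z t - z s|) ->
  cont0 z -> cont0 f.
Proof.
move=> C0 H cz T T0; apply: within_continuous_eps => t; rewrite /= in_itv/= => /andP[t0 tT] e e0.
have e1 : 0 < e / (C + 1) by rewrite divr_gt0// ltr_wpDl.
have [d d0 Hd] := within_continuousP_itv (cz T T0) t0 tT e1.
exists d => // s; rewrite /= in_itv/= => /andP[s0 sT] ts.
rewrite (le_trans (H _ _ s0 t0))// (le_trans (ler_wpM2l C0 (Hd s s0 sT ts)))//.
rewrite mulrA ler_pdivrMr ?ltr_wpDl// mulrC ler_pM2l// lerDl//.
Qed.

Lemma ln_le_sub1 (z : R) : 0 < z -> ln z <= z - 1.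
Proof. by move=> z0; rewrite lerBrDl -[leRHS](lnK z0) expR_ge1Dx. Qed.

(** On [[0, T]] the function [y] has a positive minimum, above which the logarithm is Lipschitz. *)
Lemma acp_ln (y g : R -> R) : (forall t, 0 <= t -> 0 < y t) -> ac_primitive y g ->
  ac_primitive (fun t => ln (y t)) (fun t => g t / y t).
Proof.
move=> y0 py.
have := @acp_comp R y g (@ln R) (fun z => z^-1) _ _ py.
move=> H; apply: (acp_eqr _ (H _ _)) => [t t0|T T0|t t0].
- by rewrite mulrC.
- have [m mT Hm] := EVT_min T0 (acp_continuous py T0).
  move: mT; rewrite in_itv/= => /andP[m0 mT].
  exists (y m)^-1 => s t s0 st tT.
  have ym := y0 m m0.
  suff K a b : y m <= a -> y m <= b -> a <= b -> `|ln b - ln a| <= (y m)^-1 * `|b - a|.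
    have ys : y m <= y s by apply: Hm; rewrite in_itv/= s0 (le_trans st).
    have yt : y m <= y t by apply: Hm; rewrite in_itv/= (le_trans s0 st).
    have [yst|/ltW yts] := leP (y s) (y t); first exact: K.
    by rewrite distrC [`|y t - _|]distrC; exact: K.
  move=> ma mb ab; have a0 : 0 < a by apply: lt_le_trans ma.
  have b0 : 0 < b by apply: lt_le_trans mb.
  rewrite ger0_norm ?subr_ge0 ?ler_ln ?posrE// ger0_norm ?subr_ge0//.
  rewrite -ln_div ?posrE// (le_trans (ln_le_sub1 _)) ?divr_gt0//.
  have -> : b / a - 1 = a^-1 * (b - a) by field; rewrite gt_eqF.
  by rewrite ler_wpM2r ?subr_ge0// lef_pV2 ?posrE.
- by apply: is_derive1_ln; exact/y0/ltW.
Qed.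

Lemma acp_expRN (d : R) : ac_primitive (fun t => expR (- d * t)) (fun t => - d * expR (- d * t)).
Proof.
have := acp_expR (acpZ (- d) (@acp_id R)).
by apply: acp_eqr => t _; rewrite mulr1 mulrC.
Qed.

Lemma cont0_expRN (d : R) : cont0 (fun t => expR (- d * t)).
Proof. exact: cont0_acp (acp_expRN d). Qed.

(** In logarithmic form the harvest is the additive term [- w], so a comparison of two trajectories
    involves only differences of efforts and of relative growth rates. *)
Lemma trajectory_rate x w : (forall t, 0 <= t -> 0 < x t) ->
  ac_primitive x (fun t => F (x t) - w t * x t) ->
  ac_primitive (fun t => ln (x t)) (fun t => F (x t) / x t - w t).
Proof.
move=> x0 /(acp_ln x0); apply: acp_eqr => t t0.
by rewrite mulrBl mulfK// gt_eqF// x0.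
Qed.

Section one_trajectory.
Variables (x w : R -> R).
Hypothesis px : ac_primitive x (fun t => F (x t) - w t * x t).
Hypothesis lw : loc_int w.
Hypothesis w_ge0 : {ae leb, forall t, 0 <= t -> 0 <= w t}.
Hypothesis x_gt0 : forall t, 0 <= t -> 0 < x t.
Hypothesis x_le : forall t, 0 <= t -> x t <= xbar.

Lemma growth_bounded : exists2 Fm : R, 0 <= Fm & forall s, 0 <= s -> s <= xbar -> F s <= Fm.
Proof.
have [L L0 HL] := growth_lipschitz F_C2 xbar.
exists (L * xbar); first by rewrite mulr_ge0// ltW.
move=> s s0 sX; have := HL 0 s (lexx 0) (ltW xbar_gt0) s0 sX.
rewrite F_0 !subr0 [`|s|]ger0_norm// => h.
by rewrite (le_trans (ler_norm _))// (le_trans h)// ler_wpM2l// ltW.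
Qed.

Lemma cont0_deriv_trajectory : cont0 (fun t => F' (x t)).
Proof.
have [dF dF' cF''] := F_C2.
have cF''X : {within `[0, xbar], continuous F''}.
  by apply: continuous_subspaceW cF''; exact: subset_itvl.
have [M M0 HM] := within_continuous_bounded cF''X.
have bd s : 0 < s -> s < xbar -> `|F'' s| <= M by move=> s0 sX; apply: HM; exact: ltW.
apply: (@cont0_lipschitz _ x M) => //; last exact: cont0_acp px.
move=> s t s0 t0; apply: (halfline_lipschitz dF' bd); rewrite ?x_le//; exact/ltW/x_gt0.
Qed.

(** [a] is the coefficient of the equation linearized along [x], and [phi] is its solution with
    [phi 0 = 1]. *)
Let a t := F' (x t) - w t.
Let A t := \int[leb]_(s in `[0, t]) a s.
Let phi t := expR (A t).

Let la : loc_int a.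
Proof. by apply: loc_intB => //; apply: cont0_loc_int; exact: cont0_deriv_trajectory. Qed.

Let pA : ac_primitive A a := acp_integral la.

Let pphi : ac_primitive phi (fun t => phi t * a t) := acp_expR pA.

(* Concavity gives F'(x) <= F(x)/x, so the linearized flow is dominated by x. *)
Let phi_x t s : 0 <= t -> t <= s -> phi s * x t <= phi t * x s.
Proof.
move=> t0 ts; have s0 := le_trans t0 ts.
have := acp_le pA (trajectory_rate x_gt0 px) t0 ts.
move=> K; have {}K : A s - A t <= ln (x s) - ln (x t).
  apply: K; apply: aeT => z tz zs; rewrite /a lerD2r.
  have z0 := le_trans t0 tz.
  by rewrite ler_pdivlMr ?x_gt0// mulrC (growth_tangent F_C2 F_0 F''_lt0)// ?x_gt0// x_le.
rewrite -[x t]lnK ?posrE ?x_gt0// -[x s]lnK ?posrE ?x_gt0// -!expRD ler_expR; lra.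
Qed.

Let b t := expR (- delta * t) * phi t * w t.
Let B t := \int[leb]_(s in `[0, t]) b s.

Let lb : loc_int b.
Proof.
apply: loc_int_mul_continuous lw => T T0.
by apply: cont0M T T0; [exact: cont0_expRN|exact: cont0_acp pphi].
Qed.

Let pB : ac_primitive B b := acp_integral lb.

Let B_nd s t : 0 <= s -> s <= t -> B s <= B t.
Proof.
move=> s0 st; apply: (acp_nondecreasing pB) => //; apply: aeS1 w_ge0 => z wz sz _.
by apply: mulr_ge0; [apply: mulr_ge0; exact: expR_ge0|apply: wz; exact: le_trans sz].
Qed.

(** With [k = x t / phi t], the bound [phi_x] gives [k * phi <= x] from [t] on, so it suffices to
    bound the discounted harvest [\int exp (- delta s) w x]. Because [F <= Fm] along the trajectory,
    [exp (- delta s) (x + Fm / delta)] decreases at least at the rate of that integrand; its value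
    at [t] is the bound. *)
Let B_tail : exists2 K : R, 0 <= K & forall t T, 0 <= t -> t <= T ->
  (B T - B t) * x t <= phi t * (K * expR (- delta * t)).
Proof.
have [Fm Fm0 HFm] := growth_bounded.
exists (xbar + Fm / delta) => [|t T t0 tT]; first by rewrite addr_ge0 ?divr_ge0// ltW.
have phit : 0 < phi t by exact: expR_gt0.
pose k := x t / phi t.
have k0 : 0 < k by rewrite divr_gt0// x_gt0.
have p1 := acpZ k pB.
have p2 := acpM (acp_expRN delta) (acpD px (acp_cst (Fm / delta))).
have := acp_nondecreasing (acpN (acpD p1 p2)) t0 tT => K.
have {}K : - (k * B t + expR (- delta * t) * (x t + Fm / delta)) <=
           - (k * B T + expR (- delta * T) * (x T + Fm / delta)).
  apply: K; apply: aeS1 w_ge0 => s ws ts sT.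
  have s0 := le_trans t0 ts.
  set e := expR _; have e0 : 0 <= e by exact: expR_ge0.
  have h1 : k * phi s <= x s by rewrite /k mulrAC ler_pdivrMr// [leLHS]mulrC [leRHS]mulrC phi_x.
  have h2 : F (x s) <= Fm by rewrite HFm// ?x_le// ltW// x_gt0.
  have h3 : 0 <= x s by rewrite ltW// x_gt0.
  rewrite (_ : - _ = e * (w s * (x s - k * phi s) + (Fm - F (x s)) + delta * x s)); last first.
    by rewrite /b -/e; field; rewrite gt_eqF.
  rewrite mulr_ge0// addr_ge0// ?mulr_ge0 ?(ltW delta_gt0)//.
  by rewrite addr_ge0 ?subr_ge0// mulr_ge0 ?subr_ge0 ?ws.
have h1 : 0 <= expR (- delta * T) * (x T + Fm / delta).
  by rewrite mulr_ge0 ?expR_ge0// addr_ge0 ?divr_ge0// ltW// x_gt0// (le_trans t0).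
have h2 : expR (- delta * t) * (x t + Fm / delta) <= (xbar + Fm / delta) * expR (- delta * t).
  by rewrite mulrC ler_wpM2r ?expR_ge0// lerD2r x_le.
have h3 : k * (B T - B t) <= (xbar + Fm / delta) * expR (- delta * t) by lra.
have -> : (B T - B t) * x t = phi t * (k * (B T - B t)) by rewrite /k; field; rewrite gt_eqF.
by rewrite ler_wpM2l// ltW.
Qed.

(** Variation of constants: [l1 * phi] is [p] times the integral of [exp (- delta s) phi w] over
    [[t, +oo[]. Among all solutions this is the one for which [l1 * phi] tends to 0, a choice that
    plays the part of a transversality condition. *)
Lemma adjoint_exists : exists l1 : R -> R, exists2 K : R, 0 <= K &
  ac_primitive l1 (fun t => - l1 t * (F' (x t) - w t) - expR (- delta * t) * p * w t) /\
  forall t, 0 <= t -> 0 <= l1 t /\ l1 t * x t <= K * expR (- delta * t).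
Proof.
have [K K0 HK] := B_tail.
pose S := [set B T | T in [set T | 0 <= T]].
have S0 : S (B 0) by exists 0 => //=.
have hS : has_sup S.
  split; first by exists (B 0).
  exists (phi 0 * (K * expR (- delta * 0)) / x 0 + B 0) => _ [T /= T0 <-].
  by rewrite -lerBlDr ler_pdivlMr ?x_gt0// HK.
pose Boo := sup S.
have BB t : 0 <= t -> B t <= Boo by move=> t0; apply: ub_le_sup; [case: hS|exists t].
have Btail t : 0 <= t -> (Boo - B t) * x t <= phi t * (K * expR (- delta * t)).
  move=> t0; rewrite -ler_pdivlMr ?x_gt0// lerBlDr; apply: ge_sup; first by exists (B 0).
  move=> _ [T /= T0 <-]; rewrite -lerBlDr ler_pdivlMr ?x_gt0//.
  have [tT|/ltW Tt] := leP t T; first exact: HK.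
  apply: (@le_trans _ _ 0).
    by rewrite mulr_le0_ge0 ?subr_le0 ?B_nd// ltW// x_gt0.
  by rewrite mulr_ge0 ?expR_ge0// mulr_ge0// expR_ge0.
pose l1 t := p * (Boo - B t) * expR (- A t).
have phiN t : phi t * expR (- A t) = 1 by rewrite /phi -expRD subrr expR0.
exists l1, (p * K); first by rewrite mulr_ge0.
split.
  have := acpM (acpZ p (acpB (acp_cst Boo) pB)) (acp_expR (acpN pA)).
  apply: acp_eqr => t t0; rewrite /l1 /b -/(a t).
  rewrite [X in _ + X = _](_ : _ = - (expR (- delta * t) * p * w t * (phi t * expR (- A t)))); last by ring.
  by rewrite phiN; ring.
move=> t t0; split.
  by rewrite /l1 mulr_ge0 ?expR_ge0// mulr_ge0// subr_ge0 BB.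
rewrite (_ : l1 t * x t = p * expR (- A t) * ((Boo - B t) * x t)); last by rewrite /l1; ring.
apply: le_trans (ler_wpM2l _ (Btail t t0)) _; first by rewrite mulr_ge0 ?expR_ge0.
rewrite [leLHS](_ : _ = p * K * expR (- delta * t) * (phi t * expR (- A t))); last by ring.
by rewrite phiN mulr1.
Qed.
End one_trajectory.

(** Where [ln (y / x)] exceeds [m t], the stock [y] is the larger one and has the smaller relative
    growth rate, so the derivative of [ln (y / x)] is at most [w - v <= m]. No Lipschitz constant of
    [F] enters. *)
Lemma trajectory_ratio_le x y w v (m : R) : 0 <= m ->
  (forall t, 0 <= t -> 0 < x t /\ x t <= xbar) ->
  (forall t, 0 <= t -> 0 < y t /\ y t <= xbar) ->
  ac_primitive x (fun t => F (x t) - w t * x t) ->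
  ac_primitive y (fun t => F (y t) - v t * y t) ->
  (forall t, 0 <= t -> w t - v t <= m) -> x 0 = y 0 ->
  forall t, 0 <= t -> y t <= x t * expR (m * t).
Proof.
move=> m0 Hx Hy px py wv xy0 t t0.
have x0 s : 0 <= s -> 0 < x s by move=> /Hx[].
have y0 s : 0 <= s -> 0 < y s by move=> /Hy[].
have pf := acpB (acpB (trajectory_rate y0 py) (trajectory_rate x0 px)) (acpZ m (@acp_id R)).
have : ln (y t) - ln (x t) - m * t <= 0.
  apply: (acp_barrier (L := 0) pf) => //; first by rewrite xy0 subrr mulr0 subr0.
  apply: aeT => s s0 st fs; rewrite mul0r mulr1.
  have ms : 0 <= m * s by rewrite mulr_ge0.
  have xy : x s <= y s.
    rewrite -ler_ln ?posrE ?x0 ?y0//; lra.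
  have := growth_rate_noninc F_C2 F_0 F''_lt0 (x0 s s0) xy (Hy s s0).2.
  by have := wv s s0; lra.
move=> h; rewrite -[y t]lnK ?posrE ?y0// -[x t]lnK ?posrE ?x0// -expRD ler_expR; lra.
Qed.

(** The ratio bound in both directions gives [|y - x| <= x m t exp (m t)]. Then
    [m t <= (m / a) exp (a t)] and [m <= a] turn this into a bound linear in [m], with an
    exponential rate [2 a] fixed beforehand. *)
Lemma trajectory_dist_le x y w v (m a : R) : 0 <= m -> 0 < a -> m <= a ->
  (forall t, 0 <= t -> 0 < x t /\ x t <= xbar) ->
  (forall t, 0 <= t -> 0 < y t /\ y t <= xbar) ->
  ac_primitive x (fun t => F (x t) - w t * x t) ->
  ac_primitive y (fun t => F (y t) - v t * y t) ->
  (forall t, 0 <= t -> `|v t - w t| <= m) -> x 0 = y 0 ->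
  forall t, 0 <= t -> `|y t - x t| <= x t * (m / a * expR (2 * a * t)).
Proof.
move=> m0 a0 ma Hx Hy px py vw xy0 t t0.
have wv s : 0 <= s -> w s - v s <= m.
  by move=> s0; rewrite (le_trans (ler_norm _))// distrC vw.
have vw' s : 0 <= s -> v s - w s <= m by move=> s0; rewrite (le_trans (ler_norm _))// vw.
have h1 := trajectory_ratio_le m0 Hx Hy px py wv xy0 t0.
have h2 := trajectory_ratio_le m0 Hy Hx py px vw' (esym xy0) t0.
have [xt _] := Hx t t0; have [yt _] := Hy t t0.
set z := m * t in h1 h2; have z0 : 0 <= z by rewrite mulr_ge0.
have ez : expR z - 1 <= z * expR z.
  have := expR_ge1Dx (- z); rewrite expRN => h.
  have : expR z * (1 - z) <= expR z * (expR z)^-1 by rewrite ler_wpM2l ?expR_ge0//; lra.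
  rewrite divff ?gt_eqF ?expR_gt0//; lra.
have h3 : `|y t - x t| <= x t * (z * expR z).
  have xez : x t * (expR z - 1) <= x t * (z * expR z) by rewrite ler_wpM2l// ltW.
  rewrite ler_norml; apply/andP; split; last by lra.
  have : x t * expR (- z) <= y t.
    rewrite -(ler_pM2r (expR_gt0 z)) -mulrA -expRD addNr expR0 mulr1; lra.
  have : 1 - z <= expR (- z) by have := expR_ge1Dx (- z); lra.
  move=> /(ler_wpM2l (ltW xt)).
  have : 1 <= expR z by rewrite -expR0 ler_expR.
  move=> /(ler_wpM2l z0)/(ler_wpM2l (ltW xt)); lra.
rewrite (le_trans h3)// ler_wpM2l ?(ltW xt)//.
have e1 : expR z <= expR (a * t) by rewrite ler_expR ler_wpM2r.
have e2 : a * t <= expR (a * t) by have := expR_ge1Dx (a * t); lra.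
have e3 : z <= m / a * expR (a * t).
  rewrite (_ : z = m / a * (a * t)); last by rewrite /z; field; rewrite gt_eqF.
  by rewrite ler_wpM2l// divr_ge0// ltW.
apply: (@le_trans _ _ (m / a * expR (a * t) * expR (a * t))).
  by apply: ler_pM => //; exact: expR_ge0.
rewrite -mulrA -expRD le_eqVlt; apply/orP; left; apply/eqP.
by congr (_ * expR _); ring.
Qed.

Section variation.
Variables (c : R) (x w l1 h : R -> R) (K M : R).
Hypothesis px : ac_primitive x (fun t => F (x t) - w t * x t).
Hypothesis lw : loc_int w.
Hypothesis Hx : forall t, 0 <= t -> 0 < x t /\ x t <= xbar.
Hypothesis pl1 : ac_primitive l1
  (fun t => - l1 t * (F' (x t) - w t) - expR (- delta * t) * p * w t).
Hypothesis K0 : 0 <= K.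
Hypothesis Hl1 : forall t, 0 <= t -> 0 <= l1 t /\ l1 t * x t <= K * expR (- delta * t).
Hypothesis lh : loc_int h.
Hypothesis M0 : 0 <= M.
Hypothesis hM : forall t, 0 <= t -> `|h t| <= M.

Let sigma t := l1 t * x t + expR (- delta * t) * (c - p * x t).

Lemma cont0_switching : cont0 sigma.
Proof.
apply: cont0D; first by apply: cont0M; [exact: cont0_acp pl1|exact: cont0_acp px].
apply: cont0M; first exact: cont0_expRN.
apply: cont0D; first exact: cont0_cst.
by apply: cont0N; apply: cont0M; [exact: cont0_cst|exact: cont0_acp px].
Qed.

Lemma loc_int_cost y v : cont0 y -> loc_int v ->
  loc_int (fun t => expR (- delta * t) * (c - p * y t) * v t).
Proof.
move=> cy lv; apply: loc_int_mul_continuous lv => T T0.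
apply: cont0M T T0; first exact: cont0_expRN.
apply: cont0D; first exact: cont0_cst.
by apply: cont0N; apply: cont0M; first exact: cont0_cst.
Qed.

Lemma first_variation : exists2 C : R, 0 <= C &
  forall (e : R) (y : R -> R), 0 < e -> e * M <= delta / 8 -> y 0 = x 0 ->
    ac_primitive y (fun t => F (y t) - (w t + e * h t) * y t) ->
    (forall t, 0 <= t -> 0 < y t /\ y t <= xbar) ->
    forall T, 0 <= T ->
    \int[leb]_(t in `[0, T]) (expR (- delta * t) * (c - p * y t) * (w t + e * h t)
                              - expR (- delta * t) * (c - p * x t) * w t)
    <= e * \int[leb]_(t in `[0, T]) (sigma t * h t)
       + C * (e ^+ 2 + e * expR (- (delta / 2) * T)).
Proof.
have [M2 M20 HM2] := growth_taylor xbar F_C2.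
(* The relative deviation then grows at most like [exp (delta t / 4)]. Two such factors against
   [exp (- delta t)] leave [exp (- delta t / 2)], which is still integrable. *)
pose a := delta / 8.
have a0 : 0 < a by exact: divr_gt0.
pose C1 := M ^+ 2 / a * (K + p * xbar) + M2 * (K * (xbar * (M / a) ^+ 2)).
have C10 : 0 <= C1.
  rewrite /C1 addr_ge0// mulr_ge0//.
  - by rewrite divr_ge0 ?sqr_ge0// ltW.
  - by rewrite addr_ge0// mulr_ge0// ltW.
  - by rewrite mulr_ge0// mulr_ge0 ?sqr_ge0// ltW.
exists (K * M / a + C1 / (delta / 2)).
  by rewrite addr_ge0// divr_ge0// ?mulr_ge0// ltW// divr_gt0.
move=> e y e0 eM y0x0 py Hy T T0.
have leh : loc_int (fun t => w t + e * h t).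
  apply: loc_intD => //.
  by apply: (@loc_int_mul_continuous _ h (fun=> e)) => // ? ?; exact: cont0_cst.
have lq := loc_intB (loc_int_cost (cont0_acp py) leh) (loc_int_cost (cont0_acp px) lw).
have pQ := acp_integral lq.
have ls : loc_int (fun t => sigma t * h t) by exact: loc_int_mul_continuous cont0_switching lh.
have pS := acp_integral ls.
(* Subtracting [l1 * (y - x)] cancels the terms linear in [y - x] that do not contain [h], and
   subtracting [e] times the integral of [sigma h] cancels those linear in [h]. The rest is of order
   [e ^+ 2 * exp (- delta t / 2)]; the last summand compensates for it, so that the whole is
   nonincreasing. *)
have pZ := acpD (acpB (acpB pQ (acpM pl1 (acpB py px))) (acpZ e pS))
  (acpZ (e ^+ 2 * C1 / (delta / 2)) (acp_expRN (delta / 2))).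
have em0 : 0 <= e * M by rewrite mulr_ge0// ltW.
have vw s : 0 <= s -> `|(w s + e * h s) - w s| <= e * M.
  by move=> s0; rewrite addrAC subrr add0r normrM gtr0_norm// ler_pM2l// hM.
have dist := trajectory_dist_le em0 a0 eM Hx Hy px py vw (esym y0x0).
have E2 t : expR (2 * a * t) = expR (delta / 4 * t) by congr expR; rewrite /a; field.
have := acp_nondecreasing (acpN pZ) (lexx 0) T0.
rewrite !integral0_itv y0x0 subrr !mulr0 expR0 !subr0 add0r mulr1.
set Q := \int[leb]_(_ in _) _; set S := \int[leb]_(_ in _) _.
move=> Z; have {}Z : Q - l1 T * (y T - x T) - e * S
    + e ^+ 2 * C1 / (delta / 2) * expR (- (delta / 2) * T) <= e ^+ 2 * C1 / (delta / 2).
  rewrite -lerN2; apply: Z; apply: aeT => t t0 _.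
  rewrite oppr_ge0.
  have [l10 l1x] := Hl1 t0; have [xt xX] := Hx t0; have [yt yX] := Hy t t0.
  set E := expR (- delta * t); have E0 : 0 <= E by exact: expR_ge0.
  set G := expR (- (delta / 2) * t).
  have D := dist t t0; rewrite E2 in D; set q := expR (delta / 4 * t) in D.
  have q1 : 1 <= q by rewrite -expR0 ler_expR mulr_ge0// divr_ge0// ltW.
  have Eqq : E * q * q = G by rewrite /E /q /G -!expRD; congr expR; field.
  have Eq : E * q <= G by rewrite -Eqq ler_peMr// mulr_ge0// (le_trans ler01).
  pose r := F (y t) - F (x t) - F' (x t) * (y t - x t).
  have rM : `|r| <= M2 * (y t - x t) ^+ 2 by exact: HM2.
  set m := e * M / a in D *.
  have m0 : 0 <= m by rewrite /m divr_ge0// ltW.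
  have l1d : l1 t * `|y t - x t| <= K * m * G.
    apply: le_trans (ler_wpM2l l10 D) _.
    apply: (@le_trans _ _ (K * E * (m * q))).
      by rewrite [leLHS]mulrA ler_wpM2r// mulr_ge0// (le_trans ler01).
    rewrite [leLHS](_ : _ = K * m * (E * q)); last by ring.
    by rewrite ler_wpM2l// mulr_ge0.
  have pd : E * p * `|y t - x t| <= p * xbar * m * G.
    apply: le_trans (ler_wpM2l _ D) _; first by rewrite mulr_ge0.
    apply: (@le_trans _ _ (E * p * (xbar * (m * q)))).
      by rewrite ler_wpM2l ?mulr_ge0// ler_wpM2r// mulr_ge0// (le_trans ler01).
    rewrite [leLHS](_ : _ = p * xbar * m * (E * q)); last by ring.
    by rewrite ler_wpM2l// mulr_ge0// mulr_ge0// ltW.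
  have l1dd : l1 t * (y t - x t) ^+ 2 <= K * (xbar * m ^+ 2) * G.
    have h1 : (y t - x t) ^+ 2 <= (x t * (m * q)) ^+ 2.
      by rewrite -[(y t - x t) ^+ 2]real_normK ?num_real// lerXn2r// nnegrE ?normr_ge0// (le_trans _ D).
    apply: le_trans (ler_wpM2l l10 h1) _.
    rewrite [leLHS](_ : _ = l1 t * x t * (x t * (m * q) ^+ 2)); last by ring.
    apply: (@le_trans _ _ (K * E * (xbar * (m * q) ^+ 2))).
      apply: ler_pM => //; [by rewrite mulr_ge0// ltW|by rewrite mulr_ge0 ?sqr_ge0// ltW|].
      by rewrite ler_wpM2r ?sqr_ge0.
    by rewrite -Eqq le_eqVlt; apply/orP; left; apply/eqP; ring.
  have ht := hM t0.
  have h1 : e * h t * ((l1 t - E * p) * (y t - x t)) <= e * M * ((K * m + p * xbar * m) * G).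
    apply: le_trans (ler_norm _) _; rewrite !normrM (gtr0_norm e0) -!mulrA ler_pM2l//.
    apply: ler_pM => //.
    apply: (@le_trans _ _ ((l1 t + E * p) * `|y t - x t|)); last by lra.
    rewrite ler_wpM2r// (le_trans (ler_normB _ _))//.
    by rewrite (ger0_norm l10) (ger0_norm (mulr_ge0 E0 p_ge0)).
  have h2 : - (l1 t * r) <= M2 * (K * (xbar * m ^+ 2) * G).
    apply: le_trans (ler_norm _) _; rewrite normrN normrM (ger0_norm l10).
    apply: le_trans (ler_wpM2l l10 rM) _.
    by rewrite mulrCA ler_wpM2l.
  have h3 : e * M * ((K * m + p * xbar * m) * G) + M2 * (K * (xbar * m ^+ 2) * G) = e ^+ 2 * C1 * G.
    by rewrite /C1 /m; field; rewrite gt_eqF.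
  (* Exact form of the rest: the cross term of [h] with [y - x], and the Taylor remainder of [F]
     weighted by [l1]. *)
  set X := (X in X <= 0).
  suff -> : X = e * h t * ((l1 t - E * p) * (y t - x t)) - l1 t * r - e ^+ 2 * C1 * G by lra.
  by rewrite /X /sigma /r -/E -/G; field; rewrite gt_eqF.
have [l10 l1x] := Hl1 T0.
have D := dist T T0; rewrite E2 in D.
(* The boundary term is of first order in [e], but it decays as [T] grows. *)
have h1 : l1 T * (y T - x T) <= K * M / a * (e * expR (- (delta / 2) * T)).
  apply: (@le_trans _ _ (l1 T * `|y T - x T|)); first by rewrite ler_wpM2l// ler_norm.
  apply: le_trans (ler_wpM2l l10 D) _.
  apply: (@le_trans _ _ (K * expR (- delta * T) * (e * M / a * expR (delta / 4 * T)))).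
    by rewrite [leLHS]mulrA ler_wpM2r// mulr_ge0 ?expR_ge0// divr_ge0// ltW.
  rewrite [leLHS](_ : _ = K * M / a * e * (expR (- delta * T) * expR (delta / 4 * T))); last by ring.
  rewrite -mulrA ler_wpM2l//; first by rewrite divr_ge0 ?mulr_ge0// ltW.
  rewrite ler_pM2l// -expRD ler_expR; have := mulr_ge0 (ltW delta_gt0) T0; lra.
have G0 : 0 <= expR (- (delta / 2) * T) by exact: expR_ge0.
have C2 : 0 <= C1 / (delta / 2) by rewrite divr_ge0// ltW// divr_gt0.
have h2 : 0 <= e ^+ 2 * C1 / (delta / 2) * expR (- (delta / 2) * T).
  by rewrite mulr_ge0// -mulrA mulr_ge0// sqr_ge0.
have h3 : 0 <= K * M / a by rewrite divr_ge0 ?mulr_ge0// ltW.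
have h4 : 0 <= K * M / a * e ^+ 2 by rewrite mulr_ge0// sqr_ge0.
have h5 : 0 <= C1 / (delta / 2) * (e * expR (- (delta / 2) * T)).
  by rewrite mulr_ge0// mulr_ge0// ltW.
lra.
Qed.
End variation.
End adjoint.

(** * Integrals over the half-line *)

Section halfline_integrals.
Context {R : realType}.
Implicit Types (f g : R -> R) (c d s t e C T : R).
Notation leb := (@lebesgue_measure R).
Notation hl := (`[0%R, +oo[%classic : set R).

Lemma measurable_hl : measurable hl.
Proof. exact: measurable_itv. Qed.

Lemma loc_int_hl g : leb.-integrable hl (EFin \o g) -> loc_int g.
Proof.
move=> ig T; apply: (integrableS _ _ _ ig); [exact: measurable_hl|exact: measurable_itv|].
by move=> t; rewrite /= !in_itv/= => /andP[->].
Qed.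

Lemma hl_integrableD f g : leb.-integrable hl (EFin \o f) ->
  leb.-integrable hl (EFin \o g) -> leb.-integrable hl (EFin \o (fun t => f t + g t)).
Proof. by apply: integrable_EFinD; exact: measurable_hl. Qed.

Lemma hl_integrableB f g : leb.-integrable hl (EFin \o f) ->
  leb.-integrable hl (EFin \o g) -> leb.-integrable hl (EFin \o (fun t => f t - g t)).
Proof. by apply: integrable_EFinB; exact: measurable_hl. Qed.

Lemma Rintegral_hl_cvg g : leb.-integrable hl (EFin \o g) ->
  (\int[leb]_(t in `[0, n%:R]) g t) @[n --> \oo] --> \int[leb]_(t in hl) g t.
Proof.
move=> ig; have mhl := measurable_hl.
have mg : measurable_fun hl g by exact: integrable_EFin_measurable ig.
pose I n : set R := `[0, n%:R]%classic.
have mI n : measurable (I n) by exact: measurable_itv.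
have Ihl n : I n `<=` hl by move=> t; rewrite /I/= !in_itv/= => /andP[->].
have mf n : measurable_fun hl ((EFin \o g) \_ (I n)).
  have mEg : measurable_fun hl (EFin \o g) by exact/measurable_EFinP.
  have K : measurable_fun (hl `&` I n) (EFin \o g).
    by apply: (measurable_funS mhl _ mEg) => t [].
  exact: ((measurable_restrict (EFin \o g) (mI n) mhl).1 K).
have cv : {ae leb, forall t, hl t -> ((EFin \o g) \_ (I n)) t @[n --> \oo] --> (g t)%:E}.
  apply: aeT => t; rewrite /= in_itv/= andbT => t0; apply: cvg_near_cst.
  near=> n; rewrite patchE mem_set//= /I/= in_itv/= t0/=; near: n; exact: nbhs_infty_ger.
have dom : {ae leb, forall t, forall n, hl t -> (`|((EFin \o g) \_ (I n)) t| <= `|g t|%:E)%E}.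
  apply: aeT => t n _; rewrite patchE; case: ifP => _ //=.
  by rewrite normr0 lee_fin.
have mEg : measurable_fun hl (EFin \o g) by exact/measurable_EFinP.
have [_ _] := @dominated_convergence _ _ R leb hl mhl (fun n => (EFin \o g) \_ (I n))
  (EFin \o g) (abse \o (EFin \o g)) mf mEg cv (integrable_abse ig) dom.
have E : (\int[leb]_(x in hl) (EFin \o g) x)%E = (\int[leb]_(t in hl) g t)%:E.
  by rewrite EFin_Rintegral.
rewrite E => /fine_cvg; apply: cvg_trans; apply: near_eq_cvg; near=> n => /=.
rewrite -integral_mkcondr setIidr; last exact: Ihl.
by [].
Unshelve. all: by end_near. Qed.

Lemma integrable_hl_ge0 g C : loc_int g -> (forall t, 0 <= t -> 0 <= g t) ->
  (forall T, 0 <= T -> \int[leb]_(t in `[0, T]) g t <= C) ->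
  leb.-integrable hl (EFin \o g).
Proof.
move=> lg g0 HC; have mhl := measurable_hl.
have mg := loc_int_measurable lg.
apply/integrableP; split; first exact/measurable_EFinP.
have -> : (\int[leb]_(x in hl) `|(EFin \o g) x| = \int[leb]_(x in hl) (EFin \o g) x)%E.
  apply: eq_integral => t; rewrite inE/= in_itv/= andbT => t0.
  by rewrite ger0_norm// g0.
apply: (@le_lt_trans _ _ C%:E); last exact: ltry.
rewrite itv_bigcup0.
have cv : (\int[leb]_(x in `[0%R, n%:R]) (EFin \o g) x)%E @[n --> \oo] -->
   (\int[leb]_(x in \bigcup_n `[0%R, n%:R]%classic) (EFin \o g) x)%E.
  apply: ge0_nondecreasing_set_cvg_integral.
  - by move=> n m nm; apply/subsetPset; apply: subset_itvl; rewrite bnd_simp ler_nat.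
  - by move=> n; exact: measurable_itv.
  - by move=> n; apply/measurable_EFinP; exact: integrable_EFin_measurable (lg n%:R).
  - by move=> n t /=; rewrite in_itv/= => /andP[t0 _]; rewrite lee_fin g0.
rewrite -(cvg_lim _ cv)//; apply: lime_le; first by apply/cvg_ex; eexists; exact: cv.
near=> n; rewrite -[leLHS](EFin_Rintegral _ (lg n%:R)); last exact: measurable_itv.
by rewrite lee_fin HC.
Unshelve. all: by end_near. Qed.

Lemma Rintegral_itv_expRN_le d T : 0 < d -> 0 <= T ->
  \int[leb]_(t in `[0, T]) expR (- d * t) <= d^-1.
Proof.
move=> d0 T0.
have p1 : ac_primitive (fun t => - d^-1 * expR (- d * t)) (fun t => expR (- d * t)).
  have := acpZ (- d^-1) (acp_expRN d); apply: acp_eqr => t _.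
  by rewrite mulrA mulrNN mulVf ?mul1r// gt_eqF.
rewrite (acp_FTC p1)//; last by apply: cont0_loc_int; exact: cont0_expRN.
rewrite mulr0 expR0 mulr1 opprK mulNr gerDr oppr_le0.
by rewrite mulr_ge0 ?expR_ge0// invr_ge0 ltW.
Qed.

Lemma RintegralZl_itv c f T : loc_int f ->
  \int[leb]_(t in `[0, T]) (c * f t) = c * \int[leb]_(t in `[0, T]) f t.
Proof. by move=> lf; rewrite RintegralZl//; exact: lf. Qed.

Lemma loc_intZ c f : loc_int f -> loc_int (fun t => c * f t).
Proof. by move=> lf T; apply: integrable_EFinZ; [exact: measurable_itv|exact: lf]. Qed.

Lemma integrable_hl_exp g C d : 0 < d -> loc_int g ->
  (forall t, 0 <= t -> `|g t| <= C * expR (- d * t)) ->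
  leb.-integrable hl (EFin \o g).
Proof.
move=> d0 lg gC; have mg := loc_int_measurable lg.
have C0 : 0 <= C.
  by have := gC 0 (lexx 0); rewrite mulr0 expR0 mulr1; apply: le_trans.
have le : loc_int (fun t => expR (- d * t)) by apply: cont0_loc_int; exact: cont0_expRN.
have h : leb.-integrable hl (EFin \o (fun t => C * expR (- d * t))).
  apply: (@integrable_hl_ge0 _ (C * d^-1)); first exact: loc_intZ.
    by move=> t _; rewrite mulr_ge0// expR_ge0.
  by move=> T T0; rewrite RintegralZl_itv// ler_wpM2l// Rintegral_itv_expRN_le.
apply: (integrable_EFin_le _ _ h); [exact: measurable_hl|exact: mg|].
by move=> t; rewrite /= in_itv/= andbT; exact: gC.
Qed.

Lemma integrable_hl_mul_bounded f g M : leb.-integrable hl (EFin \o f) ->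
  measurable_fun hl g -> (forall t, 0 <= t -> `|g t| <= M) ->
  leb.-integrable hl (EFin \o (fun t => f t * g t)).
Proof.
move=> fi mg gM; have mhl := measurable_hl.
have h : leb.-integrable hl (EFin \o (fun t => M * `|f t|)).
  by apply: integrable_EFinZ => //; exact: (integrable_abse fi).
apply: (integrable_EFin_le _ _ h); first exact: measurable_hl.
  by apply: measurable_funM; [exact: integrable_EFin_measurable fi|exact: mg].
move=> t; rewrite /= in_itv/= andbT => t0.
by rewrite normrM mulrC ler_wpM2r// gM.
Qed.

(* [m t] stands for the mass of [0, t]. *)
Lemma capital_ge0 (gamma K0 : R) (K m : R -> R) : 0 <= gamma -> 0 <= K0 ->
  loc_int K -> (forall t, 0 < t -> 0 <= m t) ->
  (forall s t, 0 < s -> s <= t -> m s <= m t) ->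
  (forall t, 0 < t -> K t = K0 - gamma * \int[leb]_(s in `[0, t]) K s + m t) ->
  forall t, 0 < t -> 0 <= K t.
Proof.
move=> g0 K00 lK m0 mnd KE t t0.
have pI := acp_integral lK.
(* [m] need not be differentiable, so its value at [t] is frozen: [exp (gamma s) (K0 + m t - gamma
   \int_0^s K)] has derivative [gamma exp (gamma s) (m t - m s) >= 0] and equals
   [exp (gamma t) (K t)] at [s = t]. *)
have p1 := acpM (acp_expR (acpZ gamma (@acp_id R))) (acpB (acpZ gamma pI) (acp_cst (K0 + m t))).
have := acp_nondecreasing (acpN p1) (lexx 0) (ltW t0).
rewrite !mulr0 expR0 mul1r integral0_itv mulr0 sub0r opprK => H.
have {}H : K0 + m t <= - (expR (gamma * t) * (gamma * \int[leb]_(s in `[0, t]) K s - (K0 + m t))).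
  apply: H; apply: aeS1 (@ae_neq0 R) => s sn0 s0 st.
  have {sn0}s0' : 0 < s by rewrite lt_neqAle eq_sym sn0.
  rewrite (KE s s0') subr0 mulr1; set e := expR _; set I := Rintegral _ _ _.
  rewrite (_ : - _ = e * gamma * (m t - m s)); last by ring.
  by rewrite mulr_ge0 ?mulr_ge0 ?expR_ge0// subr_ge0 mnd.
move: H; rewrite (_ : - _ = expR (gamma * t) * K t); last by rewrite (KE t t0); ring.
have : 0 <= K0 + m t by rewrite addr_ge0// m0.
by move=> /le_trans h /h; rewrite pmulr_rge0// expR_gt0.
Qed.
End halfline_integrals.

(** * The first variation over the infinite horizon *)

Section halfline_variation.
Context {R : realType}.
Variables (F F' F'' : R -> R) (xbar delta p c : R).
Hypothesis F_C2 : is_C2_halfline F F' F''.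
Hypothesis xbar_gt0 : 0 < xbar.
Hypothesis F_0 : F 0 = 0.
Hypothesis F''_lt0 : forall x : R, 0 <= x -> x <= xbar -> F'' x < 0.
Hypothesis delta_gt0 : 0 < delta.
Hypothesis p_ge0 : 0 <= p.
Hypothesis c_ge0 : 0 <= c.
Implicit Types (s t e T : R) (v y : R -> R).
Notation leb := (@lebesgue_measure R).
Notation hl := (`[0%R, +oo[%classic : set R).

(** The function [exp (- delta t) (y + Fm / delta)] decreases at least at the rate of the discounted
    harvest, whose total is therefore bounded by the initial value, however large [v] is. *)
Lemma harvest_integrable y v : loc_int v -> (forall t, 0 <= t -> 0 <= v t) ->
  ac_primitive y (fun t => F (y t) - v t * y t) ->
  (forall t, 0 <= t -> 0 < y t /\ y t <= xbar) ->
  leb.-integrable hl (EFin \o (fun t => expR (- delta * t) * p * y t * v t)).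
Proof.
move=> lv v0 py Hy.
have [Fm Fm0 HFm] := growth_bounded F_C2 xbar_gt0 F_0.
have cont : cont0 (fun t => expR (- delta * t) * p * y t).
  apply: cont0M; last exact: cont0_acp py.
  by apply: cont0M; [exact: cont0_expRN|exact: cont0_cst].
have lg : loc_int (fun t => expR (- delta * t) * p * y t * v t).
  exact: loc_int_mul_continuous cont lv.
apply: (@integrable_hl_ge0 _ _ (p * (xbar + Fm / delta))) => // [t t0|T T0].
  have [yt _] := Hy t t0.
  by rewrite mulr_ge0 ?v0// mulr_ge0 ?(ltW yt)// mulr_ge0// expR_ge0.
have p1 := acp_integral lg.
have p2 := acpZ (- p) (acpM (acp_expRN delta) (acpD py (acp_cst (Fm / delta)))).
have := acp_le p1 p2 (lexx 0) T0; rewrite integral0_itv subr0 mulr0 expR0 mul1r => H.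
apply: le_trans (H _) _.
  apply: aeT => t t0 tT; have [yt yX] := Hy t t0.
  set e := expR _; have e0 : 0 <= e by exact: expR_ge0.
  rewrite -subr_ge0 (_ : _ - _ = e * p * ((Fm - F (y t)) + delta * y t)); last first.
    by field; rewrite gt_eqF.
  rewrite mulr_ge0 ?mulr_ge0// addr_ge0 ?subr_ge0 ?HFm ?(ltW yt)// mulr_ge0 ?(ltW yt)//.
  exact: ltW.
have [y0 y0X] := Hy 0 (lexx 0); have [yT _] := Hy T T0.
have h1 : 0 <= p * (expR (- delta * T) * (y T + Fm / delta)).
  by rewrite mulr_ge0// mulr_ge0 ?expR_ge0// addr_ge0 ?(ltW yT)// divr_ge0// ltW.
have h2 : p * y 0 <= p * xbar by rewrite ler_wpM2l.
lra.
Qed.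

Section variation.
Variables (x w l1 h : R -> R) (K M : R).
Hypothesis px : ac_primitive x (fun t => F (x t) - w t * x t).
Hypothesis lw : loc_int w.
Hypothesis w_ge0 : forall t, 0 <= t -> 0 <= w t.
Hypothesis Hx : forall t, 0 <= t -> 0 < x t /\ x t <= xbar.
Hypothesis iw : leb.-integrable hl (EFin \o (fun t => expR (- delta * t) * c * w t)).
Hypothesis pl1 : ac_primitive l1
  (fun t => - l1 t * (F' (x t) - w t) - expR (- delta * t) * p * w t).
Hypothesis K0 : 0 <= K.
Hypothesis Hl1 : forall t, 0 <= t -> 0 <= l1 t /\ l1 t * x t <= K * expR (- delta * t).
Hypothesis lh : loc_int h.
Hypothesis hM : forall t, 0 <= t -> `|h t| <= M.

Let sigma t := l1 t * x t + expR (- delta * t) * (c - p * x t).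

Lemma switching_bound t : 0 <= t -> `|sigma t| <= (K + c + p * xbar) * expR (- delta * t).
Proof.
move=> t0; have [xt xX] := Hx t0; have [l10 l1x] := Hl1 t0.
set E := expR (- delta * t) in l1x *; have E0 : 0 <= E by exact: expR_ge0.
apply: le_trans (ler_normD _ _) _.
rewrite ger0_norm ?mulr_ge0 ?(ltW xt)// normrM (ger0_norm E0).
have : E * `|c - p * x t| <= E * (c + p * xbar).
  rewrite ler_wpM2l// (le_trans (ler_normB _ _))// ger0_norm// lerD2l.
  by rewrite normrM (ger0_norm p_ge0) (gtr0_norm xt) ler_wpM2l.
lra.
Qed.

Lemma switching_integrable : leb.-integrable hl (EFin \o sigma).
Proof.
apply: (integrable_hl_exp delta_gt0 _ switching_bound).
apply: cont0_loc_int; exact: (@cont0_switching _ _ _ _ _ c _ _ _ px pl1).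
Qed.

Lemma cost_density_integrable y v : loc_int v -> (forall t, 0 <= t -> 0 <= v t) ->
  ac_primitive y (fun t => F (y t) - v t * y t) ->
  (forall t, 0 <= t -> 0 < y t /\ y t <= xbar) ->
  leb.-integrable hl (EFin \o (fun t => expR (- delta * t) * c * v t)) ->
  leb.-integrable hl (EFin \o (fun t => expR (- delta * t) * (c - p * y t) * v t)).
Proof.
move=> lv v0 py Hy iv.
have := hl_integrableB iv (harvest_integrable lv v0 py Hy).
by apply: eq_integrable => // t _ /=; congr EFin; ring.
Qed.

(** Limit of [first_variation] for growing [T] with [e] fixed: the boundary term disappears before
    [e] becomes small, and only the quadratic remainder is left. *)
Lemma halfline_variation : exists2 C : R, 0 <= C &
  forall (e : R) (y : R -> R), 0 < e -> e * M <= delta / 8 -> y 0 = x 0 ->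
    ac_primitive y (fun t => F (y t) - (w t + e * h t) * y t) ->
    (forall t, 0 <= t -> 0 < y t /\ y t <= xbar) ->
    (forall t, 0 <= t -> 0 <= w t + e * h t) ->
    leb.-integrable hl (EFin \o (fun t => expR (- delta * t) * (c - p * y t) * (w t + e * h t))) /\
    \int[leb]_(t in hl) (expR (- delta * t) * (c - p * y t) * (w t + e * h t))
    - \int[leb]_(t in hl) (expR (- delta * t) * (c - p * x t) * w t)
    <= e * \int[leb]_(t in hl) (sigma t * h t) + C * e ^+ 2.
Proof.
have M0 : 0 <= M by have := hM (lexx 0); apply: le_trans.
have [C C0 HC] := first_variation F_C2 xbar_gt0 F_0 F''_lt0 delta_gt0 p_ge0 c px lw Hx pl1 K0 Hl1 lh M0 hM.
exists C => // e y e0 eM y0 py Hy weh0.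
have mh : measurable_fun hl h := loc_int_measurable lh.
have ix := cost_density_integrable lw w_ge0 px Hx iw.
have leh : loc_int (fun t => w t + e * h t) by apply: loc_intD => //; exact: loc_intZ.
have cexp : leb.-integrable hl (EFin \o (fun t => e * c * expR (- delta * t))).
  apply: (@integrable_hl_exp _ _ `|e * c| delta) => //.
    by apply: loc_intZ; apply: cont0_loc_int; exact: cont0_expRN.
  by move=> t _; rewrite normrM [`|expR _|]ger0_norm// expR_ge0.
have iwh : leb.-integrable hl (EFin \o (fun t => expR (- delta * t) * c * (w t + e * h t))).
  have := hl_integrableD iw (integrable_hl_mul_bounded cexp mh hM).
  by apply: eq_integrable => // t _ /=; congr EFin; ring.
have iy := cost_density_integrable leh weh0 py Hy iwh.
have ish : leb.-integrable hl (EFin \o (fun t => sigma t * h t)).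
  exact: integrable_hl_mul_bounded switching_integrable mh hM.
split=> //.
have c1 : \int[leb]_(t in `[0, n%:R]) (expR (- delta * t) * (c - p * y t) * (w t + e * h t))
    - \int[leb]_(t in `[0, n%:R]) (expR (- delta * t) * (c - p * x t) * w t) @[n --> \oo] -->
    \int[leb]_(t in hl) (expR (- delta * t) * (c - p * y t) * (w t + e * h t))
    - \int[leb]_(t in hl) (expR (- delta * t) * (c - p * x t) * w t).
  by apply: cvgB; exact: Rintegral_hl_cvg.
have ce : expR (- (delta / 2) * n%:R) @[n --> \oo] --> (0 : R).
  have dn : ((delta / 2) * n%:R) @[n --> \oo] --> (+oo%R : set_system R).
    apply/cvgryPge => A; near=> n.
    rewrite -ler_pdivrMl ?divr_gt0//; near: n; exact: nbhs_infty_ger.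
  rewrite (_ : (fun n : nat => expR (- (delta / 2) * n%:R)) =
               (fun n : nat => expR (- (delta / 2 * n%:R)))); last first.
    by apply/funext => n; rewrite mulNr.
  exact: (@cvg_comp _ _ _ (fun n : nat => delta / 2 * n%:R) (fun z : R => expR (- z))
    _ _ _ dn (@cvgr_expR R)).
have c2 : e * \int[leb]_(t in `[0, n%:R]) (sigma t * h t)
       + C * (e ^+ 2 + e * expR (- (delta / 2) * n%:R)) @[n --> \oo] -->
    e * \int[leb]_(t in hl) (sigma t * h t) + C * (e ^+ 2 + e * 0).
  apply: cvgD; first by apply: cvgM; [exact: cvg_cst|exact: Rintegral_hl_cvg].
  apply: cvgM; first exact: cvg_cst.
  by apply: cvgD; [exact: cvg_cst|apply: cvgM; [exact: cvg_cst|exact: ce]].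
have -> : C * e ^+ 2 = C * (e ^+ 2 + e * 0) by rewrite mulr0 addr0.
apply: ler_cvg_to c1 c2 _; near=> n.
rewrite -RintegralB//; [|exact: (loc_int_hl iy)|exact: (loc_int_hl ix)].
exact: HC.
Unshelve. all: by end_near. Qed.
End variation.
End halfline_variation.

(** * Response of the capital to an investment *)

Lemma integrable_EFin_restrict (d : measure_display) (X : measurableType d) (R : realType)
    (mu : {measure set X -> \bar R}) (D : set X) (f : X -> R) : measurable D ->
  mu.-integrable D (EFin \o f) <-> mu.-integrable setT (EFin \o (f \_ D)).
Proof. by move=> mD; rewrite -restrict_EFin; exact: integrable_mkcond. Qed.

Section discounted_response.
Context {R : realType}.
Variables (gamma : R) (nu : {finite_measure set (measurableTypeR R) -> \bar R}).
Hypothesis gamma_ge0 : 0 <= gamma.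
Implicit Types (f g : R -> R) (s t : R).
Notation leb := (@lebesgue_measure R).
Notation hl := (`[0%R, +oo[%classic : set R).

Lemma hl_integrable_restrict g :
  leb.-integrable hl (EFin \o g) <-> leb.-integrable setT (EFin \o (g \_ hl)).
Proof. by apply: integrable_EFin_restrict; exact: measurable_hl. Qed.

(** Green function of [K' = - gamma K]: what is left at time [s] of a unit of capital bought at time
    [t]. It equals 1 at [s = t >= 0], in accordance with the right continuity of [K]. *)
Definition dkernel s t : R :=
  if (0 <= t) && (t <= s) then expR (- gamma * (s - t)) else 0.

Lemma dkernel_ge0 s t : 0 <= dkernel s t.
Proof. by rewrite /dkernel; case: ifP => // _; exact: expR_ge0. Qed.

Lemma dkernel_le1 s t : dkernel s t <= 1.
Proof.
rewrite /dkernel; case: ifP => // /andP[_ ts].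
by rewrite -expR0 ler_expR mulNr oppr_le0 mulr_ge0// subr_ge0.
Qed.

Lemma measurable_dkernel (d : measure_display) (X : measurableType d) (a b : X -> R) :
  measurable_fun setT a -> measurable_fun setT b ->
  measurable_fun setT (fun z => dkernel (a z) (b z)).
Proof.
move=> ma mb; apply: measurable_fun_ifT.
- by apply: measurable_and; apply: measurable_fun_ler => //; exact: measurable_cst.
- apply: measurableT_comp; first exact: measurable_expR.
  by apply: measurable_funM; [exact: measurable_cst|exact: measurable_funB].
- exact: measurable_cst.
Qed.

Definition response s : R := \int[nu]_t dkernel s t.

Lemma integrable_dkernel s : nu.-integrable setT (EFin \o dkernel s).
Proof.
apply: (@integrable_EFin_le _ _ R nu setT _ _ (fun=> 1)) => //.
- by apply: measurable_dkernel => //; exact: measurable_cst.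
- exact: finite_measure_integrable_cst.
- by move=> t _; rewrite ger0_norm ?dkernel_ge0 ?dkernel_le1.
Qed.

Let N := fine (nu setT).
Let NE : nu setT = N%:E. Proof. by rewrite /N fineK// fin_num_measure. Qed.

Lemma response_ge0 s : 0 <= response s.
Proof. by apply: Rintegral_ge0 => t _; exact: dkernel_ge0. Qed.

Lemma response_le s : response s <= N.
Proof.
rewrite -lee_fin EFin_Rintegral//; last exact: integrable_dkernel.
rewrite -NE -[leRHS]mul1e -(integral_cst nu measurableT 1%E).
apply: ge0_le_integral => //.
- by move=> t _; rewrite lee_fin dkernel_ge0.
- by apply/measurable_EFinP/measurable_dkernel => //; exact: measurable_cst.
- by move=> t _; rewrite lee_fin dkernel_le1.
Qed.

Section fubini.
Variable f : R -> R.
Hypothesis intf : leb.-integrable setT (EFin \o f).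

Let Phi (z : measurableTypeR R * measurableTypeR R) := (f z.1 * dkernel z.1 z.2)%:E.

Let mf : measurable_fun setT f := integrable_EFin_measurable intf.

Let mPhi : measurable_fun setT Phi.
Proof.
apply/measurable_EFinP; apply: measurable_funM.
  by apply: measurableT_comp; [exact: mf|exact: measurable_fst].
by apply: measurable_dkernel; [exact: measurable_fst|exact: measurable_snd].
Qed.

Let iPhi : (leb \x nu)%E.-integrable setT Phi.
Proof.
apply/(integrable12ltyP leb nu mPhi).
have mA : measurable_fun setT (abse \o Phi) by apply: measurableT_comp => //; exact: mPhi.
have i1 : leb.-integrable setT (EFin \o (fun s => N * `|f s|)).
  by apply: integrable_EFinZ; [exact: measurableT|exact: (integrable_abse intf)].
have mn : measurable_fun setT (fun s => (N * `|f s|)%:E).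
  by case/integrableP: i1.
apply: (@le_lt_trans _ _ (\int[leb]_s (N * `|f s|)%:E)%E); last first.
  have /integrableP[_] := i1; rewrite (_ : (\int[leb]_s _)%E = (\int[leb]_s (N * `|f s|)%:E)%E)//.
  apply: eq_integral => s _ /=; rewrite ger0_norm// mulr_ge0//.
  by rewrite /N fine_ge0.
apply: ge0_le_integral => //.
- by move=> s _; exact: integral_ge0.
- exact: (measurable_fun_fubini_tonelli_F (abse \o Phi) mA (fun z => abse_ge0 _)).
- move=> s _; rewrite [leRHS]EFinM -NE muleC -(integral_cst nu measurableT (`|f s|%:E)).
  apply: ge0_le_integral => //.
  + apply/measurable_EFinP; apply: measurableT_comp => //.
    have mc : measurable_fun setT (fun _ : measurableTypeR R => f s) by exact: measurable_cst.
    have md : measurable_fun setT (fun t : measurableTypeR R => dkernel s t).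
      by apply: measurable_dkernel; [exact: measurable_cst|exact: measurable_id].
    exact: (measurable_funM mc md).
  + move=> t _; rewrite /Phi/= lee_fin normrM ler_piMr// ger0_norm ?dkernel_ge0//.
    exact: dkernel_le1.
Qed.

Let inner1 s : (\int[nu]_t Phi (s, t) = (f s * response s)%:E)%E.
Proof.
rewrite /Phi /=; under eq_integral do rewrite EFinM.
rewrite integralZl//; last exact: integrable_dkernel.
by rewrite EFinM EFin_Rintegral//; exact: integrable_dkernel.
Qed.

Let inner2 t : (\int[leb]_s Phi (s, t) = (\int[leb]_s (f s * dkernel s t))%:E)%E.
Proof.
rewrite EFin_Rintegral//.
have i1 : leb.-integrable setT (EFin \o (fun s => `|f s|)) := integrable_abse intf.
apply: (integrable_EFin_le _ _ i1); first exact: measurableT.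
  apply: measurable_funM => //.
  by apply: measurable_dkernel => //; exact: measurable_cst.
move=> s _; rewrite normrM ler_piMr// ger0_norm ?dkernel_ge0//.
exact: dkernel_le1.
Qed.

Lemma response_fubini :
  leb.-integrable setT (EFin \o (fun s => f s * response s)) /\
  \int[leb]_s (f s * response s) = \int[nu]_t (\int[leb]_s (f s * dkernel s t)).
Proof.
have F1 := integrable_fubini_F iPhi.
have E1 : fubini_F nu Phi = EFin \o (fun s => f s * response s).
  by apply/funext => s; exact: inner1.
rewrite E1 in F1; split=> //.
rewrite /Rintegral; congr fine.
transitivity ((\int[leb]_s \int[nu]_t Phi (s, t))%E).
  by apply: eq_integral => s _; rewrite inner1.
transitivity ((\int[nu]_t \int[leb]_s Phi (s, t))%E); first exact: (Fubini iPhi).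
by apply: eq_integral => t _; exact: inner2.
Qed.
End fubini.

Lemma measurable_response : measurable_fun setT response.
Proof.
pose k (z : measurableTypeR R * measurableTypeR R) := (dkernel z.1 z.2)%:E.
have m : measurable_fun setT (fubini_F nu k).
  apply: measurable_fun_fubini_tonelli_F; last by move=> z; rewrite lee_fin dkernel_ge0.
  by apply/measurable_EFinP/measurable_dkernel; [exact: measurable_fst|exact: measurable_snd].
apply/measurable_EFinP.
have -> : EFin \o response = fubini_F nu k; last exact: m.
apply/funext => s; rewrite /response /= EFin_Rintegral//; exact: integrable_dkernel.
Qed.

Lemma loc_int_response : loc_int response.
Proof.
apply: loc_intP => T T0.
apply: (@integrable_EFin_le _ _ R leb _ _ _ (fun=> N)).
- exact: measurable_itv.
- by apply: measurable_funTS; exact: measurable_response.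
- have lN : loc_int (fun _ : R => N) by apply: cont0_loc_int; exact: cont0_cst.
  exact: lN.
- by move=> s _; rewrite ger0_norm ?response_ge0 ?response_le.
Qed.

(** This is the integral of [exp (- gamma (s - t)) g s] over [s >= t], written with an integral over
    [[0, t]] so that continuity and derivative come from the calculus of primitives. For
    [g = sigma * u] it is [- l2]. *)
Definition discounted_tail g t := expR (gamma * t) * (\int[leb]_(s in hl) (g s * expR (- gamma * s))
                    - \int[leb]_(s in `[0, t]) (g s * expR (- gamma * s))).

Lemma integrable_hl_discount g : leb.-integrable hl (EFin \o g) ->
  leb.-integrable hl (EFin \o (fun s => g s * expR (- gamma * s))).
Proof.
move=> ig; apply: (integrable_hl_mul_bounded (M := 1) ig).
  by apply: loc_int_measurable; apply: cont0_loc_int; exact: cont0_expRN.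
move=> s s0; rewrite ger0_norm ?expR_ge0// -expR0 ler_expR mulNr oppr_le0.
exact: mulr_ge0.
Qed.

Lemma dkernel_pairing g t : leb.-integrable hl (EFin \o g) -> 0 <= t ->
  \int[leb]_s ((g \_ hl) s * dkernel s t) = discounted_tail g t.
Proof.
move=> ig t0; have idg := integrable_hl_discount ig.
pose G s := g s * expR (- gamma * s).
pose B : set R := `]t, +oo[%classic.
have iB : leb.-integrable B (EFin \o G).
  apply: (integrableS _ _ _ idg); [exact: measurable_hl|exact: measurable_itv|].
  by move=> s; rewrite /B/= !in_itv/= !andbT => ts; rewrite (le_trans t0)// ltW.
have E1 : \int[leb]_(s in hl) G s - \int[leb]_(s in `[0, t]) G s = \int[leb]_(s in B) G s.
  by apply: (@Rintegral_itvB R G (BLeft 0) (BInfty _ false) t idg); rewrite ?bnd_simp.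
rewrite /discounted_tail -/G E1 -RintegralZl//; [|exact: measurable_itv].
have -> : \int[leb]_(s in B) (expR (gamma * t) * G s) =
          \int[leb]_(s in `[t, +oo[) (expR (gamma * t) * G s).
  apply: (@Rintegral_itv_obnd_cbnd R t (BInfty _ false) (fun s => expR (gamma * t) * G s)).
  by apply: integrable_EFinZ; [exact: measurable_itv|exact: iB].
rewrite [RHS]Rintegral_mkcond; apply: eq_Rintegral => s _.
rewrite !patchE /dkernel t0/=.
have [ts|st] := leP t s.
  rewrite !mem_set/= ?in_itv/= ?andbT ?(le_trans t0)// /G mulrCA -expRD.
  by congr (_ * expR _); ring.
rewrite mulr0 memNset//= in_itv/= andbT; apply/negP; rewrite -ltNge//.
Qed.

Lemma dkernel_lt0 s t : t < 0 -> dkernel s t = 0.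
Proof. by move=> t0; rewrite /dkernel leNgt t0. Qed.

Lemma discounted_tail_bounded g t : leb.-integrable hl (EFin \o g) -> 0 <= t ->
  `|discounted_tail g t| <= \int[leb]_(s in hl) `|g s|.
Proof.
move=> ig t0; rewrite -dkernel_pairing//.
have ig0 : leb.-integrable setT (EFin \o (g \_ hl)).
  exact: ((hl_integrable_restrict g).1 ig).
have i1 : leb.-integrable setT (EFin \o (fun s => `|(g \_ hl) s|)) := integrable_abse ig0.
have i2 : leb.-integrable setT (EFin \o (fun s => (g \_ hl) s * dkernel s t)).
  apply: (integrable_EFin_le _ _ i1); first exact: measurableT.
    have m1 : measurable_fun setT (g \_ hl) := integrable_EFin_measurable ig0.
    have m2 : measurable_fun setT (fun s : measurableTypeR R => dkernel s t).
      by apply: measurable_dkernel; [exact: measurable_id|exact: measurable_cst].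
    exact: (measurable_funM m1 m2).
  by move=> s _; rewrite normrM ler_piMr// ger0_norm ?dkernel_ge0// dkernel_le1.
apply: (le_trans (le_normr_Rintegral _ i2)) => //.
rewrite [leRHS]Rintegral_mkcond; apply: le_Rintegral => //; first exact: (integrable_abse i2).
  rewrite (_ : EFin \o _ = EFin \o (fun s => `|(g \_ hl) s|))//.
  by apply/funext => s /=; congr EFin; rewrite !patchE; case: ifP; rewrite ?normr0.
move=> s _; rewrite !patchE; case: ifP => _; last by rewrite mul0r normr0.
by rewrite normrM ler_piMr// ger0_norm ?dkernel_ge0// dkernel_le1.
Qed.

Lemma cont0_discounted_tail g : leb.-integrable hl (EFin \o g) -> cont0 (discounted_tail g).
Proof.
move=> ig; apply: cont0M.
  by have := @cont0_expRN R (- gamma); rewrite opprK.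
apply: cont0D; first exact: cont0_cst.
by apply: cont0N; apply: cont0_acp (acp_integral (loc_int_hl (integrable_hl_discount ig))).
Qed.

Lemma integrable_discounted_tail g : leb.-integrable hl (EFin \o g) -> nu.-integrable hl (EFin \o discounted_tail g).
Proof.
move=> ig; apply: (@integrable_EFin_le _ _ R nu hl _ _ (fun=> \int[leb]_(s in hl) `|g s|)).
- exact: measurable_hl.
- by apply: loc_int_measurable; apply: cont0_loc_int; exact: cont0_discounted_tail.
- apply: (@integrableS _ _ R nu setT hl); [exact: measurableT|exact: measurable_hl|by []|].
  exact: finite_measure_integrable_cst.
- by move=> t; rewrite /= in_itv/= andbT; exact: discounted_tail_bounded.
Qed.

(** By Fubini, [response] and [discounted_tail] are adjoint to each other. The effect of a change of
    capital caused by [nu] is thereby written as an integral against [nu] itself, which is how [l2]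
    enters. *)
Lemma response_pairing g : leb.-integrable hl (EFin \o g) ->
  leb.-integrable hl (EFin \o (fun s => g s * response s)) /\
  \int[leb]_(s in hl) (g s * response s) = \int[nu]_(t in hl) discounted_tail g t.
Proof.
move=> ig; have mhl := @measurable_hl R.
have ig0 : leb.-integrable setT (EFin \o (g \_ hl)).
  exact: ((hl_integrable_restrict g).1 ig).
have [i1 E] := response_fubini ig0.
have Jneg t : t \notin hl -> \int[leb]_s ((g \_ hl) s * dkernel s t) = 0.
  move=> /negP tn; have t0 : t < 0.
    by rewrite ltNge; apply/negP => t0; apply: tn; rewrite inE/= in_itv/= t0.
  by rewrite /Rintegral integral0_eq// => s _; rewrite dkernel_lt0// mulr0.
have Jpos t : t \in hl -> \int[leb]_s ((g \_ hl) s * dkernel s t) = discounted_tail g t.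
  by rewrite inE/= in_itv/= andbT => t0; exact: dkernel_pairing.
split.
- apply: (hl_integrable_restrict _).2.
  apply: eq_integrable i1 => // s _ /=.
  by rewrite !patchE; case: ifP => // _; rewrite mul0r.
rewrite [LHS]Rintegral_mkcond [RHS]Rintegral_mkcond.
transitivity (\int[leb]_s ((g \_ hl) s * response s)).
  by apply: eq_Rintegral => s _; rewrite !patchE; case: ifP => // _; rewrite mul0r.
rewrite E; apply: eq_Rintegral => t _; rewrite patchE.
by case: ifPn => [/Jpos|/Jneg] ->.
Qed.

(** Fubini with the test function equal to [gamma] on [[0, t]]: for a unit bought at [z] in [[0, t]]
    the kernel integrates to [1 - exp (- gamma (t - z))], the part that has depreciated by time
    [t]. *)
Lemma response_equation t : 0 <= t ->
  response t = fine (nu (`[0%R, t]%classic : set R)) - gamma * \int[leb]_(s in `[0, t]) response s.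
Proof.
move=> t0; pose I : set R := `[0, t]%classic.
have mI : measurable I by exact: measurable_itv.
pose f : R -> R := (fun=> gamma) \_ I.
have lg : loc_int (fun _ : R => gamma) by apply: cont0_loc_int; exact: cont0_cst.
have intf : leb.-integrable setT (EFin \o f).
  by apply: (integrable_EFin_restrict _ _ _).1 (lg t); exact: mI.
have [_ E] := response_fubini intf.
have fE s : f s = if s \in I then gamma else 0 by rewrite /f patchE.
have E1 : \int[leb]_s (f s * response s) = gamma * \int[leb]_(s in I) response s.
  rewrite -RintegralZl//; last exact: loc_int_response.
  rewrite [RHS]Rintegral_mkcond; apply: eq_Rintegral => s _.
  by rewrite fE patchE; case: ifP => // _; rewrite mul0r.
have pP : ac_primitive (fun s => - expR (- gamma * s)) (fun s => gamma * expR (- gamma * s)).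
  by have := acpN (acp_expRN gamma); apply: acp_eqr => s _; rewrite mulNr opprK.
have lP : loc_int (fun s => gamma * expR (- gamma * s)).
  by apply: loc_intZ; apply: cont0_loc_int; exact: cont0_expRN.
have E2 z : \int[leb]_s (f s * dkernel s z) = \1_I z - dkernel t z.
  have [/andP[z0 zt]|zI] := boolP ((0 <= z) && (z <= t)); last first.
    rewrite /Rintegral integral0_eq.
      rewrite indicE memNset ?/dkernel ?(negbTE zI) ?subrr//.
      by rewrite /I/= in_itv/=; exact/negP.
    move=> s _; rewrite fE /dkernel; case: ifP; last by rewrite mul0r.
    rewrite inE/I/= in_itv/= => /andP[_ st]; case: ifP; last by rewrite mulr0.
    by move=> /andP[z0 zs]; move: zI; rewrite z0 (le_trans zs st).
  rewrite indicE mem_set/=; last by rewrite /I/= in_itv/= z0.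
  transitivity (\int[leb]_(s in `[z, t]) (expR (gamma * z) * (gamma * expR (- gamma * s)))).
    rewrite [RHS]Rintegral_mkcond; apply: eq_Rintegral => s _.
    rewrite fE patchE /dkernel z0/=.
    have [zs|sz] := leP z s; last first.
      rewrite mulr0 memNset//= in_itv/= => /andP[zs _].
      by move: sz; rewrite ltNge zs.
    have [st|ts] := leP s t.
      rewrite !mem_set; [|by rewrite /= in_itv/= zs|by rewrite /I/= in_itv/= (le_trans z0)].
      by rewrite mulrCA -expRD; congr (_ * expR _); ring.
    by rewrite !memNset ?mul0r// /I/= in_itv/= => /andP[_]; rewrite leNgt ts.
  have iP : leb.-integrable `]z, t] (EFin \o (fun s => expR (gamma * z) * (gamma * expR (- gamma * s)))).
    apply: integrable_EFinZ; first exact: measurable_itv.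
    apply: (integrableS _ _ _ (lP t)); [exact: measurable_itv|exact: measurable_itv|].
    by move=> s; rewrite /= !in_itv/= => /andP[zs ->]; rewrite (le_trans z0)// ltW.
  rewrite -Rintegral_itv_obnd_cbnd//.
  rewrite RintegralZl//; last first.
    apply: (integrableS _ _ _ (lP t)); [exact: measurable_itv|exact: measurable_itv|].
    by move=> s; rewrite /= !in_itv/= => /andP[zs ->]; rewrite (le_trans z0)// ltW.
  rewrite -(@Rintegral_itvB R _ (BLeft 0) (BRight t) z (lP t)) ?bnd_simp//.
  rewrite !(acp_FTC pP lP)// /dkernel z0 zt/=.
  have -> : expR (- gamma * (t - z)) = expR (gamma * z) * expR (- gamma * t).
    by rewrite -expRD; congr expR; ring.
  have h : expR (gamma * z) * expR (- gamma * z) = 1.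
    by rewrite -expRD mulNr subrr expR0.
  rewrite !mulrBr !mulrN h; ring.
have i1 : nu.-integrable setT (EFin \o (\1_I : R -> R)).
  apply: (@integrable_EFin_le _ _ R nu setT _ _ (fun=> 1)) => //.
  - exact: finite_measure_integrable_cst.
  - by move=> z _; rewrite indicE; case: (_ \in _); rewrite ?normr1 ?normr0.
have E3 : \int[nu]_z (\1_I z - dkernel t z) = fine (nu I) - response t.
  rewrite RintegralB//; last exact: integrable_dkernel.
  by congr (_ - _); rewrite /Rintegral integral_indic// setIT.
move: E; rewrite E1 => E.
have {}E : gamma * \int[leb]_(s in I) response s = fine (nu I) - response t.
  by rewrite E -E3; apply: eq_Rintegral => z _; exact: E2.
by rewrite -/I; lra.
Qed.
End discounted_response.

(** * Admissible processes *)

Section admissible_processes.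
Context {R : realType}.
Variables (F : R -> R) (gamma x0 K0 : R).
Hypothesis gamma_ge0 : 0 <= gamma.
Hypothesis K0_ge0 : 0 <= K0.
Implicit Types (x K u v : R -> R) (s t T : R) (mu nu : {measure set (measurableTypeR R) -> \bar R}).
Notation leb := (@lebesgue_measure R).
Notation hl := (`[0%R, +oo[%classic : set R).

(** The capital equation involves neither [x] nor [u]; it is isolated because the variations of [mu]
    are built at this level, before any trajectory of the stock. *)
Definition capital K mu := [/\ K 0 = K0, loc_int K
  & forall t, 0 < t -> exists2 m : R, mu (`[0%R, t]%classic : set R) = m%:E
      & K t = K0 - gamma * \int[leb]_(s in `[0, t]) K s + m].

Lemma admissibleE x K u mu : admissible F gamma x0 K0 x K u mu <->
  [/\ measurable_fun hl u /\ {ae leb, forall t, 0 <= t -> 0 <= u t <= 1},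
      mu (`]-oo, 0%R[%classic : set R) = 0%E,
      (forall t, 0 <= t -> 0 <= x t) /\
        x 0 = x0 /\ ac_primitive x (fun t => F (x t) - u t * K t * x t)
    & capital K mu].
Proof.
have key (t : R) : leb.-integrable `[0, t] (EFin \o K) ->
    (K0%:E - \int[leb]_(s in `[0%R, t]) (gamma * K s)%:E)%E =
    (K0 - gamma * \int[leb]_(s in `[0, t]) K s)%:E.
  move=> iK; rewrite EFinB EFinM EFin_Rintegral//.
  by under [in LHS]eq_integral do rewrite EFinM; rewrite integralZl.
split=> [[hu hmu [hx0 /caratheodoryE hx] hK hKE]|[hu hmu [hx0 hx] [hK lK hKE]]].
  split=> //; split=> // [T|t t0].
    have [T0|T0] := ltP 0 T; first by have [] := hKE T T0.
    apply: (integrableS _ _ _ (hKE 1 ltr01).1); [exact: measurable_itv|exact: measurable_itv|].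
    by move=> t; rewrite /= !in_itv/= => /andP[-> tT]; rewrite (le_trans tT)// (le_trans T0).
  have [iK] := hKE t t0; rewrite key//.
  case: (mu _) => [m|//|//] => -[E]; exists m => //.
split=> //; first by split=> //; apply/caratheodoryE.
move=> t t0; split; first exact: lK.
have [m -> ->] := hKE t t0.
by rewrite key.
Qed.

Lemma capital_measure_lty K mu T : capital K mu -> (mu (`[0%R, T]%classic : set R) < +oo)%E.
Proof.
move=> [_ _ hK]; have T1 : 0 < `|T| + 1 by rewrite ltr_wpDl.
have [m mE _] := hK _ T1; apply: (@le_lt_trans _ _ m%:E); last exact: ltry.
rewrite -mE; apply: le_measure; rewrite ?inE; [exact: measurable_itv|exact: measurable_itv|].
by apply: subset_itvl; rewrite bnd_simp (le_trans (ler_norm _))// lerDl.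
Qed.

Lemma capital_nonneg K mu t : capital K mu -> 0 <= t -> 0 <= K t.
Proof.
move=> [hK0 lK hK]; rewrite le_eqVlt => /orP[/eqP<-|t0]; first by rewrite hK0.
apply: (@capital_ge0 _ gamma K0 K (fun t => fine (mu (`[0%R, t]%classic : set R)))) => //.
- move=> s q s0 sq; have [m mE _] := hK s s0; have [n nE _] := hK q (lt_le_trans s0 sq).
  rewrite mE nE/= -lee_fin -mE -nE.
  apply: le_measure; rewrite ?inE; [exact: measurable_itv|exact: measurable_itv|].
  by apply: subset_itvl; rewrite bnd_simp.
- by move=> s s0; have [m mE ->] := hK s s0; rewrite mE.
Qed.

Lemma measurable_hl_itv (f : R -> R) T : measurable_fun hl f -> measurable_fun `[0, T] f.
Proof.
by move=> mf; apply: (measurable_funS _ _ mf); [exact: measurable_hl|move=> t; rewrite /= !in_itv/= => /andP[->]].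
Qed.

Lemma loc_int_effort K v : loc_int K -> measurable_fun hl v ->
  (forall t, 0 <= t -> 0 <= v t <= 1) -> loc_int (fun t => v t * K t).
Proof.
move=> lK mv v01; apply: loc_int_mul_bounded => // [T|T T0]; first exact: measurable_hl_itv.
by exists 1 => t t0 _; have /andP[? ?] := v01 t t0; rewrite ger0_norm.
Qed.

(** The constraint on [u] holds almost everywhere only. Truncation makes it hold at every time and
    changes neither the trajectory nor the cost. *)
Definition clip u t := Num.max 0 (Num.min 1 (u t)).

Lemma clip01 u t : 0 <= clip u t <= 1.
Proof. by rewrite /clip le_max lexx/= ge_max ler01/= ge_min lexx. Qed.

Lemma clip_eq u t : 0 <= u t <= 1 -> clip u t = u t.
Proof. by move=> /andP[u0 u1]; rewrite /clip (min_idPr u1) (max_idPr u0). Qed.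

Lemma measurable_clip u : measurable_fun hl u -> measurable_fun hl (clip u).
Proof.
move=> mu; apply: measurable_maxr; first exact: measurable_cst.
by apply: measurable_minr => //; exact: measurable_cst.
Qed.

Lemma admissible_clip x K u mu : admissible F gamma x0 K0 x K u mu ->
  admissible F gamma x0 K0 x K (clip u) mu.
Proof.
move=> /admissibleE[[hu u01] hmu [hx [hx0 px]] cK]; apply/admissibleE; split=> //.
  split; first exact: measurable_clip.
  by apply: aeT => t _; exact: clip01.
split=> //; split=> //; apply: acp_eq px.
by apply: aeS1 u01 => t h t0; rewrite clip_eq// h.
Qed.

Lemma cost_clip delta p c r x K u mu : measurable_fun hl u -> loc_int K -> cont0 x ->
  {ae leb, forall t, 0 <= t -> 0 <= u t <= 1} ->
  cost delta p c r x K (clip u) mu = cost delta p c r x K u mu.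
Proof.
move=> hu lK cx u01; congr (_ + _)%E.
have mg v : measurable_fun hl v ->
    measurable_fun hl (fun t => expR (- delta * t) * (c - p * x t) * v t * K t).
  move=> mv; apply: measurable_funM; last exact: loc_int_measurable lK.
  apply: measurable_funM; last exact: mv.
  apply: loc_int_measurable; apply: cont0_loc_int.
  apply: cont0M; first exact: cont0_expRN.
  apply: cont0D; first exact: cont0_cst.
  by apply: cont0N; apply: cont0M => //; exact: cont0_cst.
apply: ae_eq_integral.
- exact: measurable_hl.
- by apply/measurable_EFinP; apply: mg; exact: measurable_clip.
- by apply/measurable_EFinP; apply: mg.
- apply: aeS1 u01 => t h; rewrite /= in_itv/= andbT => t0.
  by rewrite clip_eq// h.
Qed.

(* Vanishes at [0] because the jump at time [0] is not part of [K 0]. *)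
Definition impulse (nu : {finite_measure set (measurableTypeR R) -> \bar R}) t :=
  (0 < t)%R%:R * response gamma nu t.

Section impulse.
Variable nu : {finite_measure set (measurableTypeR R) -> \bar R}.

Lemma impulse_ge0 t : 0 <= impulse nu t.
Proof. by rewrite mulr_ge0// response_ge0. Qed.

Lemma impulse_le t : impulse nu t <= fine (nu setT).
Proof.
rewrite /impulse; case: ltP => _; first by rewrite mul1r response_le.
by rewrite mul0r fine_ge0.
Qed.

Lemma loc_int_impulse : loc_int (impulse nu).
Proof.
apply: loc_int_mul_bounded; last exact: loc_int_response.
- move=> T.
  have -> : (fun t : R => (0 < t)%R%:R) = (fun t : R => if 0 < t then 1 else 0 : R).
    by apply/funext => t; case: ifP.
  apply: measurable_fun_if => //.
  by apply: measurable_fun_ltr => //; exact: measurable_cst.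
- by move=> T T0; exists 1 => t _ _; case: (0 < t); rewrite ?normr1 ?normr0.
Qed.

Lemma Rintegral_impulse t : 0 <= t ->
  \int[leb]_(s in `[0, t]) impulse nu s = \int[leb]_(s in `[0, t]) response gamma nu s.
Proof.
move=> t0; have lr := @loc_int_response _ gamma nu gamma_ge0.
have p1 : ac_primitive (fun t => \int[leb]_(s in `[0, t]) response gamma nu s) (impulse nu).
  apply: acp_eq (acp_integral lr); apply: aeS1 (@ae_neq0 R) => s sn0 s0.
  by rewrite /impulse lt_neqAle eq_sym sn0 s0 mul1r.
by rewrite (acp_FTC p1 loc_int_impulse t0) integral0_itv subr0.
Qed.

(** The capital equation is affine in [K] and the mass of [[0, t]], so a multiple of
    [response_equation] can be added to it. The factor [e] may be negative, as long as the new
    masses come from a measure [mu']. *)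
Lemma capital_impulse K mu mu' e : capital K mu ->
  (forall t, 0 < t -> mu' (`[0%R, t]%classic : set R) =
     (fine (mu (`[0%R, t]%classic : set R)) + e * fine (nu (`[0%R, t]%classic : set R)))%:E) ->
  capital (fun t => K t + e * impulse nu t) mu'.
Proof.
move=> [K_0 lK hK] hmu'; have li := loc_int_impulse.
split; first by rewrite K_0 /impulse ltxx mul0r mulr0 addr0.
  by apply: loc_intD => //; exact: loc_intZ.
move=> t t0; eexists; first exact: hmu'.
have [m mE ->] := hK t t0.
rewrite RintegralD; [|exact: measurable_itv|exact: lK|exact: (loc_intZ e li)].
rewrite RintegralZl_itv// Rintegral_impulse ?ltW// /impulse t0 mul1r.
by rewrite (response_equation _ gamma_ge0 (ltW t0)) mE /=; ring.
Qed.

Lemma impulse_pairing g : leb.-integrable hl (EFin \o g) ->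
  leb.-integrable hl (EFin \o (fun t => g t * impulse nu t)) /\
  \int[leb]_(t in hl) (g t * impulse nu t) = \int[nu]_(t in hl) discounted_tail gamma g t.
Proof.
move=> ig; have mhl := @measurable_hl R.
have [i1 <-] := response_pairing nu gamma_ge0 ig.
have mi : measurable_fun hl (impulse nu) := loc_int_measurable loc_int_impulse.
split.
  apply: (integrable_hl_mul_bounded (M := fine (nu setT)) ig mi) => t _.
  by rewrite ger0_norm ?impulse_ge0 ?impulse_le.
congr fine; apply: ae_eq_integral => //.
- apply/measurable_EFinP; apply: measurable_funM => //; exact: integrable_EFin_measurable ig.
- by have /integrableP[] := i1.
- apply: aeS1 (@ae_neq0 R) => s sn0; rewrite /= in_itv/= andbT => s0.
  by rewrite /impulse lt_neqAle eq_sym sn0 s0 mul1r.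
Qed.
End impulse.
End admissible_processes.

(** * Variations of an optimal process *)

(** The lower bound [- g] makes the integral of the negative part finite; an integral below [+oo]
    then bounds the positive part as well. *)
Lemma integral_lty_integrable (d : measure_display) (X : measurableType d) (R : realType)
    (mu : {measure set X -> \bar R}) (D : set X) (f g : X -> R) : measurable D ->
  measurable_fun D f -> mu.-integrable D (EFin \o g) ->
  (forall t, D t -> - g t <= f t) -> (\int[mu]_(t in D) (f t)%:E < +oo)%E ->
  mu.-integrable D (EFin \o f).
Proof.
move=> mD mf ig gf flty.
have mEf : measurable_fun D (EFin \o f) by exact/measurable_EFinP.
have ineg : (\int[mu]_(t in D) (EFin \o f)^\- t < +oo)%E.
  have /integrableP[mg] := ig; apply: le_lt_trans.
  apply: ge0_le_integral => //; first exact: measurable_funeneg.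
    by apply: measurableT_comp.
  move=> t Dt; rewrite funenegE /= -EFin_max lee_fin ge_max normr_ge0 andbT.
  by apply: (le_trans _ (ler_norm _)); rewrite lerNl gf.
apply/integrableP; split=> //.
have -> : (fun t => `|(EFin \o f) t|)%E = ((EFin \o f)^\+ \+ (EFin \o f)^\-)%E.
  by rewrite -fune_abse.
rewrite ge0_integralD//; [|exact: measurable_funepos|exact: measurable_funeneg].
apply: lte_add_pinfty => //.
move: flty; rewrite integralE.
have n0 : (\int[mu]_(t in D) (EFin \o f)^\- t)%E \is a fin_num.
  by rewrite ge0_fin_numE//; apply: integral_ge0.
move: n0; rewrite -[EFin \o f]/(fun t => (f t)%:E).
case: (\int[mu]_(t in D) (fun t0 : X => (f t0)%:E)^\- t)%E => //= a _.
by case: (\int[mu]_(t in D) (fun t0 : X => (f t0)%:E)^\+ t)%E => //= b _; exact: ltry.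
Qed.

Lemma Rintegral_le0_ae_eq0 (d : measure_display) (X : measurableType d) (R : realType)
    (mu : {measure set X -> \bar R}) (D : set X) (f : X -> R) : measurable D ->
  mu.-integrable D (EFin \o f) -> (forall t, D t -> f t <= 0) ->
  0 <= \int[mu]_(t in D) f t -> {ae mu, forall t, D t -> f t = 0}.
Proof.
move=> mD intf f0 If.
have mf : measurable_fun D (EFin \o f) by case/integrableP: intf.
have E : (\int[mu]_(t in D) `|(EFin \o f) t| = (- \int[mu]_(t in D) f t)%:E)%E.
  rewrite EFinN EFin_Rintegral// -integralN//; last exact: integrable_add_def.
  by apply: eq_integral => t; rewrite inE => Dt /=; rewrite ler0_norm// f0.
have I0 : (\int[mu]_(t in D) `|(EFin \o f) t| = 0)%E.
  by apply/eqP; rewrite eq_le integral_ge0// andbT E lee_fin oppr_le0.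
have := (ae_eq_integral_abs mu mD mf).1 I0.
by apply: filterS => t h /h /= [].
Qed.

Lemma acp_discounted_tail (R : realType) (gamma : R) (g : R -> R) : 0 <= gamma ->
  (@lebesgue_measure R).-integrable (`[0%R, +oo[%classic : set R) (EFin \o g) ->
  ac_primitive (discounted_tail gamma g) (fun t => gamma * discounted_tail gamma g t - g t).
Proof.
move=> g0 ig; have lg := loc_int_hl (integrable_hl_discount g0 ig).
have := acpM (acp_expR (acpZ gamma (@acp_id R))) 
  (acpB (acp_cst (\int[@lebesgue_measure R]_(s in (`[0%R, +oo[%classic : set R)) (g s * expR (- gamma * s))))
    (acp_integral lg)).
apply: acp_eqr => t _; rewrite /discounted_tail.
have E : expR (gamma * t) * expR (- gamma * t) = 1 by rewrite -expRD mulNr subrr expR0.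
by rewrite -[in RHS](mulr1 (g t)) -[in RHS]E; ring.
Qed.

Lemma small_perturbation (R : realType) (A C M d : R) : 0 <= C -> 0 <= M -> 0 < d ->
  (forall e, 0 < e -> e <= 1 -> e * M <= d -> 0 <= A + C * e) -> 0 <= A.
Proof.
move=> C0 M0 d0 step; rewrite leNgt; apply/negP => A0.
(* The last bound forces [C * e <= - A / 2]; adding 1 to [M] and to [C] avoids division by zero. *)
pose e := Num.min 1 (Num.min (d / (M + 1)) (- A / (2 * (C + 1)))).
have M1 : 0 < M + 1 by lra.
have C1 : 0 < 2 * (C + 1) by lra.
have e0 : 0 < e by rewrite !lt_min ltr01 !divr_gt0//; lra.
have e1 : e <= 1 by rewrite ge_min lexx.
have eM : e * (M + 1) <= d by rewrite -ler_pdivlMr// !ge_min lexx !orbT.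
have eC : e * (2 * (C + 1)) <= - A by rewrite -ler_pdivlMr// !ge_min lexx !orbT.
have eMd : e * M <= d by lra.
by have := step e e0 e1 eMd; nra.
Qed.

Section optimal_process.
Context {R : realType}.
Variables (F F' F'' : R -> R) (xbar delta gamma p c r x0 K0 : R).
Hypothesis F_C2 : is_C2_halfline F F' F''.
Hypothesis xbar_gt0 : 0 < xbar.
Hypothesis F_0 : F 0 = 0.
Hypothesis F_xbar : F xbar = 0.
Hypothesis F_gt0 : forall x : R, 0 < x -> x < xbar -> 0 < F x.
Hypothesis F''_lt0 : forall x : R, 0 <= x -> x <= xbar -> F'' x < 0.
Hypothesis delta_gt0 : 0 < delta.
Hypothesis gamma_ge0 : 0 <= gamma.
Hypothesis p_ge0 : 0 <= p.
Hypothesis c_ge0 : 0 <= c.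
Hypothesis r_ge0 : 0 <= r.
Hypothesis x0_gt0 : 0 < x0.
Hypothesis x0_le : x0 <= xbar.
Hypothesis K0_ge0 : 0 <= K0.
Variables (x K u : R -> R) (mu : {measure set (measurableTypeR R) -> \bar R}).
Hypothesis opt : optimal F delta gamma p c r x0 K0 x K u mu.
Hypothesis u01 : forall t : R, 0 <= t -> 0 <= u t <= 1.
Implicit Types (s t e T : R) (h v y L : R -> R).
Notation leb := (@lebesgue_measure R).
Notation hl := (`[0%R, +oo[%classic : set R).

Let w t := u t * K t.
Let adm := (admissibleE F gamma x0 K0 x K u mu).1 opt.1.

Let mu_u : measurable_fun hl u. Proof. by have [[]] := adm. Qed.
Let cK : capital gamma K0 K mu. Proof. by have [] := adm. Qed.
Let lK : loc_int K. Proof. by have [] := cK. Qed.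
Let K_ge0 t : 0 <= t -> 0 <= K t. Proof. exact: capital_nonneg cK. Qed.
Let lw : loc_int w. Proof. exact: loc_int_effort. Qed.
Let w_ge0 t : 0 <= t -> 0 <= w t.
Proof. by move=> t0; have /andP[? _] := u01 t0; rewrite mulr_ge0// K_ge0. Qed.
Let x_0 : x 0 = x0. Proof. by have [_ _ [_ []]] := adm. Qed.
Let px : ac_primitive x (fun t => F (x t) - w t * x t). Proof. by have [_ _ [_ []]] := adm. Qed.
Let Hx t : 0 <= t -> 0 < x t /\ x t <= xbar.
Proof.
have x_ge0 s : 0 <= s -> 0 <= x s by have [_ _ [H _] _] := adm; exact: H.
have wae : {ae leb, forall t, 0 <= t -> 0 <= w t} by apply: aeT => s; exact: w_ge0.
move=> t0; split.
  by apply: (trajectory_gt0 F_C2 xbar_gt0 F_0 F_xbar F_gt0 px wae x_ge0 lw); rewrite ?x_0.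
by apply: (trajectory_le F_C2 xbar_gt0 F_xbar px wae x_ge0); rewrite ?x_0.
Qed.

Let density v y t := expR (- delta * t) * (c - p * y t) * v t.

Let cost_density y L v (g : R -> R) (nu : {measure set (measurableTypeR R) -> \bar R}) :
  (forall t, 0 <= t -> v t * L t = g t) ->
  cost delta p c r y L v nu =
  (\int[nu]_(t in hl) (expR (- delta * t) * r)%:E + \int[leb]_(t in hl) (density g y t)%:E)%E.
Proof.
move=> E; congr (_ + _)%E; apply: eq_integral => t; rewrite inE/= in_itv/= andbT => t0.
by rewrite /density -E//; congr EFin; ring.
Qed.

Lemma optimal_cost_le0 : (cost delta p c r x K u mu <= 0)%E.
Proof.
have w0 : {ae leb, forall t : R, 0 <= t -> (0 : R) <= 0} by apply: aeT.
have l0 : loc_int (fun _ : R => 0 : R) by apply: cont0_loc_int; exact: cont0_cst.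
have [y [y0 py Hy]] := trajectory_exists F_C2 xbar_gt0 F_0 F_xbar F_gt0 l0 w0 x0_gt0 x0_le.
pose L t := K0 * expR (- gamma * t).
have pL : ac_primitive L (fun t => - gamma * L t).
  by have := acpZ K0 (acp_expRN gamma); apply: acp_eqr => t _; rewrite /L; ring.
have lL : loc_int L by apply: cont0_loc_int; exact: cont0_acp pL.
have cL : capital gamma K0 L (@mzero _ (measurableTypeR R) R).
  split=> //; first by rewrite /L mulr0 expR0 mulr1.
  move=> t t0; exists 0 => //.
  have := acp_FTC pL (loc_intZ (- gamma) lL) (ltW t0).
  rewrite RintegralZl_itv// {3}/L mulr0 expR0 mulr1; lra.
have := opt.2 y L (fun=> 0) (@mzero _ (measurableTypeR R) R).
have aL : admissible F gamma x0 K0 y L (fun=> 0) (@mzero _ (measurableTypeR R) R).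
  apply/admissibleE; split=> //.
  - by split; [exact: measurable_cst|apply: aeT => t _; rewrite lexx ler01].
  - split; first by move=> t t0; have [/ltW] := Hy t t0.
    by split=> //; apply: acp_eqr py => t _; rewrite !mul0r.
move=> /(_ aL) /le_trans; apply.
rewrite /cost integral_measure_zero add0e integral0_eq// => t _.
by rewrite mulr0 mul0r.
Qed.

(** The setup cost is nonnegative and the total is at most 0, so the running cost is below [+oo].
    Its density is bounded below by minus the integrable discounted harvest, hence it is integrable,
    and then the setup cost is finite too. *)
Lemma optimal_integrable :
  mu.-integrable hl (EFin \o (fun t => expR (- delta * t) * r)) /\
  leb.-integrable hl (EFin \o (fun t => expR (- delta * t) * c * w t)).
Proof.
have mhl := @measurable_hl R.
have me : measurable_fun hl (fun t : R => expR (- delta * t) * r).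
  by apply: loc_int_measurable; apply: cont0_loc_int; apply: cont0M; [exact: cont0_expRN|exact: cont0_cst].
have := optimal_cost_le0; rewrite (@cost_density _ _ _ w)// => H.
set P := (\int[mu]_(t in hl) _)%E in H.
have P0 : (0 <= P)%E.
  by apply: integral_ge0 => t _; rewrite lee_fin mulr_ge0// expR_ge0.
set Q := (\int[leb]_(t in hl) _)%E in H.
have Qlt : (Q < +oo)%E by move: H P0; case: (P) => [a||]; case: (Q) => [b||] //; rewrite ?ltry.
have ih := harvest_integrable F_C2 xbar_gt0 F_0 delta_gt0 p_ge0 lw w_ge0 px Hx.
have lD : loc_int (density w x).
  by apply: loc_int_cost; [exact: cont0_acp px|exact: lw].
have iD : leb.-integrable hl (EFin \o density w x).
  apply: (integral_lty_integrable _ _ ih _ Qlt); [exact: mhl|exact: loc_int_measurable|].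
  move=> t; rewrite /= in_itv/= andbT => t0; rewrite /density.
  rewrite -subr_ge0 opprK (_ : _ + _ = expR (- delta * t) * c * w t); last by ring.
  by rewrite mulr_ge0 ?w_ge0// mulr_ge0// expR_ge0.
split; last first.
  have := hl_integrableD iD ih.
  by apply: eq_integrable => // t _ /=; congr EFin; rewrite /density; ring.
have Qfin : (Q \is a fin_num)%E by exact: integrable_fin_num iD.
apply/integrableP; split; first exact/measurable_EFinP.
rewrite (_ : (\int[mu]_(t in hl) _)%E = P).
  by move: H Qfin; case: (P) => [a||]; case: (Q) => //= b; rewrite ?ltry.
apply: eq_integral => t _; rewrite /= ger0_norm// mulr_ge0// expR_ge0.
Qed.

Section adjoint_variation.
Variables (l1 : R -> R) (B : R).
Hypothesis B_ge0 : 0 <= B.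
Hypothesis pl1 : ac_primitive l1
  (fun t => - l1 t * (F' (x t) - w t) - expR (- delta * t) * p * w t).
Hypothesis Hl1 : forall t, 0 <= t -> 0 <= l1 t /\ l1 t * x t <= B * expR (- delta * t).

Let sigma t := l1 t * x t + expR (- delta * t) * (c - p * x t).
Let setup_cost := \int[mu]_(t in hl) (expR (- delta * t) * r).

(** Common form of all the variations: the stock and the running cost see a competitor only through
    its effort [v * L], and its setup cost has to be affine in [e]. Optimality divided by [e] gives
    the inequality in the limit. *)
Lemma optimal_variation h (M rho : R) : loc_int h -> (forall t, 0 <= t -> `|h t| <= M) ->
  (forall e, 0 < e -> e <= 1 -> exists (L v : R -> R) (nu : {measure set (measurableTypeR R) -> \bar R}),
    [/\ measurable_fun hl v /\ (forall t, 0 <= t -> 0 <= v t <= 1),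
        nu (`]-oo, 0%R[%classic : set R) = 0%E, capital gamma K0 L nu,
        (forall t, 0 <= t -> v t * L t = w t + e * h t)
      & (\int[nu]_(t in hl) (expR (- delta * t) * r)%:E = (setup_cost + e * rho)%:E)%E]) ->
  0 <= rho + \int[leb]_(t in hl) (sigma t * h t).
Proof.
move=> lh hM pert; have mhl := @measurable_hl R.
have [imu iw] := optimal_integrable.
have [C C0 HC] := halfline_variation F_C2 xbar_gt0 F_0 F''_lt0 delta_gt0 p_ge0 c_ge0
  px lw w_ge0 Hx iw pl1 B_ge0 Hl1 lh hM.
have M0 : 0 <= M by have := hM 0 (lexx 0); apply: le_trans.
have step e : 0 < e -> e <= 1 -> e * M <= delta / 8 ->
    0 <= rho + \int[leb]_(t in hl) (sigma t * h t) + C * e.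
  move=> e0 e1 eM; have [L [v [nu [[mv v01] nu0 cL vL nuE]]]] := pert e e0 e1.
  have L_ge0 t : 0 <= t -> 0 <= L t by exact: capital_nonneg cL.
  have weh_ge0 t : 0 <= t -> 0 <= w t + e * h t.
    by move=> t0; rewrite -vL// mulr_ge0 ?L_ge0//; have /andP[] := v01 t t0.
  have lweh : loc_int (fun t => w t + e * h t) by apply: loc_intD => //; exact: loc_intZ.
  have [y [y0 py Hy]] := trajectory_exists F_C2 xbar_gt0 F_0 F_xbar F_gt0 lweh
    (aeT weh_ge0) x0_gt0 x0_le.
  have aL : admissible F gamma x0 K0 y L v nu.
    apply/admissibleE; split=> //.
    - by split=> //; exact: aeT.
    - split; first by move=> t t0; have [/ltW] := Hy t t0.
      by split=> //; apply: acp_eqr py => t t0; rewrite vL.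
  have y0x : y 0 = x 0 by rewrite y0 x_0.
  have [iy Hvar] := HC e y e0 eM y0x py Hy weh_ge0.
  have ix := cost_density_integrable F_C2 xbar_gt0 F_0 delta_gt0 p_ge0 lw w_ge0 px Hx iw.
  have := opt.2 y L v nu aL.
  rewrite (@cost_density _ _ _ w)// (@cost_density _ _ _ _ nu vL) nuE.
  have -> : (\int[mu]_(t in hl) (expR (- delta * t) * r)%:E = setup_cost%:E)%E.
    by rewrite /setup_cost EFin_Rintegral.
  have -> : (\int[leb]_(t in hl) (density w x t)%:E = (\int[leb]_(t in hl) density w x t)%:E)%E.
    by rewrite EFin_Rintegral.
  have -> : (\int[leb]_(t in hl) (density (fun t => w t + e * h t) y t)%:E =
             (\int[leb]_(t in hl) density (fun t => w t + e * h t) y t)%:E)%E.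
    by rewrite EFin_Rintegral.
  rewrite -!EFinD lee_fin => H.
  have {}Hvar : \int[leb]_(t in hl) density (fun t => w t + e * h t) y t
    - \int[leb]_(t in hl) density w x t <= e * \int[leb]_(t in hl) (sigma t * h t) + C * e ^+ 2.
    exact: Hvar.
  rewrite -(pmulr_rge0 _ e0) !mulrDr [e * (C * e)]mulrCA -expr2 -addrA.
  by apply: (le_trans _ (lerD (lexx _) Hvar)); rewrite addrA subr_ge0 -(lerD2l setup_cost) addrA.
apply: small_perturbation C0 M0 _ step.
exact: divr_gt0.
Qed.

Let cont0_sigma : cont0 sigma.
Proof. exact: (@cont0_switching _ _ _ _ _ _ _ _ _ px pl1). Qed.

Let sigma_int : leb.-integrable hl (EFin \o sigma).
Proof. exact: (switching_integrable delta_gt0 p_ge0 c_ge0 px Hx pl1 Hl1). Qed.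

(* The control variation is damped by [expR (- K)] so that it stays bounded
   although [K] may not be. *)
Lemma optimal_control_ae : {ae leb, forall t, 0 <= t ->
  forall z : R, 0 <= z -> z <= 1 -> K t * sigma t * u t <= K t * sigma t * z}.
Proof.
have mhl := @measurable_hl R.
(* A minimizer of [sigma t * z] over [z] in [[0, 1]], measurable because it is an indicator. *)
pose g t := if sigma t < 0 then 1 else 0 : R.
have g01 t : 0 <= g t <= 1 by rewrite /g; case: ifP => _; rewrite !lexx ?ler01.
have msigma : measurable_fun hl sigma by apply: loc_int_measurable; exact: cont0_loc_int.
have mg : measurable_fun hl g.
  apply: measurable_fun_if => //.
  by apply: measurable_fun_ltr => //; exact: measurable_cst.
have meK : measurable_fun hl (fun t => expR (- K t)).
  apply: (measurableT_comp (@measurable_expR R)); apply: measurableT_comp => //.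
  exact: loc_int_measurable.
pose a t := expR (- K t) * (g t - u t).
have ma : measurable_fun hl a by apply: measurable_funM => //; exact: measurable_funB.
have eK1 t : 0 <= t -> expR (- K t) <= 1.
  by move=> t0; rewrite -expR0 ler_expR oppr_le0 K_ge0.
have gu1 t : 0 <= t -> `|g t - u t| <= 1.
  move=> t0; have /andP[? ?] := g01 t; have /andP[? ?] := u01 t0.
  by rewrite ler_norml; apply/andP; split; lra.
have a1 t : 0 <= t -> `|a t| <= 1.
  move=> t0; rewrite normrM ger0_norm ?expR_ge0//.
  by rewrite -[leRHS]mulr1 ler_pM ?expR_ge0// ?eK1 ?gu1.
pose h t := a t * K t.
have lh : loc_int h.
  apply: loc_int_mul_bounded => // [T|T T0]; first exact: measurable_hl_itv.
  by exists 1 => t t0 _; exact: a1.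
have h1 t : 0 <= t -> `|h t| <= 1.
  move=> t0; rewrite /h /a mulrAC normrM.
  have eK : 0 <= expR (- K t) * K t <= 1.
    rewrite mulr_ge0 ?expR_ge0 ?K_ge0//= mulrC expRN -ler_pdivlMr ?invr_gt0 ?expR_gt0//.
    rewrite mul1r invrK; apply: le_trans (expR_ge1Dx _); lra.
  have /andP[eK0 eK1'] := eK.
  by rewrite ger0_norm// -[leRHS]mulr1 ler_pM ?gu1.
have H0 : 0 <= 0 + \int[leb]_(t in hl) (sigma t * h t).
  apply: (optimal_variation lh h1) => e e0 e1.
  exists K, (fun t => u t + e * a t), mu; split.
  - split.
      by apply: measurable_funD => //; apply: measurable_funM => //; exact: measurable_cst.
    move=> t t0; have /andP[u0 u1] := u01 t0; have /andP[gt0 gt1] := g01 t.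
    rewrite /a mulrA; set k := e * expR _.
    have k0 : 0 <= k by rewrite mulr_ge0 ?expR_ge0// ltW.
    have k1 : k <= 1 by rewrite -[leRHS]mulr1 ler_pM ?expR_ge0 ?eK1// ltW.
    clearbody k; apply/andP; split; nra.
  - by have [] := adm.
  - exact: cK.
  - by move=> t t0; rewrite /w /h; ring.
  - have [imu _] := optimal_integrable.
    by rewrite mulr0 addr0 /setup_cost EFin_Rintegral.
have sg t : sigma t * (g t - u t) <= 0 \/ ~ 0 <= t.
  have [t0|] := leP 0 t; last by rewrite ltNge => /negP; right.
  left; rewrite /g; have /andP[u0 u1] := u01 t0; case: ltP => s0.
    by rewrite nmulr_rle0// subr_ge0.
  by rewrite sub0r mulrN oppr_le0 mulr_ge0.
have ish : leb.-integrable hl (EFin \o (fun t => sigma t * h t)).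
  by apply: integrable_hl_mul_bounded h1 => //; exact: loc_int_measurable.
rewrite add0r in H0.
(* By the choice of [g] the integrand is nonpositive, while optimality makes its integral
   nonnegative; so it vanishes almost everywhere. *)
have := @Rintegral_le0_ae_eq0 _ _ R leb _ _ _ ish _ H0.
move=> /(_ mhl); have sh t : hl t -> sigma t * h t <= 0.
  rewrite /= in_itv/= andbT => t0; rewrite /h /a.
  rewrite (_ : _ * _ = (expR (- K t) * K t) * (sigma t * (g t - u t))); last by ring.
  rewrite mulr_ge0_le0 ?mulr_ge0 ?expR_ge0 ?K_ge0//.
  by have [] := sg t.
move=> /(_ sh); apply: aeS1 => t; rewrite /= in_itv/= andbT => H t0 z z0 z1.
have {H} : expR (- K t) * (K t * (sigma t * (g t - u t))) = 0.
  by rewrite -[RHS](H t0) /h /a; ring.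
move=> /eqP; rewrite mulf_eq0 gt_eqF ?expR_gt0//= => /eqP E.
rewrite (_ : K t * sigma t * u t = K t * sigma t * g t); last first.
  by apply/eqP; rewrite -subr_eq0 -oppr_eq0 -E; apply/eqP; ring.
rewrite -!mulrA ler_wpM2l ?K_ge0// /g; case: ltP => s0.
  by rewrite ler_wnM2l// ltW.
by rewrite mulr0 mulr_ge0.
Qed.

Let mu0 : mu (`]-oo, 0%R[%classic : set R) = 0%E. Proof. by have [] := adm. Qed.

(** Marginal cost of a unit of capital bought at [t]: its price plus its later effect on the running
    cost. In terms of the multiplier it is [expR (- delta * t) * r - l2 t]. *)
Let value t := expR (- delta * t) * r + discounted_tail gamma (fun t => sigma t * u t) t.

Let sigma_u_int : leb.-integrable hl (EFin \o (fun t => sigma t * u t)).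
Proof.
apply: (integrable_hl_mul_bounded (M := 1) sigma_int mu_u) => t t0.
by have /andP[? ?] := u01 t0; rewrite ger0_norm.
Qed.

Let setup_ge0 t : 0 <= expR (- delta * t) * r.
Proof. by rewrite mulr_ge0// expR_ge0. Qed.

Let measurable_setup : measurable_fun hl (fun t => (expR (- delta * t) * r)%:E).
Proof.
apply/measurable_EFinP; apply: loc_int_measurable; apply: cont0_loc_int.
by apply: cont0M; [exact: cont0_expRN|exact: cont0_cst].
Qed.

(** Used with [q = 1] for added and [q = -1] for removed investment. The induced change of effort is
    bounded because [nu] is finite and [u] takes values in [[0, 1]]. *)
Lemma impulse_variation (nu : {finite_measure set (measurableTypeR R) -> \bar R}) (q rho : R) :
  (forall e, 0 < e -> e <= 1 -> exists mu' : {measure set (measurableTypeR R) -> \bar R},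
    [/\ mu' (`]-oo, 0%R[%classic : set R) = 0%E,
        (forall t, 0 < t -> mu' (`[0%R, t]%classic : set R) =
          (fine (mu (`[0%R, t]%classic : set R)) + (e * q) * fine (nu (`[0%R, t]%classic : set R)))%:E)
      & (\int[mu']_(t in hl) (expR (- delta * t) * r)%:E = (setup_cost + e * rho)%:E)%E]) ->
  0 <= rho + q * \int[nu]_(t in hl) discounted_tail gamma (fun t => sigma t * u t) t.
Proof.
move=> pert; have mhl := @measurable_hl R.
have li : loc_int (impulse gamma nu) := loc_int_impulse gamma_ge0 nu.
have [isu <-] := impulse_pairing gamma_ge0 nu sigma_u_int.
rewrite -RintegralZl//.
have -> : \int[leb]_(t in hl) (q * (sigma t * u t * impulse gamma nu t)) =
          \int[leb]_(t in hl) (sigma t * (q * (u t * impulse gamma nu t))).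
  by apply: eq_Rintegral => t _; ring.
apply: (@optimal_variation _ (`|q| * fine (nu setT))).
- apply: loc_intZ; exact: loc_int_effort.
- move=> t t0; have /andP[? ?] := u01 t0.
  rewrite normrM ler_wpM2l// normrM !ger0_norm ?impulse_ge0//.
  by rewrite -[leRHS]mul1r ler_pM ?impulse_ge0 ?impulse_le.
- move=> e e0 e1; have [mu' [n1 n2 n3]] := pert e e0 e1.
  exists (fun t => K t + (e * q) * impulse gamma nu t), u, mu'; split=> //.
  + by apply: capital_impulse n2.
  + by move=> t t0; rewrite /w; ring.
Qed.

(** Integration against a Dirac mass evaluates the tail at the single point [a], so the inequality
    holds at every time and not just almost everywhere. *)
Lemma value_ge0 a : 0 <= a -> 0 <= value a.
Proof.
move=> a0; have mhl := @measurable_hl R.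
pose nu : {finite_measure set (measurableTypeR R) -> \bar R} := \d_ (a : measurableTypeR R).
have hla : a \in hl by rewrite inE/= in_itv/= a0.
have nu_hl f : measurable_fun hl f -> (\int[nu]_(t in hl) (f t)%:E = (f a)%:E)%E.
  move=> mf; rewrite integral_dirac//; last exact/measurable_EFinP.
  by rewrite diracE hla mul1e.
have nuE A : nu A = (\1_A a)%:E by [].
have := @impulse_variation nu 1 (expR (- delta * a) * r).
rewrite mul1r /Rintegral nu_hl; last first.
  by apply: loc_int_measurable; apply: cont0_loc_int; exact: cont0_discounted_tail.
apply=> e e0 e1; pose e' := NngNum (ltW e0).
exists (measure_add mu (mscale e' nu)); split.
- rewrite [LHS]measure_addE mu0 add0e.
  transitivity (e%:E * nu `]-oo, 0%R[%classic)%E; first by [].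
  rewrite nuE indicE memNset ?mule0//=.
  by rewrite in_itv/=; apply/negP; rewrite -leNgt.
- move=> t t0; rewrite [LHS]measure_addE /mscale/= mulr1.
  have [_ _ hK] := cK; have [m -> _] := hK t t0.
  by [].
- rewrite ge0_integral_measure_add//; last by move=> t _; rewrite lee_fin.
  rewrite ge0_integral_mscale//; last by move=> t _; rewrite lee_fin.
  rewrite nu_hl; last exact/measurable_EFinP.
  have [imu _] := optimal_integrable.
  by rewrite EFinD EFinM /setup_cost EFin_Rintegral.
Qed.

(** The total mass of [mu] may be infinite, whereas [impulse_variation] takes a finite measure;
    hence the restriction to [[0, n]], followed by a countable union of null sets. *)
Lemma value_ae0 : {ae mu, forall t, 0 <= t -> value t = 0}.
Proof.
have mhl := @measurable_hl R.
have [imu _] := optimal_integrable.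
suff H n : {ae mu, forall t, `[0%R, n%:R]%classic t -> value t = 0}.
  have := ae_foralln H; apply: filterS => t {}H t0.
  have [n tn] : exists n : nat, t <= n%:R.
    by exists (Num.truncn t).+1; rewrite ltW// truncnS_gt.
  by apply: (H n); rewrite /= in_itv/= t0.
pose I : set (measurableTypeR R) := `[0%R, n%:R]%classic.
have mI : measurable I by exact: measurable_itv.
have mIC : measurable (~` I) by exact: measurableC.
have Ifin : (mu I < +oo)%E by exact: capital_measure_lty cK.
pose nu : {finite_measure set (measurableTypeR R) -> \bar R} := mfrestr mI Ifin.
pose setup_on (m : {measure set (measurableTypeR R) -> \bar R}) :=
  (\int[m]_(t in hl) (expR (- delta * t) * r)%:E)%E.
(* The setup cost is the sum of a part [a] on [[0, n]] and a part [b] outside, both finite because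
   the total is. Removing the fraction [e] of the first part saves [e * a], hence [rho = - a]. *)
have split_mu : setup_on mu = (setup_on nu + setup_on (mrestr mu mIC))%E.
  rewrite /setup_on -ge0_integral_measure_add//; last by move=> t _; rewrite lee_fin.
  apply: eq_measure_integral => A mA _.
  rewrite [RHS]measure_addE /nu/= /mfrestr /mrestr -measureU//; [|exact: measurableI|exact: measurableI|].
    by rewrite -setIUr setUv setIT.
  by rewrite setIACA setICr setI0.
have mu_fin : setup_on mu = setup_cost%:E by rewrite /setup_cost EFin_Rintegral.
have nu_ge0 : (0 <= setup_on nu)%E by apply: integral_ge0 => t _; rewrite lee_fin.
have r_ge0' : (0 <= setup_on (mrestr mu mIC))%E by apply: integral_ge0 => t _; rewrite lee_fin.
have [a aE] : exists a, setup_on nu = a%:E.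
  by move: split_mu nu_ge0 r_ge0'; rewrite mu_fin; case: (setup_on nu) => [a||]; [exists a|case: (setup_on _)|].
have [b bE] : exists b, setup_on (mrestr mu mIC) = b%:E.
  by move: split_mu; rewrite mu_fin aE; case: (setup_on _) => [b||]; [exists b| |].
have Pab : setup_cost = a + b by move: split_mu; rewrite mu_fin aE bE -EFinD => -[].
have := @impulse_variation nu (-1) (- a).
have inu : nu.-integrable hl (EFin \o (fun t => expR (- delta * t) * r)).
  apply/integrableP; split=> //.
  rewrite (_ : (\int[nu]_(t in hl) _)%E = setup_on nu); first by rewrite aE ltry.
  by apply: eq_integral => t _; rewrite /= ger0_norm.
have itail : nu.-integrable hl (EFin \o discounted_tail gamma (fun t => sigma t * u t)).
  exact: (integrable_discounted_tail nu gamma_ge0 sigma_u_int).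
have -> : - a + -1 * \int[nu]_(t in hl) discounted_tail gamma (fun t => sigma t * u t) t
        = \int[nu]_(t in hl) (-1 * value t).
  rewrite RintegralZl//; last exact: integrable_EFinD.
  rewrite RintegralD// /Rintegral -/(setup_on nu) aE /=; ring.
move=> H; have {}H : 0 <= \int[nu]_(t in hl) (-1 * value t).
  apply: H => e e0 e1; pose e' := NngNum (ltW e0).
  have e1' : 0 <= 1 - e by rewrite subr_ge0.
  (* The weight [1 - e] is nonnegative since [e <= 1], so reducing [mu] on [[0, n]] leaves a
     measure. *)
  exists (measure_add (mscale (NngNum e1') nu) (mrestr mu mIC)); split.
  - have z (A : set (measurableTypeR R)) : measurable A -> mu ((`]-oo, 0%R[%classic : set R) `&` A) = 0%E.
      move=> mA; apply/eqP; rewrite -measure_le0 -mu0.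
      by apply: le_measure; rewrite ?inE//; apply: measurableI => //; exact: measurable_itv.
    rewrite [LHS]measure_addE.
    transitivity ((1 - e)%:E * mu ((`]-oo, 0%R[%classic : set R) `&` I)
                  + mu ((`]-oo, 0%R[%classic : set R) `&` ~` I))%E; first by [].
    by rewrite !z// mule0 adde0.
  - move=> t t0; rewrite [LHS]measure_addE.
    set A : set (measurableTypeR R) := `[0%R, t]%classic.
    transitivity ((1 - e)%:E * mu (A `&` I) + mu (A `&` ~` I))%E; first by [].
    have mA : measurable A by exact: measurable_itv.
    rewrite -[nu A]/(mu (A `&` I)).
    have [_ _ hK] := cK; have [m mE _] := hK t t0.
    have muA : mu A = (mu (A `&` I) + mu (A `&` ~` I))%E.
      rewrite -measureU//; [|exact: measurableI|exact: measurableI|].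
        by rewrite -setIUr setUv setIT.
      by rewrite setIACA setICr setI0.
    have : mu A = m%:E by exact: mE.
    rewrite muA; have := measure_ge0 mu (A `&` I); have := measure_ge0 mu (A `&` ~` I).
    case: (mu (A `&` I)) => [a1||]; case: (mu (A `&` ~` I)) => [a2||] //= _ _ _.
    by rewrite -EFinM -EFinD; congr EFin; ring.
  - rewrite ge0_integral_measure_add//; last by move=> t _; rewrite lee_fin.
    rewrite ge0_integral_mscale//; last by move=> t _; rewrite lee_fin.
    rewrite -/(setup_on nu) -/(setup_on (mrestr mu mIC)) aE bE Pab -EFinM -EFinD.
    by congr EFin => /=; ring.
have ival : nu.-integrable hl (EFin \o (fun t => -1 * value t)).
  by apply: integrable_EFinZ => //; exact: integrable_EFinD.
have {H} := @Rintegral_le0_ae_eq0 _ _ R nu _ _ mhl ival _ H.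
have nval t : hl t -> -1 * value t <= 0.
  by rewrite /= in_itv/= andbT => t0; rewrite mulN1r oppr_le0 value_ge0.
move=> /(_ nval) [N [mN N0 HN]].
(* A null set of the restricted measure becomes null for [mu] after intersection with [I]. *)
exists (N `&` I); split; first exact: measurableI.
  exact: N0.
move=> t /= /not_implyP[It vt]; split; last exact: It.
apply: HN => /= H; apply: vt.
have tl : hl t by move: It; rewrite /= !in_itv/= => /andP[->].
by have := H tl; rewrite mulN1r => /eqP; rewrite oppr_eq0 => /eqP.
Qed.
End adjoint_variation.

(** With [eta = 1], [Htilde] is affine in the control with slope [- K t * sigma t], so the last
    clause is its maximum condition. The third and fourth clauses say that the marginal cost of
    capital is nonnegative, and zero where investment takes place. *)
Lemma interior_maximum_principle : exists l1 l2 : R -> R,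
  [/\ ac_primitive l1 (fun t => - l1 t * (F' (x t) - u t * K t) - expR (- delta * t) * p * (u t * K t)),
      ac_primitive l2 (fun t => gamma * l2 t + (l1 t * x t + expR (- delta * t) * (c - p * x t)) * u t),
      (forall t, 0 <= t -> l2 t <= expR (- delta * t) * r),
      {ae mu, forall t, 0 <= t -> l2 t = expR (- delta * t) * r}
    & {ae leb, forall t, 0 <= t -> forall z : R, 0 <= z -> z <= 1 ->
        K t * (l1 t * x t + expR (- delta * t) * (c - p * x t)) * u t <=
        K t * (l1 t * x t + expR (- delta * t) * (c - p * x t)) * z}].
Proof.
have x_gt0 t : 0 <= t -> 0 < x t by move=> /Hx[].
have x_le t : 0 <= t -> x t <= xbar by move=> /Hx[].
have [l1 [B B0 [pl1 Hl1]]] := adjoint_exists F_C2 xbar_gt0 F_0 F''_lt0 delta_gt0 p_ge0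
  px lw (aeT w_ge0) x_gt0 x_le.
pose g t := (l1 t * x t + expR (- delta * t) * (c - p * x t)) * u t.
have ig : leb.-integrable hl (EFin \o g).
  apply: (integrable_hl_mul_bounded (M := 1) (switching_integrable delta_gt0 p_ge0 c_ge0 px Hx pl1 Hl1) mu_u).
  by move=> t t0; have /andP[? ?] := u01 t0; rewrite ger0_norm.
exists l1, (fun t => - discounted_tail gamma g t); split.
- exact: pl1.
- have := acpN (acp_discounted_tail gamma_ge0 ig).
  by apply: acp_eqr => t _; rewrite /g; ring.
- by move=> t t0; rewrite -subr_ge0 opprK; have H := value_ge0 B0 pl1 Hl1 t0; exact: H.
- have H0 := value_ae0 B0 pl1 Hl1.
  apply: filterS H0; first exact: (ae_filter_ringOfSetsType mu).
  by move=> t H t0; have /eqP := H t0; rewrite addrC addr_eq0 => /eqP ->; rewrite opprK.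
- by apply: aeS1 (optimal_control_ae B0 pl1 Hl1).
Qed.
End optimal_process.

(** * Multipliers for an arbitrary initial stock *)

Lemma optimal_clip (R : realType) (F : R -> R) (delta gamma p c r x0 K0 : R) (x K u : R -> R)
    (mu : {measure set (measurableTypeR R) -> \bar R}) :
  optimal F delta gamma p c r x0 K0 x K u mu ->
  optimal F delta gamma p c r x0 K0 x K (clip u) mu.
Proof.
move=> [adm opt]; split; first exact: admissible_clip.
move=> y L v nu aL; have /admissibleE[[mu_u u01] _ [_ [_ px]] [_ lK _]] := adm.
rewrite cost_clip //; first exact: opt.
exact: cont0_acp px.
Qed.

Unset Implicit Arguments.

Theorem mainTheorem4 (R : realType) (F F' F'' : R -> R)
    (xbar delta gamma p c r : R)
    (F_C2 : is_C2_halfline F F' F'')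
    (xbar_gt0 : 0 < xbar)
    (F_0 : F 0 = 0) (F_xbar : F xbar = 0)
    (F_gt0 : forall x : R, 0 < x -> x < xbar -> 0 < F x)
    (F''_lt0 : forall x : R, 0 <= x -> x <= xbar -> F'' x < 0)
    (delta_gt0 : 0 < delta) (gamma_ge0 : 0 <= gamma)
    (p_ge0 : 0 <= p) (c_ge0 : 0 <= c) (r_ge0 : 0 <= r)
    (x0 K0 : R) (x0_ge0 : 0 <= x0) (x0_le : x0 <= xbar) (K0_ge0 : 0 <= K0)
    (x K u : R -> R) (mu : {measure set (measurableTypeR R) -> \bar R})
    (opt : optimal F delta gamma p c r x0 K0 x K u mu) :
  exists (l10 l20 eta : R) (l1 l2 : R -> R),
    (l10 ^+ 2 + l20 ^+ 2 + eta ^+ 2 <> 0 /\ 0 <= eta) /\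
    caratheodory l1
      (fun t => - l1 t * (F' (x t) - u t * K t)
                - eta * expR (- delta * t) * p * u t * K t) l10 /\
    caratheodory l2
      (fun t => l1 t * x t * u t + gamma * l2 t
                + eta * expR (- delta * t) * (c - p * x t) * u t) l20 /\
    (forall t : R, 0 <= t -> l2 t - eta * expR (- delta * t) * r <= 0) /\
    {ae mu, forall t : R, 0 <= t -> l2 t - eta * expR (- delta * t) * r = 0} /\
    {ae @lebesgue_measure R, forall t : R, 0 <= t ->
      is_max
        [set Htilde F delta gamma p c t (x t) (K t) w (l1 t) (l2 t) eta
          | w in `[0, 1]]
        (Htilde F delta gamma p c t (x t) (K t) (u t) (l1 t) (l2 t) eta)}.

Proof.
have /admissibleE[[mu_u u01] _ [x_ge0 [x_0 px]] cK] := opt.1.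
have lw : loc_int (fun t => clip u t * K t).
  have [_ lK _] := cK; apply: loc_int_effort => //; first exact: measurable_clip.
  by move=> t _; exact: clip01.
(* The case [x0 = 0] is separate because the construction for a positive stock takes logarithms of
   [x] and divides by it. *)
move: x0_ge0; rewrite le_eqVlt => /orP[/eqP x00|x0_gt0].
  have x_eq0 t : 0 <= t -> x t = 0.
    have w0 : {ae @lebesgue_measure R, forall t, 0 <= t -> 0 <= u t * K t}.
      apply: aeS1 u01 => s H s0; have /andP[us0 _] := H s0.
      by rewrite mulr_ge0// (capital_nonneg gamma_ge0 K0_ge0 cK).
    by move=> t0; apply: (trajectory_eq0 F_C2 F_0 px w0 x_ge0) => //; rewrite x_0.
  (* Coefficient of the adjoint equation at stock 0 with [eta = 0], using the clipped control, for
     which the effort is locally integrable. *)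
  pose a t := - (F' 0 - clip u t * K t).
  have la : loc_int a.
    have l0 : loc_int (fun _ : R => F' 0) by apply: cont0_loc_int; exact: cont0_cst.
    have := loc_intZ (-1) (loc_intB l0 lw).
    by rewrite (_ : (fun t => -1 * _) = a)//; apply/funext => t; rewrite mulN1r.
  have pl1 := acp_expR (acp_integral la).
  exists 1, 0, 0, (fun t => expR (\int[@lebesgue_measure R]_(s in `[0, t]) a s)), (fun=> 0).
  split; first by split=> //; rewrite expr1n !expr0n/= !addr0; apply/eqP; rewrite oner_eq0.
  split.
    apply/caratheodoryE; split; first by rewrite integral0_itv expR0.
    apply: acp_eq pl1; apply: aeS1 u01 => t H t0.
    by rewrite /a clip_eq ?H// x_eq0//; ring.
  split.
    apply/caratheodoryE; split=> //; have := @acp_cst R 0.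
    by apply: acp_eqr => t t0; rewrite x_eq0//; ring.
  split; first by move=> t _; rewrite !mul0r subr0.
  split.
    by apply: aeW => t _; rewrite !mul0r subr0.
  apply: aeS1 u01 => t H t0; split.
    by exists (u t) => //; rewrite /= in_itv/= H.
  (* With stock and [eta] both 0 the control drops out of [Htilde], so every value of it is
     maximal. *)
  move=> _ [z _ <-]; rewrite /Htilde x_eq0//.
  by rewrite !mulr0 !subr0 !mul0r.
have [l1 [l2 [pl1 pl2 Hle Heq Hmax]]] := interior_maximum_principle F_C2 xbar_gt0 F_0 F_xbar
  F_gt0 F''_lt0 delta_gt0 gamma_ge0 p_ge0 c_ge0 r_ge0 x0_gt0 x0_le K0_ge0
  (optimal_clip opt) (fun t _ => clip01 u t).
exists (l1 0), (l2 0), 1, l1, l2; split.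
  split; last exact: ler01.
  by apply/eqP; rewrite gt_eqF// expr1n ltr_wpDl// addr_ge0// sqr_ge0.
split.
  apply/caratheodoryE; split=> //; apply: acp_eq pl1.
  by apply: aeS1 u01 => t H t0; rewrite clip_eq ?H//; ring.
split.
  apply/caratheodoryE; split=> //; apply: acp_eq pl2.
  by apply: aeS1 u01 => t H t0; rewrite clip_eq ?H//; ring.
split; first by move=> t t0; rewrite mul1r subr_le0 Hle.
split.
  apply: filterS Heq; first exact: (ae_filter_ringOfSetsType mu).
  by move=> t H t0; rewrite mul1r H// subrr.
apply: aeS2 u01 Hmax => t H {}Hmax t0; split.
  by exists (u t) => //; rewrite /= in_itv/= H.
move=> _ [z zI <-]; have /andP[z0 z1] : 0 <= z <= 1 by move: zI; rewrite /= in_itv.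
have := Hmax t0 z z0 z1; rewrite clip_eq ?H// /Htilde; lra.
Qed.
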